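(* (Spectral Theorem for representations) Let $\pi$ be a non-degenerate representation of a commutative $*$-algebra $A$ in a Hilbert space $H\neq\{0\}$. There exists a unique resolution of identity $P$ on $\mathrm{sp}(\pi)$, acting on $H$, such that $$\pi(a)=\int_{\mathrm{sp}(\pi)}\hat a|_{\mathrm{sp}(\pi)}\,dP\quad\text{(in norm)}\qquad\text{for all }a\in A.$$ Moreover $\pi'=P'$, and the support of $P$ is all of $\mathrm{sp}(\pi)$.
   Context: All algebras and Hilbert spaces are complex; $A$ is a $*$-algebra without any norm or unit assumed. A representation of $A$ in the Hilbert space $H$ is a $*$-algebra homomorphism $\pi:A\to B(H)$ (equivalently, an algebra homomorphism into linear operators on $H$ with $\langle\pi(a)x,y\rangle=\langle x,\pi(a^* )y\rangle$). It is non-degenerate if $\pi(a)x=0$ for all $a\in A$ implies $x=0$. Spectrum of $\pi$: let $B$ be the norm closure of $\pi(A)$ in $B(H)$, a commutative C*-algebra, and let $\Delta(B)$ be the set of non-zero multiplicative linear functionals on $B$. Then $\mathrm{sp}(\pi)=\{\tau\circ\pi:\tau\in\Delta(B)\}$, a set of non-zero Hermitian multiplicative linear functionals on $A$, equipped with the topology of pointwise convergence on $A$; it is a locally compact Hausdorff space. For $a\in A$, $\hat a(\sigma)=\sigma(a)$ for $\sigma \in \mathrm{sp}(\pi)$. A spectral measure $P$ defined on a $\sigma$-algebra $\mathcal{E}$ on a set $\Omega\ne\varnothing$ and acting on $H$ is a map $P:\mathcal{E}\to B(H)$ such that each $P(\omega)$ is an orthogonal projection, $P(\Omega)=1$, and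 $\omega\mapsto\langle P(\omega)x,x\rangle$ is a measure for every $x\in H$. A resolution of identity on a locally compact Hausdorff space $\Omega\neq\varnothing$ is a spectral measure on the Borel $\sigma$-algebra of $\Omega$ such that all measures $\langle Px,x\rangle$ are inner regular ($\mu(\omega)=\sup\{\mu(K):K\subset\omega\text{ compact}\}$). Its support is $\Omega\setminus\omega$, where $\omega$ is the largest open set with $P(\omega)=0$. For a bounded measurable complex function $f$ and $b\in B(H)$, $b=\int f\,dP$ (in norm) means that $\|b-I_P(h)\|\leq|f-h|_\infty$ (supremum norm) for every measurable step function $h$, where $I_P$ is the linear map on step functions with $I_P(1_\omega)=P(\omega)$. $\pi'$ is the set of operators in $B(H)$ commuting with all $\pi(a)$, $a\in A$; $P'$ is the set of operators in $B(H)$ commuting with all $P(\omega)$. *)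

(* Defs.v *)
From HB Require Import structures.
From mathcomp Require Import all_boot all_order all_algebra.
From mathcomp Require Import sesquilinear.
From mathcomp Require Export complex.
From mathcomp Require Import all_classical all_reals all_analysis.

Set Implicit Arguments.
Unset Strict Implicit.
Unset Printing Implicit Defensive.

Import Order.TTheory GRing.Theory Num.Theory.
Import numFieldNormedType.Exports.

Local Open Scope classical_set_scope.
Local Open Scope complex_scope.
Local Open Scope ring_scope.

(* Neither a unit nor a norm is assumed, so that the algebra is built on top of
   [lmodType] and not on the (unital) algebra structures of the library. *)
HB.mixin Record Lmodule_isComStarAlgebra (R : realType) A
    & GRing.Lmodule R[i] A := {
  amul : A -> A -> A ;
  astar : A -> A ;
  amulA : associative amul ;
  amulC : commutative amul ;
  amulDl : left_distributive amul +%R ;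
  amulZl : forall (k : R[i]) (a b : A), amul (k *: a) b = k *: amul a b ;
  astarK : involutive astar ;
  astarD : {morph astar : a b / a + b} ;
  astarZ : forall (k : R[i]) (a : A), astar (k *: a) = k^* *: astar a ;
  astarM : forall a b : A, astar (amul a b) = amul (astar b) (astar a)
}.

#[short(type="comStarAlgType")]
HB.structure Definition ComStarAlgebra (R : realType) :=
  {A of GRing.Lmodule R[i] A & Lmodule_isComStarAlgebra R A}.

(* The inner product is linear in its first argument. *)
HB.mixin Record NormedModule_isHilbert (R : realType) H
    & CompleteNormedModule R[i] H := {
  inner : {dot H for @Num.conj R[i]} ;
  inner_norm : forall x : H, `|x| ^+ 2 = inner x x
}.

#[short(type="hilbertType")]
HB.structure Definition Hilbert (R : realType) :=
  {H of CompleteNormedModule R[i] H & NormedModule_isHilbert R H}.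

(* The norms of the library on complex spaces take their values in [R[i]], in
   the nonnegative reals. *)
Definition rnorm (R : realType) (V : normedZmodType R[i]) (x : V) : R :=
  complex.Re `|x|.

Section Operators.
Context {R : realType} {H : hilbertType R}.
Implicit Types (S T p : H -> H) (X : set (H -> H)).

Definition BH : set (H -> H) :=
  [set T | linear T /\ continuous T].

Definition opnorm T : R := sup [set rnorm (T x) | x in [set x | rnorm x <= 1]].

Definition norm_closure X : set (H -> H) :=
  [set T | BH T /\
    forall e : R, 0 < e -> exists2 S, X S & opnorm (T - S) < e].

Definition is_adjoint S T := forall x y : H, inner (S x) y = inner x (T y).

Definition orthogonal_projection p :=
  [/\ BH p, p \o p = p & is_adjoint p p].

Definition commutant X : set (H -> H) :=
  [set T | BH T /\ forall S, X S -> T \o S = S \o T].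

(* Non-zero multiplicative linear functionals on an algebra [X] of operators,
   as functions on all operators of which only the values on [X] matter. *)
Definition character X (tau : (H -> H) -> R[i]) :=
  [/\ forall S T, X S -> X T -> tau (S + T) = tau S + tau T,
      forall (k : R[i]) S, X S -> tau (k *: S) = k * tau S,
      forall S T, X S -> X T -> tau (S \o T) = tau S * tau T
    & exists2 S, X S & tau S != 0].

End Operators.

Section Representations.
Context {R : realType} {A : comStarAlgType R} {H : hilbertType R}.
Implicit Types pi : A -> H -> H.

Definition representation pi :=
  [/\ forall a, BH (pi a),
      linear pi,
      forall a b, pi (amul a b) = pi a \o pi b
    & forall a, is_adjoint (pi a) (pi (astar a))].

Definition nondegenerate_rep pi :=
  forall x : H, (forall a, pi a x = 0) -> x = 0.

Definition sp_set pi : set {ptws A -> R[i]^o} :=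
  [set sigma | exists2 tau, character (norm_closure (range pi)) tau
                          & sigma = (fun a => tau (pi a))].

(* [set_type] carries the subspace topology, here inherited from the topology
   of pointwise convergence. *)
Definition sp pi : topologicalType := set_type (sp_set pi).

Definition hat pi (a : A) : sp pi -> R[i] :=
  fun sigma => (set_val sigma : A -> R[i]) a.

End Representations.

Arguments hat {R A H} pi a.

(* The measurable structures of the library live on pointed types, and a
   spectrum has no distinguished point (it is even empty for [pi = 0]); hence
   the explicit sigma-algebras [E] below. *)
Section SpectralMeasures.
Context {R : realType} {H : hilbertType R} {Omega : Type}.
Implicit Types (E : set (set Omega)) (P : set Omega -> H -> H).
Implicit Types (f h : Omega -> R[i]).

Definition is_measure E (mu : set Omega -> \bar R) :=
  [/\ mu set0 = 0%E,
      forall w, E w -> (0 <= mu w)%E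
    & forall F : nat -> set Omega, (forall n, E (F n)) -> trivIset setT F ->
        (fun n => (\sum_(0 <= i < n) mu (F i))%E) @ \oo -->
          mu (\bigcup_n F n)].

(* For a projection [P w], the number [inner (P w x) x] is real. *)
Definition diag_measure P (x : H) (w : set Omega) : \bar R :=
  (complex.Re (inner (P w x) x))%:E.

(* Only the values of [P] on [E] matter. *)
Definition spectral_measure E P :=
  [/\ [set: Omega] !=set0, sigma_algebra setT E,
      forall w, E w -> orthogonal_projection (P w),
      P setT = id
    & forall x, is_measure E (diag_measure P x)].

Definition step_fun E h :=
  finite_set (range h) /\ forall z, E (h @^-1` [set z]).

Definition is_step_integral E P (I : (Omega -> R[i]) -> H -> H) :=
  (forall (k : R[i]) f h, step_fun E f -> step_fun E h ->
     I (k *: (f : Omega -> R[i]^o) + h) = k *: I f + I h) /\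
  (forall w, E w -> I \1_w = P w).

Definition supnorm f : R := sup (range (fun s => rnorm (f s : R[i]^o))).

Definition bounded_measurable E f :=
  (exists M : R, forall s, rnorm (f s : R[i]^o) <= M) /\
  (forall U : set R[i]^o, open U -> E (f @^-1` U)).

Definition is_integral_in_norm E P f (b : H -> H) :=
  [/\ bounded_measurable E f, BH b
    & exists2 I, is_step_integral E P I
        & forall h, step_fun E h -> opnorm (b - I h) <= supnorm (f - h)].

End SpectralMeasures.

Section ResolutionOfIdentity.
Context {R : realType} {H : hilbertType R} {Omega : topologicalType}.
Implicit Types (P : set Omega -> H -> H).

Definition borel : set (set Omega) := <<s open>>.

Definition inner_regular (mu : set Omega -> \bar R) :=
  forall w, borel w ->
    mu w = ereal_sup [set mu K | K in [set K | compact K /\ K `<=` w]].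

Definition resolution_of_identity P :=
  [/\ hausdorff_space Omega, locally_compact [set: Omega],
      spectral_measure borel P
    & forall x, inner_regular (diag_measure P x)].

Definition is_support P (S : set Omega) :=
  exists w : set Omega,
    [/\ open w, P w = 0, (forall U, open U -> P U = 0 -> U `<=` w)
      & S = ~` w].

End ResolutionOfIdentity.

Arguments borel : clear implicits.

Definition represents (R : realType) (A : comStarAlgType R) (H : hilbertType R)
    (pi : A -> H -> H) (P : set (sp pi) -> H -> H) :=
  resolution_of_identity P /\
  forall a : A, is_integral_in_norm (borel (sp pi)) P (hat pi a) (pi a).

(* Main.v *)
Require Import Defs.
From HB Require Import structures.
From mathcomp Require Import all_boot all_order all_algebra.
From mathcomp Require Import sesquilinear.
From mathcomp Require Import all_classical all_reals all_analysis.
From mathcomp Require Import ring lra.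

(** Let [B] be the norm closure of [range pi]. The spectral measure is built from
    the ideals of [B]. What makes this possible is a supply of characters that
    know about vectors. If [h] in [B] is self-adjoint and
    [<h x, x>] is negative, then some character [tau] of [B] satisfies
    [tau h < 0] and [tau g = 0] for all [g] with [g x = 0]
    ([closure_vector_character]). Indeed the self-adjoint operators that are
    positive on the cyclic subspace of [x] form an archimedean cone, which is
    closed under products by an iteration of F. Riesz ([pos_comp]), so that the
    representation theorem of Kadison and Dubois ([archimedean_character])
    applies. Consequently the Gelfand transform is isometric on self-adjoint
    elements ([gelfand_norm]), [B] contains positive parts ([closure_pos]), and
    the spectrum is a locally compact Hausdorff space with enough elements of [B]
    to separate points from closed sets ([sp_urysohn]).

    For [U] open let [popen U] be the projection whose kernel consists of the
    vectors killed by the elements of [B] supported in [U]. Then [popen] carries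
    intersections to products, and unions to suprema: the latter, [null_bigcup],
    is where characters that know about vectors come in. Call [spec w] the
    infimum of the [popen U] over the open sets [U] around [w]. For a vector [x]
    the sets that can be squeezed between a closed and an open set, up to
    arbitrarily small measure [|popen (U \ C) x|^2], form a sigma-algebra that
    contains the open sets ([borel_regular]); on the Borel sets [spec] is
    therefore countably additive, and it is a resolution of the identity by
    [tight].

    The bridge from [spec] to [pi] is [spec_estimate]: if the Gelfand transform
    of [g] is within [d] of the constant [c] on [w], then
    [|g y - c y| <= d |y|] for all [y] in the range of [spec w]. Applied to the
    level sets of a step function this is the formula for [pi a] as an integral
    in norm.

    Any spectral measure [Q] that represents [pi] satisfies the same estimate.
    For [C] closed and [K] compact disjoint from it, it follows that the ranges
    of [spec C] and [Q K] are orthogonal, because an element of [B] that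
    vanishes on [C] kills the former and is invertible on the latter, locally
    on [K] ([represents_disjoint]). With the regularity of both measures this
    yields [Q = spec]. An operator that commutes with [range pi] preserves the
    ranges of the [popen U], hence commutes with [spec]; the converse is an
    approximation by step functions. Finally [spec U = 0] with [U] open and
    nonempty would annihilate the nonzero elements of [B] supported in [U]. *)

Set Implicit Arguments.
Unset Strict Implicit.
Unset Printing Implicit Defensive.

Import Order.TTheory GRing.Theory Num.Theory.
Import numFieldNormedType.Exports.

Local Open Scope classical_set_scope.
Local Open Scope complex_scope.
Local Open Scope ring_scope.

(** * Real-valued norms and inner products *)

Section Norm.
Context {R : realType}.
Implicit Types V : normedModType R[i].

Lemma rnormE V (x : V) : `|x| = (rnorm x)%:C.
Proof. by rewrite /rnorm RRe_real // ger0_real. Qed.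

Lemma cnormE (z : R[i]) : `|z| = (rnorm (z : R[i]^o))%:C.
Proof. exact: (@rnormE R[i]^o). Qed.

Lemma rnorm_ge0 V (x : V) : 0 <= rnorm x.
Proof. by rewrite -lecR -rnormE; exact: normr_ge0. Qed.

Lemma rnormD V (x y : V) : rnorm (x + y) <= rnorm x + rnorm y.
Proof. by rewrite -lecR rmorphD /= -!rnormE ler_normD. Qed.

Lemma rnormN V (x : V) : rnorm (- x) = rnorm x.
Proof. by rewrite /rnorm normrN. Qed.

Lemma rnormB V (x y : V) : rnorm (x - y) = rnorm (y - x).
Proof. by rewrite -rnormN opprB. Qed.

Lemma rnorm0 V : rnorm (0 : V) = 0.
Proof. by rewrite /rnorm normr0. Qed.

Lemma rnorm0_eq0 V (x : V) : rnorm x = 0 -> x = 0.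
Proof. by move=> x0; apply: normr0_eq0; rewrite rnormE x0. Qed.

Lemma rnorm_gt0 V (x : V) : x != 0 -> 0 < rnorm x.
Proof.
by move=> x0; rewrite lt_def rnorm_ge0 andbT; apply: contra_neq x0 => /rnorm0_eq0.
Qed.

Lemma rnorm_le0 V (x : V) : rnorm x <= 0 -> x = 0.
Proof. by move=> x0; apply/rnorm0_eq0/eqP; rewrite eq_le x0 rnorm_ge0. Qed.

Lemma rnormZ V (k : R[i]) (x : V) : rnorm (k *: x) = rnorm (k : R[i]^o) * rnorm x.
Proof. by apply/complexI; rewrite rmorphM /= -!rnormE normrZ. Qed.

Lemma rnorm_real (r : R) : rnorm (r%:C : R[i]^o) = `|r|.
Proof. by rewrite /rnorm normc_def /= expr0n addr0 sqrtr_sqr. Qed.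

Lemma conj_real (r : R) : (r%:C)^* = r%:C :> R[i].
Proof. exact: conjc_real. Qed.

Lemma rnormM (k l : R[i]) :
  rnorm (k * l : R[i]^o) = rnorm (k : R[i]^o) * rnorm (l : R[i]^o).
Proof. exact: (@rnormZ R[i]^o). Qed.

Lemma rnorm1 : rnorm (1 : R[i]^o) = 1.
Proof. by rewrite /rnorm normr1. Qed.

Lemma rnormX (k : R[i]) n :
  rnorm (k ^+ n : R[i]^o) = rnorm (k : R[i]^o) ^+ n.
Proof. by elim: n => [|n IHn]; rewrite ?rnorm1 // !exprS rnormM IHn. Qed.

Lemma rnormB_tri V (x y z : V) : rnorm (x - z) <= rnorm (x - y) + rnorm (y - z).
Proof. by rewrite -{1}(subrK y x) -addrA rnormD. Qed.

Lemma ler_eps (a b : R) : (forall e : R, 0 < e -> a <= b + e) -> a <= b.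
Proof. by move=> h; apply/ler_addgt0Pr => e; exact: h. Qed.

Lemma inv_small (e : R) : 0 < e -> exists N, forall n, (N <= n)%N -> n.+1%:R^-1 <= e.
Proof.
move=> e0; exists (Num.truncn e^-1) => n Nn; rewrite -[e]invrK lef_pV2 ?posrE ?invr_gt0 //.
by apply: le_trans (ltW (truncnS_gt _)) _; rewrite ler_nat.
Qed.

Lemma le_half (a b c e : R) : a <= b + c -> b <= e / 2 -> c <= e / 2 -> a <= e.
Proof. by move=> *; lra. Qed.

Lemma le_third (a b c d f e : R) : a <= b + c -> c <= d + f ->
  b <= e / 3 -> d <= e / 3 -> f <= e / 3 -> a <= e.
Proof. by move=> *; lra. Qed.

Lemma rnorm_le_eps V (x : V) : (forall e : R, 0 < e -> rnorm x <= e) -> x = 0.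
Proof. by move=> xe; apply/rnorm_le0/ler_eps => e e0; rewrite add0r xe. Qed.

Lemma rnorm_dist_eps V (x y : V) : (forall e : R, 0 < e -> rnorm (x - y) <= e) -> x = y.
Proof. by move=> /rnorm_le_eps/eqP; rewrite subr_eq0 => /eqP. Qed.

Lemma rnormCK (z : R[i]) : z^* * z = ((rnorm (z : R[i]^o)) ^+ 2)%:C.
Proof. by rewrite mulrC -sqr_normc cnormE rmorphXn. Qed.

Lemma Re_le_rnorm (z : R[i]) : `|complex.Re z| <= rnorm (z : R[i]^o).
Proof. by rewrite -lecR -cnormE normc_ge_Re. Qed.

Lemma Im_le_rnorm (z : R[i]) : `|complex.Im z| <= rnorm (z : R[i]^o).
Proof.
have := Re_le_rnorm ('i * z); case: z => a b.
rewrite rnormM /= mul0r mul1r sub0r normrN; suff -> : rnorm ('i : R[i]^o) = 1.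
  by rewrite mul1r.
by rewrite /rnorm normc_def /= expr0n expr1n add0r sqrtr1.
Qed.

Lemma rnorm_le_ReIm (z : R[i]) :
  rnorm (z : R[i]^o) <= `|complex.Re z| + `|complex.Im z|.
Proof.
rewrite /rnorm normc_def /=.
rewrite -(ger0_norm (addr_ge0 (normr_ge0 (complex.Re z)) (normr_ge0 (complex.Im z)))).
rewrite -sqrtr_sqr; apply: ler_wsqrtr; rewrite sqrrD !real_normK ?num_real //.
by rewrite lerD2r lerDl mulrn_wge0 ?mulr_ge0.
Qed.

Lemma cvg_rnormP {T : Type} V (F : set_system T) (f : T -> V) (l : V) : Filter F ->
  (f @ F --> l <-> forall e : R, 0 < e -> F [set x | rnorm (f x - l) <= e]).
Proof.
move=> FF; split=> [/cvgrPdist_le fl e e0|fl].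
  have : 0 < e%:C by rewrite ltcR.
  by move/fl; apply: filterS => x /=; rewrite rnormE lecR rnormB.
apply/cvgrPdist_le => e e0.
have eR : e = (complex.Re e)%:C by rewrite RRe_real // gtr0_real.
have /fl : 0 < complex.Re e by rewrite -ltcR -eR.
by apply: filterS => x /=; rewrite rnormE eR lecR rnormB.
Qed.

(** The instance of [cvg_rnormP] at a point; keeping [T] abstract lets its
    neighbourhoods be recognised as a filter when [T] is a subspace. *)
Lemma continuous_rnormP {T : topologicalType} V (f : T -> V) (x : T) :
  f @ x --> f x <-> forall e : R, 0 < e -> nbhs x [set y | rnorm (f y - f x) <= e].
Proof. exact: cvg_rnormP. Qed.

Lemma continuous_normP {T : topologicalType} (f : T -> R) (x : T) :
  f @ x --> f x <-> forall e : R, 0 < e -> nbhs x [set y | `|f y - f x| <= e].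
Proof.
split=> [/cvgrPdist_le fl e /fl|fl]; first by apply: filterS => y; rewrite distrC.
by apply/cvgrPdist_le => e /fl; apply: filterS => y; rewrite /= distrC.
Qed.

Definition cvgs V (u : nat -> V) (l : V) :=
  forall e : R, 0 < e -> exists N, forall n, (N <= n)%N -> rnorm (u n - l) <= e.

Lemma cauchy_cvgs (V : completeNormedModType R[i]) (u : nat -> V) :
  (forall e : R, 0 < e -> exists N, forall m n, (N <= m)%N -> (N <= n)%N ->
     rnorm (u m - u n) <= e) -> exists l, cvgs u l.
Proof.
move=> uC; have /cauchy_cvg/cvg_ex[/= l ul] : cauchy (u @ \oo).
  apply: cauchy_exP => e e0.
  have eR : e = (complex.Re e)%:C by rewrite RRe_real // gtr0_real.
  have e0' : 0 < complex.Re e by rewrite -ltcR -eR.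
  have [|N uN] := uC (complex.Re e / 2); first by rewrite divr_gt0.
  exists (u N); exists N => // n /= Nn; rewrite -ball_normE /ball_/=.
  rewrite rnormE eR ltcR (le_lt_trans (uN _ _ _ _)) //.
  by rewrite ltr_pdivrMr // ltr_pMr // ltr1n.
exists l => e e0; move/cvgrPdist_le : ul => /(_ e%:C).
rewrite ltcR => /(_ e0) [N _ uN]; exists N => n Nn.
by rewrite -lecR -rnormE distrC uN.
Qed.

End Norm.

(** * Projections onto closed subspaces of a Hilbert space *)

Section InnerProduct.
Context {R : realType} {H : hilbertType R}.
Implicit Types (x y z : H) (k : R[i]) (L M : set H).

Lemma innerDl x y z : inner (x + y) z = inner x z + inner y z.
Proof. by rewrite linearDl. Qed.

Lemma innerDr x y z : inner z (x + y) = inner z x + inner z y.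
Proof. by rewrite linearD. Qed.

Lemma innerZl k x y : inner (k *: x) y = k * inner x y.
Proof. by rewrite linearZl_LR. Qed.

Lemma innerC x y : inner x y = (inner y x)^*.
Proof. by rewrite hermC /= expr0 mul1r. Qed.

Lemma innerZr k x y : inner x (k *: y) = k^* * inner x y.
Proof. by rewrite innerC innerZl rmorphM /= -innerC. Qed.

Lemma inner0l x : inner 0 x = 0.
Proof. by rewrite -(scale0r 0) innerZl mul0r. Qed.

Lemma inner0r x : inner x 0 = 0.
Proof. by rewrite innerC inner0l conjC0. Qed.

Lemma innerNl x y : inner (- x) y = - inner x y.
Proof. by rewrite -scaleN1r innerZl mulN1r. Qed.

Definition ip x y : R := complex.Re (inner x y).

Lemma ipDl x y z : ip (x + y) z = ip x z + ip y z.
Proof. by rewrite /ip innerDl raddfD. Qed.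

Lemma ipDr x y z : ip z (x + y) = ip z x + ip z y.
Proof. by rewrite /ip innerDr raddfD. Qed.

Lemma ipC x y : ip x y = ip y x.
Proof. by rewrite /ip innerC; case: (inner y x). Qed.

Lemma ipZl (r : R) x y : ip (r%:C *: x) y = r * ip x y.
Proof. by rewrite /ip innerZl; case: (inner x y) => a b /=; ring. Qed.

Lemma ipZr (r : R) x y : ip x (r%:C *: y) = r * ip x y.
Proof. by rewrite ipC ipZl ipC. Qed.

Lemma ipNl x y : ip (- x) y = - ip x y.
Proof. by rewrite /ip innerNl raddfN. Qed.

Lemma ipNr x y : ip x (- y) = - ip x y.
Proof. by rewrite ipC ipNl ipC. Qed.

Lemma ip0l x : ip 0 x = 0.
Proof. by rewrite /ip inner0l. Qed.

Lemma ip0r x : ip x 0 = 0.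
Proof. by rewrite ipC ip0l. Qed.

Lemma innerE x y : inner x y = ip x y +i* ip x ('i *: y).
Proof. by rewrite /ip innerZr; case: (inner x y) => a b /=; congr (_ +i* _); ring. Qed.

Lemma rnorm_sqr x : rnorm x ^+ 2 = ip x x.
Proof. by rewrite /ip -inner_norm rnormE -rmorphXn. Qed.

Lemma ip_ge0 x : 0 <= ip x x.
Proof. by rewrite -rnorm_sqr sqr_ge0. Qed.

Lemma rnormD_sqr x y : rnorm (x + y) ^+ 2 = rnorm x ^+ 2 + 2 * ip x y + rnorm y ^+ 2.
Proof. by rewrite !rnorm_sqr ipDl !ipDr (ipC y x); ring. Qed.

Lemma rnormB_sqr x y : rnorm (x - y) ^+ 2 = rnorm x ^+ 2 - 2 * ip x y + rnorm y ^+ 2.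
Proof. by rewrite rnormD_sqr rnormN ipNr; ring. Qed.

Lemma rnorm_sqr_le x (c : R) : 0 <= c -> rnorm x ^+ 2 <= c ^+ 2 -> rnorm x <= c.
Proof. by move=> c0; rewrite ler_pXn2r // nnegrE // rnorm_ge0. Qed.

Lemma CauchySchwarz x y : `|ip x y| <= rnorm x * rnorm y.
Proof.
have [->|y0] := eqVneq y 0; first by rewrite ip0r normr0 rnorm0 mulr0.
have yy : 0 < rnorm y ^+ 2 by rewrite exprn_gt0 // rnorm_gt0.
rewrite -(@ler_pXn2r _ 2) // ?nnegrE ?mulr_ge0 ?rnorm_ge0 //.
rewrite real_normK ?num_real // exprMn.
have := sqr_ge0 (rnorm ((rnorm y ^+ 2)%:C *: x - (ip x y)%:C *: y)).
rewrite rnormB_sqr ipZl ipZr !rnormZ !rnorm_real !exprMn !real_normK ?num_real //.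
set a := rnorm x ^+ 2; set b := rnorm y ^+ 2 in yy *; set c := ip x y => hh.
have : 0 <= b * (a * b - c ^+ 2).
  by move: hh; congr (_ <= _); ring.
by rewrite pmulr_rge0 // subr_ge0.
Qed.

Lemma ip_le x y : ip x y <= rnorm x * rnorm y.
Proof. exact: le_trans (ler_norm _) (CauchySchwarz x y). Qed.

Lemma ip_eq0 x : ip x x = 0 -> x = 0.
Proof. by rewrite -rnorm_sqr => /eqP; rewrite sqrf_eq0 => /eqP /rnorm0_eq0. Qed.

Lemma inner_eq0 x : (forall y, inner x y = 0) -> x = 0.
Proof. by move=> h; apply: ip_eq0; rewrite /ip h. Qed.

(** Vectors are determined by their inner products, which turns identities
    between linear combinations into identities between scalars. *)
Lemma inner_inj x y : (forall z, inner x z = inner y z) -> x = y.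
Proof.
move=> h; apply/eqP; rewrite -subr_eq0; apply/eqP/inner_eq0 => z.
by rewrite innerDl innerNl h subrr.
Qed.

Definition closed_subspace L :=
  [/\ L 0, forall k x y, L x -> L y -> L (k *: x + y)
    & forall x, (forall e : R, 0 < e -> exists2 y, L y & rnorm (x - y) <= e) -> L x].

Section ClosedSubspace.
Variable L : set H.
Hypothesis cL : closed_subspace L.

Lemma subspaceZ k x : L x -> L (k *: x).
Proof. by case: cL => L0 LD _ Lx; rewrite -[_ *: _]addr0; apply: LD. Qed.

Lemma subspaceD x y : L x -> L y -> L (x + y).
Proof. by case: cL => L0 LD _ Lx Ly; rewrite -[x]scale1r; apply: LD. Qed.

Lemma subspaceN x : L x -> L (- x).
Proof. by rewrite -scaleN1r; exact: subspaceZ. Qed.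

Lemma subspaceB x y : L x -> L y -> L (x - y).
Proof. by move=> Lx Ly; apply/subspaceD/subspaceN. Qed.

Lemma subspace_lim x : (forall e : R, 0 < e -> exists2 y, L y & rnorm (x - y) <= e) -> L x.
Proof. by case: cL => _ _; apply. Qed.

Lemma subspace0 : L 0. Proof. by case: cL. Qed.

End ClosedSubspace.

Definition orth L : set H := [set z | forall y, L y -> inner z y = 0].

Lemma orth_ip L z : closed_subspace L -> (forall y, L y -> ip z y = 0) -> orth L z.
Proof.
move=> cL h y Ly; rewrite innerE !h //; exact: subspaceZ.
Qed.

(** A minimising sequence is Cauchy by the parallelogram identity, and at the
    minimum the first variation vanishes. *)
Lemma projection_exists L x : closed_subspace L -> exists2 y, L y & orth L (x - y).
Proof.
move=> cL; pose D := [set rnorm (x - y) ^+ 2 | y in L].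
have D0 : has_inf D.
  split; first by exists (rnorm (x - 0) ^+ 2); exists 0 => //; exact: subspace0.
  by exists 0 => _ [y _ <-]; exact: sqr_ge0.
have minD y : L y -> inf D <= rnorm (x - y) ^+ 2.
  by move=> Ly; apply: ge_inf; [case: D0|exists y].
have /choice[u uP] (n : nat) : exists y, L y /\ rnorm (x - y) ^+ 2 < inf D + n.+1%:R^-1.
  have [_ [y Ly <-] lty] := @inf_adherent _ D n.+1%:R^-1 ltac:(by rewrite invr_gt0) D0.
  by exists y.
have [|y uy] := @cauchy_cvgs _ H u.
  move=> e e0; have [|N hN] := @inv_small _ (e ^+ 2 / 4).
    by rewrite divr_gt0 // exprn_gt0.
  have N4 : 4 * N.+1%:R^-1 <= e ^+ 2 by rewrite mulrC -ler_pdivlMr // hN.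
  exists N => m n Nm Nn; apply: rnorm_sqr_le; first exact: ltW.
  apply: le_trans N4.
  have inv_le p : (N <= p)%N -> p.+1%:R^-1 <= N.+1%:R^-1 :> R.
    by move=> Np; rewrite lef_pV2 ?posrE // ler_nat.
  have [Lm um] := uP m; have [Ln un] := uP n.
  pose w := (2^-1)%:C *: (u m + u n).
  have /minD : L w by apply: subspaceZ => //; exact: subspaceD.
  have -> : x - w = (2^-1)%:C *: ((x - u m) + (x - u n)).
    rewrite addrACA -opprD scalerBr scalerDr -scalerDl -rmorphD /=.
    by rewrite (_ : 2^-1 + 2^-1 = 1) ?scale1r //; field.
  have -> : u m - u n = (x - u n) - (x - u m).
    by rewrite opprB [RHS]addrC subrKA.
  rewrite rnormZ rnorm_real exprMn real_normK ?num_real //.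
  rewrite (rnormD_sqr (x - u m)) (rnormB_sqr (x - u n)).
  move: (inv_le _ Nm) (inv_le _ Nn) um un; rewrite (ipC (x - u n)).
  set a := rnorm (x - u m) ^+ 2; set b := rnorm (x - u n) ^+ 2.
  have -> : 2^-1 ^+ 2 = 4^-1 :> R by field.
  set N1 := N.+1%:R^-1; set m1 := m.+1%:R^-1; set n1 := n.+1%:R^-1.
  by set p := ip _ _; move=> *; lra.
have Ly : L y.
  apply: subspace_lim => // e /uy [N uN]; exists (u N); first by have [] := uP N.
  by rewrite rnormB uN.
exists y => //; apply: orth_ip => // z Lz.
have miny w : L w -> rnorm (x - y) ^+ 2 <= rnorm (x - w) ^+ 2.
  move=> Lw; apply: le_trans (minD _ Lw); apply: ler_eps => e e0.
  (* the distance to [y] is the limit of the distances to the [u n] *)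
  pose c := 2 * rnorm (x - y) + 3.
  have c0 : 0 < c by rewrite ltr_wpDl // mulr_ge0 // rnorm_ge0.
  have d0 : 0 < Num.min 1 (e / (2 * c)) by rewrite lt_min ltr01 divr_gt0 // mulr_gt0.
  have [N uN] := uy _ d0.
  have [|M hM] := @inv_small _ (e / 2); first by rewrite divr_gt0.
  pose n := (N + M)%N; have ne : n.+1%:R^-1 <= e / 2 := hM n (leq_addl _ _).
  have [Ln un] := uP n; have /uN : (N <= n)%N by exact: leq_addr.
  rewrite le_min => /andP[u1 ue].
  have tri : rnorm (x - y) <= rnorm (x - u n) + rnorm (u n - y) by exact: rnormB_tri.
  have tri2 : rnorm (x - u n) <= rnorm (x - y) + rnorm (u n - y).
    by rewrite (rnormB (u n)); exact: rnormB_tri.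
  move: ue; rewrite ler_pdivlMr ?mulr_gt0 // => ue.
  have := rnorm_ge0 (x - u n); have := rnorm_ge0 (u n - y); have := rnorm_ge0 (x - y).
  move: un ne tri tri2 u1 ue; rewrite /c.
  set p := rnorm (x - y); set q := rnorm (u n - y); set r := rnorm (x - u n).
  set n1 := n.+1%:R^-1; move=> un ne tri tri2 q1 ue p0 q0 r0.
  have pp : p ^+ 2 <= (r + q) ^+ 2 by rewrite ler_pXn2r // nnegrE addr_ge0.
  have qq : q * (2 * r + q) <= q * (2 * p + 3) by apply: ler_wpM2l => //; lra.
  by move: pp qq; rewrite sqrrD => pp qq; clearbody n1; lra.
have var (t : R) : 0 <= t ^+ 2 * ip z z - 2 * t * ip (x - y) z.
  have /miny : L (y + t%:C *: z) by apply: subspaceD => //; exact: subspaceZ.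
  rewrite opprD addrA (rnormB_sqr (x - y)) ipZr rnormZ rnorm_real exprMn.
  by rewrite real_normK ?num_real // (rnorm_sqr z) => h; lra.
have zz := ip_ge0 z.
have := var (ip (x - y) z / (ip z z + 1)).
set a := ip (x - y) z; set b := ip z z in zz *.
have b1 : 0 < b + 1 by lra.
have -> : (a / (b + 1)) ^+ 2 * b - 2 * (a / (b + 1)) * a = - (a ^+ 2 * ((b + 2) / (b + 1) ^+ 2)).
  by field; rewrite gt_eqF.
rewrite oppr_ge0 pmulr_lle0 ?divr_gt0 ?exprn_gt0 //; last by lra.
by move=> a0; apply/eqP; rewrite -sqrf_eq0 eq_le a0 sqr_ge0.
Qed.

Lemma orth_closed L : closed_subspace (orth L).
Proof.
split => [y _|k x y ox oy z Lz|x hx y Ly]; first exact: inner0l.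
  by rewrite innerDl innerZl ox // oy // mulr0 addr0.
have ip0 z : orth [set x0 | orth L x0] z -> ip x z = 0.
  move=> oz; apply/eqP; rewrite -normr_le0; apply: ler_eps => e e0.
  have r1 : 0 < rnorm z + 1 by rewrite ltr_wpDl // rnorm_ge0.
  have [w ow xw] := hx (e / (rnorm z + 1)) (divr_gt0 e0 r1).
  rewrite -[x](subrK w) ipDl (ipC w) [ip z w]/ip oz // !addr0.
  apply: le_trans (CauchySchwarz _ _) _.
  apply: le_trans (ler_wpM2r (rnorm_ge0 z) xw) _.
  by rewrite add0r mulrAC ler_pdivrMr // ler_pM2l // lerDl.
have oy k : orth [set x0 | orth L x0] (k *: y).
  by move=> z oz; rewrite innerZl innerC oz // conjC0 mulr0.
rewrite innerE !ip0 //; have := oy 1; by rewrite scale1r.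
Qed.

Lemma orth_self L x : L x -> orth L x -> x = 0.
Proof. by move=> Lx ox; apply: ip_eq0; rewrite /ip ox. Qed.

Lemma orthS L M : L `<=` M -> orth M `<=` orth L.
Proof. by move=> LM x ox y /LM; exact: ox. Qed.

Lemma orthC L x y : L x -> orth L y -> inner x y = 0.
Proof. by move=> Lx oy; rewrite innerC oy // conjC0. Qed.

Lemma orthK L : closed_subspace L -> orth (orth L) = L.
Proof.
move=> cL; apply/seteqP; split=> x; last by move=> Lx y oy; exact: orthC oy.
move=> oox; have [y Ly oy] := projection_exists x cL.
have -> : x = y; last by [].
apply/eqP; rewrite -subr_eq0; apply/eqP; apply: (@orth_self (orth L)) => //.
apply: (subspaceB (orth_closed _)) => //.
by move=> z oz; exact: orthC oz.
Qed.

End InnerProduct.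

(** [ring] for vectors, by [inner_inj]. *)
Ltac vector_ring :=
  let z := fresh in
  apply: inner_inj => z; rewrite ?(innerDl, innerNl, innerZl, inner0l); ring.

Section Projection.
Context {R : realType} {H : hilbertType R}.
Implicit Types (x y z : H) (L M : set H).

(** The orthogonal projection onto [L]; the default value matters only when
    [L] is not a closed subspace. *)
Definition proj L x : H := xget 0 [set y | L y /\ orth L (x - y)].

Section OneSubspace.
Variable L : set H.
Hypothesis cL : closed_subspace L.

Lemma projP x : L (proj L x) /\ orth L (x - proj L x).
Proof.
rewrite /proj; case: xgetP => [y -> //|no].
by have [y Ly oy] := projection_exists x cL; case: (no y).
Qed.

Lemma proj_in x : L (proj L x). Proof. by have [] := projP x. Qed.

Lemma proj_orth x : orth L (x - proj L x). Proof. by have [] := projP x. Qed.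

Lemma proj_uniq x y : L y -> orth L (x - y) -> proj L x = y.
Proof.
move=> Ly oy; apply/eqP; rewrite -subr_eq0; apply/eqP.
apply: (@orth_self _ _ L); first exact: (subspaceB cL (proj_in x)).
have -> : proj L x - y = (x - y) - (x - proj L x) by rewrite opprB [RHS]addrC subrKA.
exact: (subspaceB (orth_closed L) oy (proj_orth x)).
Qed.

Lemma proj_id x : L x -> proj L x = x.
Proof. by move=> Lx; apply: proj_uniq => // y Ly; rewrite subrr inner0l. Qed.

Lemma proj_eq0 x : orth L x -> proj L x = 0.
Proof. by move=> ox; apply: proj_uniq; rewrite ?subr0 //; exact: subspace0. Qed.

Lemma proj_linear : linear (proj L).
Proof.
move=> k x y; apply: proj_uniq.
  by apply: (subspaceD cL); [apply: (subspaceZ cL)|]; exact: proj_in.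
have -> : k *: x + y - (k *: proj L x + proj L y) =
          k *: (x - proj L x) + (y - proj L y).
  by rewrite scalerBr opprD addrACA.
apply: (subspaceD (orth_closed L)); last exact: proj_orth.
by apply: (subspaceZ (orth_closed L)); exact: proj_orth.
Qed.

Lemma proj_pyth x : rnorm x ^+ 2 = rnorm (proj L x) ^+ 2 + rnorm (x - proj L x) ^+ 2.
Proof.
rewrite -{1}(subrK (proj L x) x) (rnormD_sqr (x - proj L x)) /ip.
rewrite (proj_orth x (proj_in x)) /=.
by rewrite mulr0 addr0 addrC.
Qed.

Lemma proj_le x : rnorm (proj L x) <= rnorm x.
Proof.
apply: rnorm_sqr_le; first exact: rnorm_ge0.
by rewrite [leRHS]proj_pyth lerDl sqr_ge0.
Qed.

Lemma proj_adj x y : inner (proj L x) y = inner x (proj L y).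
Proof.
transitivity (inner (proj L x) (proj L y)).
  rewrite -[in LHS](subrK (proj L y) y) innerDr.
  by rewrite (orthC (proj_in x) (proj_orth y)) add0r.
rewrite -[in RHS](subrK (proj L x) x) innerDl.
by rewrite (proj_orth x (proj_in y)) add0r.
Qed.

Lemma proj_sqr x : ip (proj L x) x = rnorm (proj L x) ^+ 2.
Proof. by rewrite rnorm_sqr /ip -proj_adj (proj_id (proj_in x)). Qed.

End OneSubspace.

Lemma projS L M x : closed_subspace L -> closed_subspace M -> L `<=` M ->
  proj L (proj M x) = proj L x.
Proof.
move=> cL cM LM; apply: proj_uniq => //; first exact: proj_in.
have -> : proj M x - proj L x = (x - proj L x) - (x - proj M x).
  by rewrite opprB [RHS]addrC subrKA.
apply: (subspaceB (orth_closed L)); first exact: proj_orth.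
by apply: (orthS LM); exact: proj_orth.
Qed.

Lemma projS_sub L M x : closed_subspace L -> closed_subspace M -> L `<=` M ->
  rnorm (proj M x - proj L x) ^+ 2 = rnorm (proj M x) ^+ 2 - rnorm (proj L x) ^+ 2.
Proof.
move=> cL cM LM; have := proj_pyth cL (proj M x); rewrite projS // => ->; ring.
Qed.

Lemma projS_le L M x : closed_subspace L -> closed_subspace M -> L `<=` M ->
  rnorm (proj L x) <= rnorm (proj M x).
Proof. by move=> cL cM LM; rewrite -(projS x cL cM LM) proj_le. Qed.

Lemma bigcap_closed (I : Type) (D : set I) (F : I -> set H) :
  (forall i, D i -> closed_subspace (F i)) ->
  closed_subspace (\bigcap_(i in D) F i).
Proof.
move=> cF; split=> [i /cF[]//|k x y hx hy i Di|x hx i Di].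
  by have [_ h _] := cF _ Di; apply: h; [exact: hx|exact: hy].
have [_ _] := cF _ Di; apply => e /hx [y Fy xy]; exists y => //; exact: Fy.
Qed.

End Projection.

(** * Bounded operators *)

Section BoundedOperators.
Context {R : realType} {H : hilbertType R}.
Implicit Types (S T U : H -> H) (x y : H) (c : R) (k : R[i]).

Lemma linD T x y : linear T -> T (x + y) = T x + T y.
Proof. by move=> lT; have := lT 1 x y; rewrite !scale1r. Qed.

Lemma lin0 T : linear T -> T 0 = 0.
Proof.
move=> lT; have := lT 1 0 0; rewrite !scale1r add0r => h.
by apply: (addrI (T 0)); rewrite addr0.
Qed.

Lemma linZ T k x : linear T -> T (k *: x) = k *: T x.
Proof. by move=> lT; have := lT k x 0; rewrite !addr0 lin0 // addr0. Qed.

Lemma linN T x : linear T -> T (- x) = - T x.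
Proof. by move=> lT; rewrite -scaleN1r linZ // scaleN1r. Qed.

Lemma linB T x y : linear T -> T (x - y) = T x - T y.
Proof. by move=> lT; rewrite linD // linN. Qed.

Definition bnd T c := forall x, rnorm (T x) <= c * rnorm x.

Lemma bnd_continuous T c : linear T -> bnd T c -> continuous T.
Proof.
move=> lT bT x; apply/cvgrPdist_le => /= e e0.
have eR : e = (complex.Re e)%:C by rewrite RRe_real // gtr0_real.
have e0' : 0 < complex.Re e by rewrite -ltcR -eR.
have c1 : 0 < `|c| + 1 by rewrite ltr_wpDl.
near=> y; rewrite rnormE eR lecR -linB //.
apply: le_trans (bT _) _; apply: (@le_trans _ _ ((`|c| + 1) * rnorm (x - y))).
  by apply: ler_wpM2r; [exact: rnorm_ge0|rewrite (le_trans (ler_norm _)) // lerDl].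
rewrite mulrC -ler_pdivlMr // -lecR -rnormE.
near: y; apply/nbhs_ballP; exists (complex.Re e / (`|c| + 1))%:C => /=.
  by rewrite ltcR divr_gt0.
by move=> y; rewrite -ball_normE => /ltW.
Unshelve. all: by end_near. Qed.

Lemma BH_bnd T : BH T -> exists2 c : R, 0 <= c & bnd T c.
Proof.
move=> [lT cT]; have /cvgrPdist_lt := cT 0; rewrite (lin0 lT) => /(_ 1 ltr01).
move=> /nbhs_ballP[e /= e0 he].
have eR : e = (complex.Re e)%:C by rewrite RRe_real // gtr0_real.
have e0' : 0 < complex.Re e by rewrite -ltcR -eR.
exists (2 / complex.Re e); first by rewrite divr_ge0 // ltW.
move=> x; have [->|x0] := eqVneq x 0; first by rewrite lin0 // rnorm0 mulr0.
have nx := rnorm_gt0 x0.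
pose r := complex.Re e / (2 * rnorm x).
have r0 : 0 < r by rewrite divr_gt0 // mulr_gt0.
have /he : ball 0 e (r%:C *: x).
  rewrite -ball_normE /ball_/= sub0r normrN rnormE eR ltcR rnormZ rnorm_real gtr0_norm //.
  rewrite /r -mulrA invfM -mulrA mulVf ?gt_eqF // mulr1.
  by rewrite gtr_pMr // invf_lt1 // ltr1n.
rewrite /= sub0r normrN linZ // rnormE ltcR rnormZ rnorm_real gtr0_norm //.
rewrite -ltr_pdivlMl // mulr1 => /ltW; rewrite /r invf_div.
by rewrite mulrAC.
Qed.

Lemma bnd_BH T c : linear T -> bnd T c -> BH T.
Proof. by move=> lT bT; split => //; exact: bnd_continuous bT. Qed.

Lemma BH_linear T : BH T -> linear T. Proof. by case. Qed.

Lemma opnorm_le T c : 0 <= c -> bnd T c -> opnorm T <= c.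
Proof.
move=> c0 bT; apply: ge_sup.
  by exists (rnorm (T 0)); exists 0 => //=; rewrite rnorm0 ler01.
by move=> _ [x /= x1 <-]; apply: le_trans (bT x) _; rewrite ler_piMr.
Qed.

Lemma bnd_opnorm T : BH T -> bnd T (opnorm T).
Proof.
move=> BT x; have lT := BH_linear BT; have [c c0 bT] := BH_bnd BT.
have [->|x0] := eqVneq x 0; first by rewrite lin0 // rnorm0 mulr0.
have nx := rnorm_gt0 x0.
rewrite -ler_pdivrMr //; apply: ub_le_sup.
  by exists c => _ [y /= y1 <-]; apply: le_trans (bT y) _; rewrite ler_piMr.
exists ((rnorm x)^-1%:C *: x) => /=.
  by rewrite rnormZ rnorm_real gtr0_norm ?invr_gt0 // mulVf // gt_eqF.
by rewrite linZ // rnormZ rnorm_real gtr0_norm ?invr_gt0 // mulrC.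
Qed.

Lemma bnd_opnormS T c : BH T -> opnorm T <= c -> bnd T c.
Proof.
move=> BT Tc x; apply: le_trans (bnd_opnorm BT x) _.
by apply: ler_wpM2r => //; exact: rnorm_ge0.
Qed.

Lemma bndS T c d : c <= d -> bnd T c -> bnd T d.
Proof.
by move=> cd bT x; apply: le_trans (bT x) _; rewrite ler_wpM2r // rnorm_ge0.
Qed.

Lemma bndD S T c d : bnd S c -> bnd T d -> bnd (S + T) (c + d).
Proof.
by move=> bS bT x; rewrite mulrDl (le_trans (rnormD _ _)) // lerD.
Qed.

Lemma bndZ k T c : bnd T c -> bnd (k *: T) (rnorm (k : R[i]^o) * c).
Proof. by move=> bT x; rewrite /= rnormZ -mulrA ler_wpM2l // rnorm_ge0. Qed.

Lemma bndN T c : bnd T c -> bnd (- T) c.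
Proof. by move=> bT x; rewrite rnormN. Qed.

Lemma bndB S T c : bnd (S - T) c -> bnd (T - S) c.
Proof. by move=> b x; have := b x; rewrite rnormB. Qed.

Lemma bnd_comp S T c d : 0 <= c -> bnd S c -> bnd T d -> bnd (S \o T) (c * d).
Proof.
move=> c0 bS bT x; apply: le_trans (bS _) _.
by rewrite -mulrA ler_wpM2l.
Qed.

Lemma bnd_tri S T U c d : bnd (S - T) c -> bnd (T - U) d -> bnd (S - U) (c + d).
Proof.
move=> b1 b2 x; rewrite mulrDl.
apply: le_trans (rnormB_tri (S x) (T x) (U x)) _.
by apply: lerD; [exact: b1|exact: b2].
Qed.

Lemma BH_id : BH (idfun : H -> H).
Proof. by apply: (@bnd_BH _ 1) => // x; rewrite mul1r. Qed.

Lemma BH_comp S T : BH S -> BH T -> BH (S \o T).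
Proof.
move=> BS BT; have [c c0 bS] := BH_bnd BS; have [d d0 bT] := BH_bnd BT.
have [lS lT] := (BH_linear BS, BH_linear BT).
by apply: (bnd_BH _ (bnd_comp c0 bS bT)) => k x y /=; rewrite lT lS.
Qed.

Lemma BH_D S T : BH S -> BH T -> BH (S + T).
Proof.
move=> BS BT; have [c c0 bS] := BH_bnd BS; have [d d0 bT] := BH_bnd BT.
have [lS lT] := (BH_linear BS, BH_linear BT).
apply: (bnd_BH _ (bndD bS bT)) => k x y /=.
by rewrite !fctE lT lS scalerDr addrACA.
Qed.

Lemma BH_Z k T : BH T -> BH (k *: T).
Proof.
move=> BT; have [d d0 bT] := BH_bnd BT; have lT := BH_linear BT.
apply: (bnd_BH _ (bndZ k bT)) => l x y /=.
by rewrite !fctE lT scalerDr !scalerA mulrC.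
Qed.

Lemma BH_B S T : BH S -> BH T -> BH (S - T).
Proof.
by move=> BS BT; rewrite -scaleN1r; apply: BH_D => //; exact: BH_Z.
Qed.

Lemma BH_0 : BH (0 : H -> H).
Proof.
by apply: (@bnd_BH _ 0) => [k x y|x] /=; rewrite -/(0 : H) ?scaler0 ?addr0 // rnorm0 mul0r.
Qed.

Definition opcvg (u : nat -> H -> H) T :=
  forall e : R, 0 < e -> exists N, forall n, (N <= n)%N -> bnd (u n - T) e.

Lemma BH_complete (u : nat -> H -> H) : (forall n, BH (u n)) ->
  (forall e : R, 0 < e -> exists N, forall m n, (N <= m)%N -> (N <= n)%N ->
     bnd (u m - u n) e) ->
  exists2 T, BH T & opcvg u T.
Proof.
move=> Bu Cu.
have /choice[T uT] x : exists l, cvgs (fun n => u n x) l.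
  apply: cauchy_cvgs => e e0.
  have r1 : 0 < rnorm x + 1 by rewrite ltr_wpDl // rnorm_ge0.
  have [N uN] := Cu _ (divr_gt0 e0 r1); exists N => m n Nm Nn.
  apply: le_trans (uN m n Nm Nn x) _.
  by rewrite mulrAC ler_pdivrMr // ler_pM2l // lerDl.
have uTe (e : R) : 0 < e -> exists N, forall n, (N <= n)%N -> bnd (u n - T) e.
  move=> e0; have [N uN] := Cu e e0; exists N => n Nn x.
  apply: ler_eps => d d0; have [M uM] := uT x d d0.
  have := uM (maxn N M) (leq_maxr _ _).
  have := uN n (maxn N M) Nn (leq_maxl _ _) x.
  have := rnormB_tri (u n x) (u (maxn N M) x) (T x).
  by rewrite !fctE => *; lra.
exists T => //.
have lT : linear T.
  move=> k x y; apply: rnorm_dist_eps => e e0.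
  pose c := (rnorm (k *: x + y) + rnorm (k : R[i]^o) * rnorm x + rnorm y) + 1.
  have c0 : 0 < c by rewrite ltr_wpDl // !addr_ge0 ?mulr_ge0 ?rnorm_ge0.
  have [N /(_ N (leqnn N)) uN] := uTe (e / c) (divr_gt0 e0 c0).
  have -> : T (k *: x + y) - (k *: T x + T y) =
     (T - u N) (k *: x + y) - (k *: (T - u N) x + (T - u N) y).
    rewrite !fctE (BH_linear (Bu N)) scalerBr.
    by rewrite [k *: T x - _ + _]addrACA -opprD opprB subrKA.
  have bN := bndB uN.
  apply: le_trans (rnormD _ _) _; rewrite rnormN.
  apply: le_trans (lerD (lexx _) (rnormD _ _)) _; rewrite rnormZ.
  have h1 := bN (k *: x + y); have h2 := bN x; have h3 := bN y.
  have h4 := ler_wpM2l (rnorm_ge0 (k : R[i]^o)) h2.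
  have ec : e / c * c = e by rewrite divfK // gt_eqF.
  have q0 : 0 <= e / c by rewrite divr_ge0 // ltW.
  move: ec h1 h2 h3 h4 q0; rewrite {2}/c; set q := e / c.
  by move=> *; lra.
have [N /(_ N (leqnn N)) uN] := uTe 1 ltr01.
have [c c0 bc] := BH_bnd (Bu N).
apply: (@bnd_BH _ (1 + c)) => // x; have := bndD (bndB uN) bc x.
by rewrite subrK.
Qed.

Lemma norm_closureP (X : set (H -> H)) T : X `<=` BH ->
  (norm_closure X T <->
   BH T /\ forall e : R, 0 < e -> exists2 S, X S & bnd (T - S) e).
Proof.
move=> XB; split=> -[BT h]; split=> // e e0.
  have [S XS TS] := h e e0; exists S => //; apply: bnd_opnormS (ltW TS).
  by apply: BH_B => //; exact: XB.
have [S XS TS] := h (e / 2) ltac:(by rewrite divr_gt0); exists S => //.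
apply: (@le_lt_trans _ _ (e / 2)); last by rewrite ltr_pdivrMr // ltr_pMr // ltr1n.
by apply: opnorm_le => //; rewrite ltW // divr_gt0.
Qed.

(** Adjoints inherit bounds: [|S x|^2 = <x, T S x>]. *)
Lemma bnd_adjoint S T c : is_adjoint S T -> 0 <= c -> bnd T c -> bnd S c.
Proof.
move=> ST c0 bT x; have h : rnorm (S x) ^+ 2 <= c * rnorm x * rnorm (S x).
  rewrite rnorm_sqr /ip ST; apply: le_trans (ip_le _ _) _.
  by rewrite mulrC mulrAC ler_wpM2r ?rnorm_ge0.
have [Sx0|Sx0] := eqVneq (rnorm (S x)) 0.
  by rewrite Sx0 mulr_ge0 ?rnorm_ge0.
by move: h; rewrite expr2 ler_pM2r // lt_def Sx0 rnorm_ge0.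
Qed.

Lemma is_adjointP S T : linear T -> (forall x y, ip (S x) y = ip x (T y)) ->
  is_adjoint S T.
Proof. by move=> lT h x y; rewrite !(innerE _ _) !h linZ. Qed.

Lemma is_adjointC S T : is_adjoint S T -> is_adjoint T S.
Proof. by move=> h x y; rewrite innerC -h -innerC. Qed.

Lemma is_adjoint_lim (u v : nat -> H -> H) S T :
  (forall n, is_adjoint (u n) (v n)) -> linear T -> opcvg u S -> opcvg v T ->
  is_adjoint S T.
Proof.
move=> uv lT uS vT; apply: is_adjointP => // x y.
apply/eqP; rewrite -subr_eq0 -normr_le0; apply: ler_eps => e e0.
pose c := rnorm x * rnorm y * 2 + 1.
have c0 : 0 < c by rewrite ltr_wpDl // !mulr_ge0 ?rnorm_ge0.
have [N uN] := uS (e / c) (divr_gt0 e0 c0).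
have [M vM] := vT (e / c) (divr_gt0 e0 c0).
have {uN}uN := uN (maxn N M) (leq_maxl _ _) x.
have {vM}vM := vM (maxn N M) (leq_maxr _ _) y.
set n := maxn N M in uN vM.
have -> : ip (S x) y - ip x (T y) = - ip (u n x - S x) y + ip x (v n y - T y).
  rewrite ipDl ipNl ipDr ipNr [ip (u n x) y]/ip uv -/(ip x (v n y)); ring.
rewrite add0r; apply: le_trans (ler_normD _ _) _; rewrite normrN.
have h1 := CauchySchwarz (u n x - S x) y; have h2 := CauchySchwarz x (v n y - T y).
have h3 := ler_wpM2r (rnorm_ge0 y) uN; have h4 := ler_wpM2l (rnorm_ge0 x) vM.
apply: le_trans (lerD h1 h2) _; apply: le_trans (lerD h3 h4) _.
have -> : e / c * rnorm x * rnorm y + rnorm x * (e / c * rnorm y) = e / c * (c - 1).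
  by rewrite /c; ring.
by rewrite mulrBr divfK ?gt_eqF // mulr1 lerBlDr lerDl divr_ge0 // ltW.
Qed.

Lemma orthogonal_projection_proj (L : set H) :
  closed_subspace L -> orthogonal_projection (proj L).
Proof.
move=> cL; split; last exact: proj_adj.
  apply: (@bnd_BH _ 1); first exact: proj_linear.
  by move=> x; rewrite mul1r proj_le.
by apply/funext => x /=; rewrite proj_id //; exact: proj_in.
Qed.

End BoundedOperators.

(** * Characters of an archimedean ordered algebra *)

(** The representation theorem of Kadison and Dubois. A cone which is maximal
    among those that contain [T], are stable under multiplication by [T] and
    omit [-1] is a total order, so that the algebra is compared with the
    scalars: this Dedekind cut is a homomorphism to [R]. *)
Section ArchimedeanCharacter.
Context {R : realType} {S : comPzRingType} (iota : {rmorphism R -> S}).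
Variable T : set S.
Hypothesis TD : forall a b, T a -> T b -> T (a + b).
Hypothesis TM : forall a b, T a -> T b -> T (a * b).
Hypothesis Tr : forall r : R, 0 <= r -> T (iota r).
Hypothesis Tarch : forall a, exists r : R, T (iota r - a).
Implicit Types (a b g h : S) (M : set S) (r c e : R).

Lemma cone_arch_pos a : exists2 r : R, 0 < r & T (iota r - a).
Proof.
have [r Ta] := Tarch a; exists (`|r| + 1); first by rewrite ltr_wpDl.
have -> : iota (`|r| + 1) - a = (iota r - a) + iota (`|r| + 1 - r).
  by rewrite !rmorphB !rmorphD; ring.
apply: TD => //; apply: Tr; have := ler_norm r; lra.
Qed.

Lemma iotaVK r : r != 0 -> iota r * iota r^-1 = 1.
Proof. by move=> r0; rewrite -rmorphM mulfV // rmorph1. Qed.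

(** Write [g >= 0] for [T g]. If [t <= n] and [f + s >= 0] then
    [n (f + s - 1/n) = (n - t)(f + s) + (t f - 1) + s t >= 0], so that the lower
    bound of [f] improves by [1/n] as long as it is negative. *)
Lemma cone_quotient t f : T t -> T (t * f - 1) -> T f.
Proof.
move=> Tt Ttf; have [n n0 Tn] := cone_arch_pos t.
have [r r0 Tfr] := cone_arch_pos (- f); rewrite opprK addrC in Tfr.
have n1 : n != 0 by rewrite gt_eqF.
have step s : 0 <= s -> T (f + iota s) -> T (f + iota (s - n^-1)).
  move=> s0 Tfs.
  have -> : f + iota (s - n^-1) =
      iota n^-1 * ((iota n - t) * (f + iota s) + (t * f - 1) + iota s * t).
    by have := iotaVK n1; rewrite rmorphB; set x := iota n^-1 => E; ring: E.
  apply: TM; first by apply: Tr; rewrite invr_ge0 ltW.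
  apply: TD; last by apply: TM => //; exact: Tr.
  by apply: TD => //; exact: TM.
have below s : s <= 0 -> T (f + iota s) -> T f.
  move=> s0 Tfs; have -> : f = f + iota s + iota (- s) by rewrite rmorphN addrK.
  by apply: TD => //; apply: Tr; rewrite oppr_ge0.
suff iter k s : s <= k%:R * n^-1 -> T (f + iota s) -> T f.
  apply: (iter (Num.truncn (r * n)).+1 r) => //.
  by rewrite ler_pdivlMr //; apply/ltW/truncnS_gt.
elim: k s => [|k IHk] s; first by rewrite mul0r; exact: below.
move=> sk Tfs; have [s0|/ltW s0] := leP s 0; first exact: below Tfs.
by apply: (IHk (s - n^-1)); [move: sk; rewrite -natr1 => sk; lra|exact: step].
Qed.

Definition proper_module M :=
  [/\ T `<=` M, forall a b, M a -> M b -> M (a + b),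
      forall t a, T t -> M a -> M (t * a) & ~ M (- 1)].

Lemma maximal_module M0 : proper_module M0 ->
  exists M, [/\ proper_module M, M0 `<=` M &
    forall M', proper_module M' -> M `<=` M' -> M' `<=` M].
Proof.
move=> pM0.
(* the union with [M0] gives the empty chain an upper bound *)
have [F FP Ftot|A [PA maxA]] := @Zorn_bigcup _ [set X | proper_module (X `|` M0)].
  have chain a b : (\bigcup_(X in F) X `|` M0) a -> (\bigcup_(X in F) X `|` M0) b ->
      exists Y, [/\ proper_module Y, Y a, Y b & Y `<=` \bigcup_(X in F) X `|` M0].
    move=> [[X FX Xa]|Ma] [[Z FZ Zb]|Mb].
    - have [XZ|ZX] := Ftot X Z FX FZ.
        exists (Z `|` M0); split; [exact: FP|by left; exact: XZ|by left|].
        by apply: setSU => z Zz; exists Z.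
      exists (X `|` M0); split; [exact: FP|by left|by left; exact: ZX|].
      by apply: setSU => z Xz; exists X.
    - exists (X `|` M0); split; [exact: FP|by left|by right|].
      by apply: setSU => z Xz; exists X.
    - exists (Z `|` M0); split; [exact: FP|by right|by left|].
      by apply: setSU => z Zz; exists Z.
    by exists M0; split => //; exact: subsetUr.
  split=> [t Tt|a b Ua Ub|t a Tt Ua|U1].
  - by right; case: pM0 => TM0 _ _ _; exact: TM0.
  - have [Y [[_ YD _ _] Ya Yb YU]] := chain a b Ua Ub; apply: YU; exact: YD.
  - have [Y [[_ _ YM _] Ya _ YU]] := chain a a Ua Ua; apply: YU; exact: YM.
  - by have [Y [[_ _ _ Y1] Ya _ _]] := chain _ _ U1 U1.
exists (A `|` M0); split; [by []|exact: subsetUr|].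
move=> M' pM' AM'; apply: contrapT => nsub; apply: (maxA M'); last first.
  rewrite /= (_ : M' `|` M0 = M') //; apply/setUidPl.
  by apply: subset_trans AM'; exact: subsetUr.
split; last by move=> M'A; apply: nsub; apply: subset_trans M'A _; exact: subsetUl.
by apply: subset_trans AM'; exact: subsetUl.
Qed.

Section Maximal.
Variable M : set S.
Hypothesis pM : proper_module M.
Hypothesis maxM : forall M', proper_module M' -> M `<=` M' -> M' `<=` M.

Let MT a : T a -> M a. Proof. by case: pM => h _ _ _; exact: h. Qed.
Let MD a b : M a -> M b -> M (a + b). Proof. by case: pM => _ h _ _; exact: h. Qed.
Let MM t a : T t -> M a -> M (t * a). Proof. by case: pM => _ _ h _; exact: h. Qed.
Let M1 : ~ M (- 1). Proof. by case: pM. Qed.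
Let Mr r : 0 <= r -> M (iota r). Proof. by move=> r0; apply/MT/Tr. Qed.

Lemma maximal_refutation a : ~ M a -> exists t m, [/\ T t, M m & - 1 = m + t * a].
Proof.
move=> nMa; pose M' := [set b | exists t m, [/\ T t, M m & b = m + t * a]].
apply: contrapT => no; apply: nMa; apply: (maxM (M' := M')).
- split=> [t Tt|b c [t [m [Tt Mm ->]]] [s [n [Ts Mn ->]]]|s b Ts [t [m [Tt Mm ->]]]|].
  + exists (iota 0), t; split; [exact: Tr|exact: MT|by rewrite rmorph0; ring].
  + by exists (t + s), (m + n); split; [exact: TD|exact: MD|ring].
  + by exists (s * t), (s * m); split; [exact: TM|exact: MM|ring].
  + by move=> M'1; apply: no.
- move=> m Mm; exists (iota 0), m; split=> //; [exact: Tr|by rewrite rmorph0; ring].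
- exists (iota 1), (iota 0); split; [exact: Tr|exact: Mr|].
  by rewrite rmorph0 rmorph1; ring.
Qed.

(** If neither [a] nor [- a] can be added to [M], there are [t, s] in [T] with
    [-1 - t a] and [-1 + s a] in [M]; eliminating [a] puts [- t] in [M], and then
    [-1] as well because [a] is bounded below. *)
Lemma maximal_total a : M a \/ M (- a).
Proof.
apply: contrapT => /not_orP[/maximal_refutation[t [m [Tt Mm E1]]]].
move=> /maximal_refutation[s [n [Ts Mn E2]]].
have Mt : M (- t).
  have -> : - t = s + (t * n + s * m).
    apply/eqP; rewrite -subr_eq0; apply/eqP.
    have -> : - t - (s + (t * n + s * m)) =
      (t * -1 - t * (n + s * - a)) + (s * -1 - s * (m + t * a)) by ring.
    by rewrite -E1 -E2 !subrr addr0.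
  by apply: MD; [exact: MT|apply: MD; exact: MM].
have [r r0 Ta] := cone_arch_pos (- a); rewrite opprK in Ta.
apply: M1; rewrite E1.
have -> : m + t * a = m + t * (iota r + a) + iota r * - t by ring.
apply: MD; last by apply: MM => //; apply: Tr; exact: ltW.
by apply: MD => //; apply: MT; exact: TM.
Qed.

Lemma maximal_iota r : M (iota r) -> 0 <= r.
Proof.
move=> Mir; rewrite leNgt; apply/negP => r0; apply: M1.
have -> : - 1 = iota (- r)^-1 * iota r.
  rewrite -rmorphM invrN mulNr mulVf ?rmorphN1 //.
  by rewrite lt_eqF.
by apply: MM => //; apply: Tr; rewrite invr_ge0 oppr_ge0 ltW.
Qed.

Definition cut a : R := sup [set r | M (a - iota r)].

Lemma cut_has_sup a : has_sup [set r | M (a - iota r)].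
Proof.
split.
  have [r r0 Ta] := cone_arch_pos (- a); exists (- r) => /=; apply: MT.
  by rewrite rmorphN opprK addrC -[a]opprK.
have [r r0 Ta] := cone_arch_pos a; exists r => s /= Ms.
rewrite -subr_ge0; apply: maximal_iota.
have -> : iota (r - s) = (iota r - a) + (a - iota s) by rewrite rmorphB; ring.
by apply: MD => //; exact: MT.
Qed.

Lemma cutP a c : (forall e, 0 < e -> M (a - iota c + iota e) /\ M (iota c - a + iota e)) <->
  cut a = c.
Proof.
have [ne ub] := cut_has_sup a; split=> [h|<- e e0].
  apply/eqP; rewrite eq_le; apply/andP; split.
    apply: ge_sup => // r /= Mr'; apply: ler_eps => e e0.
    rewrite -subr_ge0; apply: maximal_iota.
    have -> : iota (c + e - r) = (a - iota r) + (iota c - a + iota e).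
      by rewrite rmorphB rmorphD; ring.
    by apply: MD => //; case: (h e e0).
  apply: ler_eps => e e0; rewrite -lerBlDr; apply: ub_le_sup => //=.
  by rewrite rmorphB opprB addrA (addrAC a) addrAC; case: (h e e0) => + _; congr M; ring.
split.
  have [r Mar er] := sup_adherent e0 (cut_has_sup a).
  have -> : a - iota (cut a) + iota e = (a - iota r) + iota (r - (cut a - e)).
    by rewrite !rmorphB; ring.
  by apply: MD => //; apply: Mr; rewrite subr_ge0 ltW.
have [Mn|Mn] := maximal_total (iota (cut a) - a + iota e) => //.
have : cut a + e <= cut a.
  by apply: ub_le_sup => //=; move: Mn; congr M; rewrite rmorphD; ring.
by rewrite gerDl leNgt e0.
Qed.

Lemma cut_approx a e : 0 < e ->
  M (a - iota (cut a) + iota e) /\ M (iota (cut a) - a + iota e).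
Proof. by move: e; exact/cutP. Qed.

Lemma cut_iota r : cut (iota r) = r.
Proof. by apply/cutP => e e0; rewrite subrr add0r; split; apply: Mr; exact: ltW. Qed.

Lemma cut_add a b : cut (a + b) = cut a + cut b.
Proof.
apply/cutP => e e0.
have e2 : 0 < e / 2 by rewrite divr_gt0.
have [a1 a2] := cut_approx a e2; have [b1 b2] := cut_approx b e2.
have -> : iota e = iota (e / 2) + iota (e / 2) by rewrite -rmorphD -splitr.
rewrite !rmorphD; split.
  by move: (MD a1 b1); congr M; ring.
by move: (MD a2 b2); congr M; ring.
Qed.

Lemma cut_ge0 a : M a -> 0 <= cut a.
Proof.
move=> Ma; apply: ub_le_sup; first by case: (cut_has_sup a).
by rewrite /= rmorph0 subr0.
Qed.

Lemma cut_opp a : cut (- a) = - cut a.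
Proof.
apply/eqP; rewrite -subr_eq0 opprK addrC -cut_add subrr.
by have := cut_iota 0; rewrite rmorph0 => ->.
Qed.

Lemma cut_scale c a : cut (iota c * a) = c * cut a.
Proof.
suff pos d : 0 <= d -> cut (iota d * a) = d * cut a.
  have [/pos //|c0] := leP 0 c; apply/oppr_inj.
  by rewrite -cut_opp -mulNr -[in RHS]mulNr -rmorphN pos // oppr_ge0 ltW.
move=> d0; apply/cutP => e e0; pose r := e / (d + 1).
have d1 : 0 < d + 1 by lra.
have r0 : 0 < r by rewrite divr_gt0.
have er : iota e = iota d * iota r + iota r.
  by rewrite -rmorphM -rmorphD; congr (iota _); rewrite /r; field; rewrite gt_eqF.
have [a1 a2] := cut_approx a r0; rewrite er rmorphM.
have Mir : M (iota r) by apply: Mr; exact: ltW.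
split.
  by move: (MD (MM (Tr d0) a1) Mir); congr M; ring.
by move: (MD (MM (Tr d0) a2) Mir); congr M; ring.
Qed.

(** [t] multiplies [M] into itself, so that [t] times an element with cut [0]
    has cut [0]; the rest is scalar. *)
Lemma cut_mul_cone t a : T t -> cut (t * a) = cut t * cut a.
Proof.
move=> Tt.
have [n n0 Tn] := cone_arch_pos t; have n1 : n != 0 by rewrite gt_eqF.
suff /eqP : cut (t * (a - iota (cut a))) = 0.
  rewrite mulrBr cut_add cut_opp subr_eq0 => /eqP ->.
  by rewrite mulrC cut_scale mulrC.
apply/cutP => e e0; rewrite rmorph0.
have d0 : 0 < e / n by rewrite divr_gt0.
have [a1 a2] := cut_approx a d0.
have ed : iota e = iota n * iota (e / n) by rewrite -rmorphM mulrCA mulfV // mulr1.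
have Mnt : M (iota (e / n) * (iota n - t)).
  by apply/MT/TM => //; apply: Tr; exact: ltW.
split; rewrite ed.
  by move: (MD (MM Tt a1) Mnt); congr M; ring.
by move: (MD (MM Tt a2) Mnt); congr M; ring.
Qed.

Lemma cut_mul a b : cut (a * b) = cut a * cut b.
Proof.
have [r r0 Ta] := cone_arch_pos (- a); rewrite opprK in Ta.
have := cut_mul_cone b Ta; rewrite mulrDl !cut_add cut_mul_cone; last by apply: Tr; exact: ltW.
by rewrite mulrDl => /addrI.
Qed.

End Maximal.

(** The module generated by [T] and [- f] omits [-1] by [cone_quotient]. *)
Theorem archimedean_character f : ~ T f ->
  exists tau : S -> R,
    [/\ {morph tau : a b / a + b}, {morph tau : a b / a * b},
        forall r, tau (iota r) = r, forall t, T t -> 0 <= tau t & tau f <= 0].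
Proof.
move=> nTf; pose M0 := [set b | exists t s, [/\ T t, T s & b = t - s * f]].
have T0 : T (iota 0) by exact: Tr.
have pM0 : proper_module M0.
  split=> [t Tt|b c [t [s [Tt Ts ->]]] [t' [s' [Tt' Ts' ->]]]|u b Tu [t [s [Tt Ts ->]]]|].
  + by exists t, (iota 0); split => //; rewrite rmorph0; ring.
  + by exists (t + t'), (s + s'); split; [exact: TD|exact: TD|ring].
  + by exists (u * t), (u * s); split; [exact: TM|exact: TM|ring].
  + move=> [t [s [Tt Ts E]]]; apply: nTf; apply: (cone_quotient Ts).
    suff -> : s * f - 1 = t by [].
    by rewrite E; ring.
have [M [pM M0M maxM]] := maximal_module pM0.
exists (cut M); split.
- exact: cut_add.
- exact: cut_mul.
- exact: cut_iota.
- by move=> t Tt; apply: cut_ge0 => //; case: pM => TM' _ _ _; exact: TM'.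
- rewrite -oppr_ge0 -cut_opp //; apply: cut_ge0 => //; apply: M0M.
  exists (iota 0), (iota 1); split => //; first exact: Tr.
  by rewrite rmorph0 rmorph1; ring.
Qed.

End ArchimedeanCharacter.

(** * Characters of a commutative algebra of operators *)

Section OperatorAlgebra.
Context {R : realType} {H : hilbertType R}.
Implicit Types (S T U : H -> H) (X K : set (H -> H)) (x y z : H).

(** Unital commutative [*]-algebras of bounded operators; they need not be
    closed in norm. *)
Record opalg X : Prop := OpAlg {
  opalg_BH : X `<=` BH;
  opalg_id : X idfun;
  opalg_lin : forall (k : R[i]) S T, X S -> X T -> X (k *: S + T);
  opalg_comp : forall S T, X S -> X T -> X (S \o T);
  opalg_comm : forall S T, X S -> X T -> S \o T = T \o S;
  opalg_adj : forall S, X S -> exists2 S', X S' & is_adjoint S' S }.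

Section Algebra.
Variable X : set (H -> H).
Hypothesis hX : opalg X.

Lemma opalg_linear S : X S -> linear S.
Proof. by move=> /(opalg_BH hX)/BH_linear. Qed.

Lemma opalg0 : X 0.
Proof.
rewrite -(addNr idfun) -scaleN1r.
by apply: (opalg_lin hX); exact: opalg_id.
Qed.

Lemma opalgZ (k : R[i]) S : X S -> X (k *: S).
Proof. by move=> XS; rewrite -[_ *: _]addr0; exact: (opalg_lin hX k XS opalg0). Qed.

Lemma opalgD S T : X S -> X T -> X (S + T).
Proof. by move=> XS XT; rewrite -[S]scale1r; exact: opalg_lin. Qed.

Lemma opalgN S : X S -> X (- S).
Proof. by move=> XS; rewrite -scaleN1r; exact: opalgZ. Qed.

Lemma opalgB S T : X S -> X T -> X (S - T).
Proof. by move=> XS XT; apply/opalgD/opalgN. Qed.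

Lemma opalgC S T x : X S -> X T -> S (T x) = T (S x).
Proof. by move=> XS XT; rewrite -[LHS]/((S \o T) x) (opalg_comm hX XS XT). Qed.

Lemma adj_real (r : R) S : is_adjoint S S -> is_adjoint (r%:C *: S) (r%:C *: S).
Proof. by move=> aS x y; rewrite !fctE innerZl innerZr aS conj_real. Qed.

(** Positivity is tested on an invariant set [K] of vectors only, a cyclic
    subspace in the application: characters that are positive on the resulting
    cone kill the operators that vanish on [K]. *)
Section Positivity.
Variable K : set H.
Hypothesis KX : forall S y, X S -> K y -> K (S y).

Definition pos S := forall y, K y -> 0 <= ip (S y) y.

Definition riesz_step S := S - (S \o S).

Lemma riesz_step_pos S : X S -> is_adjoint S S -> pos S -> pos (idfun - S) ->
  [/\ X (riesz_step S), is_adjoint (riesz_step S) (riesz_step S),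
      pos (riesz_step S) & pos (idfun - riesz_step S)].
Proof.
move=> XS aS p0 p1; have lS := opalg_linear XS; split.
- exact: (opalgB XS (opalg_comp hX XS XS)).
- move=> x y; rewrite /riesz_step !fctE /= innerDl innerNl !aS innerDr.
  by rewrite -[- S (S y)]scaleN1r innerZr rmorphN rmorph1 mulN1r.
- move=> y Ky; rewrite /riesz_step !fctE /=.
  have h1 := p1 _ (KX XS Ky); have XS1 := opalgB (opalg_id hX) XS.
  have h2 := p0 _ (KX XS1 Ky).
  suff -> : ip (S y - S (S y)) y =
      ip ((idfun - S) (S y)) (S y) + ip (S ((idfun - S) y)) ((idfun - S) y).
    exact: addr_ge0.
  rewrite !fctE /= linB //.
  have aS' u v : ip (S u) v = ip u (S v) by rewrite /ip aS.
  by rewrite !(ipDl, ipNl, ipDr, ipNr) !aS'; ring.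
- move=> y Ky; rewrite /riesz_step !fctE /= opprB addrCA addrC ipDl.
  by apply: addr_ge0; [exact: p1|rewrite /ip aS ip_ge0].
Qed.

(** For commuting [0 <= S <= 1] and [T >= 0], the squares of the iterates [p_k]
    of [p - p^2] have sum [S], so that [S T = sum_k p_k T p_k >= 0]. *)
Lemma pos_comp1 S T : X S -> X T -> is_adjoint S S -> pos S -> pos (idfun - S) ->
  pos T -> pos (S \o T).
Proof.
move=> XS XT aS pS pS1 pT y Ky; pose p n := iter n riesz_step S.
have pP n : [/\ X (p n), is_adjoint (p n) (p n), pos (p n) & pos (idfun - p n)].
  by elim: n => [|n [h1 h2 h3 h4]] /=; [split|exact: riesz_step_pos].
have adj n u v : ip (p n u) v = ip u (p n v) by have [_ a _ _] := pP n; rewrite /ip a.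
have sumS n z : ip (S z) z = \sum_(k < n) rnorm (p k z) ^+ 2 + ip (p n z) z.
  elim: n => [|n ->]; first by rewrite big_ord0 add0r.
  rewrite big_ord_recr /= -addrA; congr (_ + _).
  by rewrite /riesz_step !fctE /= rnorm_sqr ipDl ipNl !adj; ring.
have sumST n : ip (S (T y)) y = \sum_(k < n) ip (T (p k y)) (p k y) + ip (p n (T y)) y.
  elim: n => [|n ->]; first by rewrite big_ord0 add0r.
  rewrite big_ord_recr /= -addrA; congr (_ + _).
  have [Xp _ _ _] := pP n.
  by rewrite /riesz_step !fctE /= (opalgC _ XT Xp) ipDl ipNl !adj; ring.
rewrite /= -oppr_le0; apply: ler_eps => e e0; rewrite add0r.
pose d := e / (rnorm (T y) + 1).
have t1 : 0 < rnorm (T y) + 1 by rewrite ltr_wpDl // rnorm_ge0.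
have d0 : 0 < d by rewrite divr_gt0.
have [n pn] : exists n, rnorm (p n y) <= d.
  apply: contrapT => /forallNP no.
  have big n : d ^+ 2 *+ n <= ip (S y) y.
    rewrite (sumS n y); apply: (@le_trans _ _ (\sum_(k < n) rnorm (p k y) ^+ 2)).
      rewrite -[n in leLHS]card_ord -sumr_const; apply: ler_sum => k _.
      rewrite ler_pXn2r // ?nnegrE ?rnorm_ge0 ?(ltW d0) //.
      by have /negP := no k; rewrite -ltNge => /ltW.
    by rewrite lerDl; have [_ _ h _] := pP n; exact: h.
  have := big (Num.truncn (ip (S y) y / d ^+ 2)).+1.
  rewrite leNgt -[_ *+ _]mulr_natr mulrC -ltr_pdivrMr ?exprn_gt0 //.
  by rewrite truncnS_gt.
rewrite (sumST n) opprD; apply: (@le_trans _ _ (- ip (p n (T y)) y)).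
  rewrite gerDr oppr_le0; apply: sumr_ge0 => k _; apply: pT.
  by apply: KX => //; have [] := pP k.
apply: le_trans (ler_norm _) _; rewrite normrN adj.
apply: le_trans (CauchySchwarz _ _) _.
apply: le_trans (ler_wpM2l (rnorm_ge0 _) pn) _.
by rewrite mulrCA ler_piMr ?(ltW e0) // ler_pdivrMr // mul1r lerDl.
Qed.

Lemma pos_bnd S c : bnd S c -> pos (c%:C *: idfun - S).
Proof.
move=> bS y _; rewrite !fctE /= ipDl ipNl ipZl subr_ge0.
apply: le_trans (ip_le _ _) _; rewrite -rnorm_sqr expr2 mulrA.
by rewrite ler_wpM2r // rnorm_ge0.
Qed.

(** Rescaling [S] reduces this to [pos_comp1]. *)
Lemma pos_comp S T : X S -> X T -> is_adjoint S S -> pos S -> pos T -> pos (S \o T).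
Proof.
move=> XS XT aS pS pT; have [c c0 bS] := BH_bnd (opalg_BH hX XS).
have bS1 : bnd S (c + 1) by apply: bndS bS; rewrite lerDl ler01.
pose d := c + 1; have d0 : 0 < d by rewrite ltr_wpDl.
have posZ r U : 0 <= r -> pos U -> pos (r%:C *: U).
  by move=> r0 pU y Ky; rewrite !fctE /= ipZl mulr_ge0 // pU.
have di : 0 <= d^-1 by rewrite invr_ge0 ltW.
have -> : S \o T = d%:C *: ((d^-1%:C *: S) \o T).
  apply/funext => y; rewrite !fctE /= scalerA -rmorphM mulfV ?scale1r //.
  by rewrite gt_eqF.
apply: (posZ d); first exact: ltW.
apply: pos_comp1 => //; first exact: opalgZ.
- exact: adj_real.
- exact: (posZ d^-1).
have -> : idfun - d^-1%:C *: S = d^-1%:C *: (d%:C *: idfun - S).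
  rewrite scalerBr scalerA -rmorphM mulVf ?scale1r //.
  by rewrite gt_eqF.
by apply: (posZ d^-1) => //; exact: pos_bnd.
Qed.

End Positivity.

(** Kadison-Dubois is about real algebras, whence this restriction to the
    self-adjoint elements. *)
Record sa := Sa { op : H -> H; op_in : X op; op_adj : is_adjoint op op }.

Lemma sa_eq (a b : sa) : op a = op b -> a = b.
Proof.
case: a b => [S XS aS] [T XT aT] /= ST; case: T / ST XT aT => XT aT.
by congr Sa; exact: Prop_irrelevance.
Qed.

Lemma adjD S S' T T' : is_adjoint S S' -> is_adjoint T T' ->
  is_adjoint (S + T) (S' + T').
Proof. by move=> aS aT x y; rewrite !fctE innerDl innerDr aS aT. Qed.

Lemma adj_comp S S' T T' : is_adjoint S S' -> is_adjoint T T' ->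
  is_adjoint (S \o T) (T' \o S').
Proof. by move=> aS aT x y; rewrite /= aS aT. Qed.

Lemma adj_id : is_adjoint (idfun : H -> H) idfun. Proof. by []. Qed.

Lemma adjN S S' : is_adjoint S S' -> is_adjoint (- S) (- S').
Proof.
move=> aS x y; rewrite !fctE innerNl aS -[- S' y]scaleN1r innerZr.
by rewrite rmorphN rmorph1 mulN1r.
Qed.

Lemma adj0 : is_adjoint (0 : H -> H) 0.
Proof. by move=> x y; rewrite inner0l inner0r. Qed.

Definition sa_zero := Sa opalg0 adj0.
Definition sa_add a b := Sa (opalgD (op_in a) (op_in b)) (adjD (@op_adj a) (@op_adj b)).
Definition sa_opp a := Sa (opalgN (op_in a)) (adjN (@op_adj a)).
Definition sa_one := Sa (opalg_id hX) adj_id.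
Lemma sa_mul_adj a b : is_adjoint (op a \o op b) (op a \o op b).
Proof. by rewrite {2}(opalg_comm hX (op_in a) (op_in b)); apply: adj_comp; exact: op_adj. Qed.
Definition sa_mul a b := Sa (opalg_comp hX (op_in a) (op_in b)) (@sa_mul_adj a b).

End Algebra.
End OperatorAlgebra.

Section SelfAdjointRing.
Context {R : realType} {H : hilbertType R} {X : set (H -> H)}.

(** The ring structure depends on the proof that [X] is an algebra. *)
Definition saR (hX : opalg X) : Type := sa X.

Variable hX : opalg X.

HB.instance Definition _ := gen_eqMixin (saR hX).
HB.instance Definition _ := gen_choiceMixin (saR hX).

Fact saR_addA : @associative (saR hX) (sa_add hX).
Proof. by move=> a b c; apply: sa_eq; rewrite /= addrA. Qed.
Fact saR_addC : @commutative (saR hX) _ (sa_add hX).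
Proof. by move=> a b; apply: sa_eq; rewrite /= addrC. Qed.
Fact saR_add0 : @left_id (saR hX) _ (sa_zero hX) (sa_add hX).
Proof. by move=> a; apply: sa_eq; rewrite /= add0r. Qed.
Fact saR_addN : @left_inverse (saR hX) _ _ (sa_zero hX) (sa_opp hX) (sa_add hX).
Proof. by move=> a; apply: sa_eq; rewrite /= addNr. Qed.
HB.instance Definition _ :=
  GRing.isZmodule.Build (saR hX) saR_addA saR_addC saR_add0 saR_addN.

Fact saR_mulA : @associative (saR hX) (sa_mul hX).
Proof. by move=> a b c; apply: sa_eq. Qed.
Fact saR_mulC : @commutative (saR hX) _ (sa_mul hX).
Proof. by move=> a b; apply: sa_eq; rewrite /= (opalg_comm hX) //; exact: op_in. Qed.
Fact saR_mul1 : @left_id (saR hX) _ (sa_one hX) (sa_mul hX).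
Proof. by move=> a; apply: sa_eq. Qed.
Fact saR_mulD : @left_distributive (saR hX) _ (sa_mul hX) (sa_add hX).
Proof. by move=> a b c; apply: sa_eq. Qed.
HB.instance Definition _ :=
  GRing.Zmodule_isComPzRing.Build (saR hX) saR_mulA saR_mulC saR_mul1 saR_mulD.

Definition sa_scalar (r : R) : saR hX :=
  Sa (opalgZ hX (r%:C) (opalg_id hX)) (adj_real r (@adj_id _ H)).

Fact sa_scalar_zmod : zmod_morphism sa_scalar.
Proof.
by move=> r s; apply: sa_eq; rewrite /= rmorphB scalerBl.
Qed.
Fact sa_scalar_monoid : monoid_morphism sa_scalar.
Proof.
split=> [|r s]; apply: sa_eq; first by rewrite /= scale1r.
by rewrite /= rmorphM; apply/funext => x; rewrite !fctE /= scalerA.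
Qed.
HB.instance Definition _ := GRing.isZmodMorphism.Build _ _ sa_scalar sa_scalar_zmod.
HB.instance Definition _ := GRing.isMonoidMorphism.Build _ _ sa_scalar sa_scalar_monoid.

Implicit Types (S T U : H -> H) (a b : saR hX) (x y z : H).

Lemma cartesian S S' : X S -> X S' -> is_adjoint S' S ->
  exists a b, S = op a + 'i *: op b /\ S' = op a - 'i *: op b.
Proof.
move=> XS XS' aS; have aS' := is_adjointC aS.
have X1 : X ((2^-1)%:C *: (S + S')) by apply: (opalgZ hX); exact: (opalgD hX).
have A1 : is_adjoint ((2^-1)%:C *: (S + S')) ((2^-1)%:C *: (S + S')).
  by apply: adj_real; rewrite {2}[S + S']addrC; exact: adjD.
have X2 : X ((2^-1)%:C *: ('i *: (S' - S))).
  by apply: (opalgZ hX); apply: (opalgZ hX); exact: (opalgB hX).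
have A2 : is_adjoint ((2^-1)%:C *: ('i *: (S' - S))) ((2^-1)%:C *: ('i *: (S' - S))).
  apply: adj_real => x y; rewrite !fctE innerZl innerZr innerDl innerNl.
  rewrite aS aS' innerDr -[- S y]scaleN1r innerZr rmorphN rmorph1.
  by rewrite conjCi; ring.
have half : (2^-1 : R)%:C + (2^-1)%:C = 1 :> R[i].
  by rewrite -rmorphD /= (_ : 2^-1 + 2^-1 = 1 :> R) ?rmorph1 //; field.
have ii : 'i * 'i = - 1 :> R[i] by rewrite -expr2 sqrCi.
have E2 : 'i *: ((2^-1)%:C *: ('i *: (S' - S))) = (2^-1)%:C *: (S - S').
  by rewrite !scalerA mulrAC ii mulN1r scaleNr -scalerN opprB.
exists (Sa X1 A1), (Sa X2 A2); rewrite /= E2; split.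
  by rewrite -scalerDr addrACA subrr addr0 scalerDr -scalerDl half scale1r.
by rewrite -scalerBr opprB [X in _ *: X]addrC subrKA scalerDr -scalerDl half scale1r.
Qed.

(** [op a] is then self-adjoint and skew-adjoint. *)
Lemma cartesian_uniq a b : op a + 'i *: op b = 0 -> a = 0 /\ b = 0.
Proof.
move=> ab; have E x : op a x = - ('i *: op b x).
  have := congr1 (fun f : H -> H => f x) ab; rewrite !fctE => /eqP.
  by rewrite addr_eq0 => /eqP.
have a0 : op a = 0.
  apply/funext => x; apply: inner_eq0 => z.
  suff h : inner (op a x) z = - inner (op a x) z.
    by move/eqP: h; rewrite -addr_eq0 -mulr2n mulrn_eq0 => /eqP.
  rewrite {1}op_adj E -[- ('i *: _)]scaleNr innerZr -op_adj.
  by rewrite E innerNl innerZl rmorphN mulNr [X in - (X * _)]conjCi; ring.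
split; apply: sa_eq => //=; apply/funext => x.
have := E x; rewrite a0 => /esym/eqP; rewrite oppr_eq0 scaler_eq0.
by rewrite (negbTE (neq0Ci _)) => /eqP.
Qed.

Section VectorCharacter.
Variable x : H.

Let K : set H := [set k x | k in X].

Let KX S y : X S -> K y -> K (S y).
Proof. by move=> XS [T XT <-]; exists (S \o T) => //; exact: (opalg_comp hX). Qed.

Definition cone : set (saR hX) := [set a | pos K (op a)].

(** A small multiple [e] of the unit keeps [h + e] negative at [x], hence outside
    the cone, and makes the value at [h] strictly negative. *)
Lemma real_character (h : saR hX) : ip (op h x) x < 0 ->
  exists t : saR hX -> R,
    [/\ {morph t : a b / a + b}, {morph t : a b / a * b},
        forall r, t (sa_scalar r) = r,
        forall a, cone a -> 0 <= t a & t h < 0].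
Proof.
move=> hx; have nx : 0 < rnorm x ^+ 2.
  by rewrite exprn_gt0 // rnorm_gt0 //; apply: contraTneq hx => ->; rewrite ip0r ltxx.
pose e : R := - ip (op h x) x / (2 * rnorm x ^+ 2).
have e0 : 0 < e by apply: divr_gt0; [rewrite oppr_gt0|apply: mulr_gt0].
have eE : e * rnorm x ^+ 2 = - ip (op h x) x / 2.
  by rewrite /e; move: nx; set q := _ ^+ 2 => nx; field; rewrite gt_eqF.
have [a b ca cb|a b ca cb|r r0|a|//|t [tD tM tr t0 th]] :=
  @archimedean_character _ _ sa_scalar cone _ _ _ _ (h + sa_scalar e).
- by move=> y Ky; rewrite /= !fctE ipDl addr_ge0 //; [exact: ca|exact: cb].
- by apply: (pos_comp hX KX) => //; [exact: op_in|exact: op_in|exact: op_adj].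
- by move=> y Ky; rewrite /= !fctE ipZl mulr_ge0 // ip_ge0.
- have [c c0 bc] := BH_bnd (opalg_BH hX (op_in a)).
  by exists c; rewrite /cone /=; exact: (@pos_bnd _ _ K).
- move=> /(_ x); rewrite /= !fctE ipDl ipZl -rnorm_sqr eE => /(_ _).
  have Kx : K x by exists idfun => //; exact: opalg_id.
  by move=> /(_ Kx) hh; lra.
exists t; split=> //; have := th; rewrite tD tr => ?; lra.
Qed.

(** The character comes from the cone of the operators that are positive on the
    cyclic subspace of [x]. If [S x = 0] then [S] vanishes on that subspace by
    commutativity, so that both signs of [S' S] lie in the cone and [tau S = 0]. *)
Theorem vector_character (h : H -> H) : X h -> is_adjoint h h -> ip (h x) x < 0 ->
  exists tau : (H -> H) -> R[i],
    [/\ forall (k : R[i]) S T, X S -> X T -> tau (k *: S + T) = k * tau S + tau T,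
        forall S T, X S -> X T -> tau (S \o T) = tau S * tau T,
        tau idfun = 1,
        exists2 r : R, r < 0 & tau h = r%:C
      & forall S, X S -> S x = 0 -> tau S = 0].
Proof.
move=> Xh ah hx; have [t [tD tM tr t0 th]] := @real_character (Sa Xh ah) hx.
have tZ r a : t (sa_scalar r * a) = r * t a by rewrite tM tr.
have tN a : t (- a) = - t a.
  have := tZ (-1) a; rewrite mulN1r => <-; congr t; apply: sa_eq => /=.
  by apply/funext => y; rewrite !fctE /= rmorphN rmorph1 scaleN1r.
have /choice[f fP] S : exists ab : saR hX * saR hX,
    X S -> S = op ab.1 + 'i *: op ab.2.
  have [XS|nXS] := pselect (X S); last by exists (0, 0).
  have [S' XS' aS] := opalg_adj hX XS.
  by have [a [b [E _]]] := cartesian XS XS' aS; exists (a, b).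
pose tau S := t (f S).1 +i* t (f S).2.
have tauE S a b : X S -> S = op a + 'i *: op b -> tau S = t a +i* t b.
  move=> XS E; rewrite /tau; suff [-> ->] : (f S).1 = a /\ (f S).2 = b by [].
  have := fP S XS; rewrite {1}E => E2.
  have [|/eqP + /eqP] := @cartesian_uniq ((f S).1 - a) ((f S).2 - b).
    rewrite /= scalerBr addrACA -opprD -E2 subrr //.
  by rewrite !subr_eq0 => /eqP -> /eqP ->.
have tauh : tau h = (t (Sa Xh ah))%:C.
  rewrite (@tauE h (Sa Xh ah) 0) //=; last by rewrite scaler0 addr0.
  by have := tr 0; rewrite rmorph0 => ->.
exists tau; split.
- move=> [u v] S T XS XT.
  set a := (f S).1; set b := (f S).2; set c := (f T).1; set d := (f T).2.
  rewrite (@tauE _ (sa_scalar u * a - sa_scalar v * b + c)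
                   (sa_scalar v * a + sa_scalar u * b + d)).
  + rewrite !(tD, tN, tZ) /tau -/a -/b -/c -/d.
    by apply/eqP; rewrite eq_complex /=; apply/andP; split; apply/eqP; ring.
  + exact: (opalg_lin hX).
  apply/funext => y; rewrite {1}(fP S XS) {1}(fP T XT) !fctE /= -/a -/b -/c -/d.
  have -> : u +i* v = u%:C + 'i * v%:C by rewrite [LHS]complexE.
  have ii : 'i * 'i = - 1 :> R[i] by rewrite -expr2 sqrCi.
  apply: inner_inj => z; rewrite !(innerDl, innerNl, innerZl).
  by ring: ii.
- move=> S T XS XT.
  set a := (f S).1; set b := (f S).2; set c := (f T).1; set d := (f T).2.
  rewrite (@tauE _ (a * c - b * d) (a * d + b * c)).
  + rewrite !(tD, tN, tM) /tau -/a -/b -/c -/d.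
    by apply/eqP; rewrite eq_complex /=; apply/andP; split; apply/eqP; ring.
  + exact: (opalg_comp hX).
  apply/funext => y; rewrite {1}(fP S XS) {1}(fP T XT) !fctE /= -/a -/b -/c -/d.
  have la := opalg_linear hX (op_in a); have lb := opalg_linear hX (op_in b).
  rewrite !(linD _ _ la) !(linD _ _ lb) !(linZ _ _ la) !(linZ _ _ lb).
  have ii : 'i * 'i = - 1 :> R[i] by rewrite -expr2 sqrCi.
  apply: inner_inj => z; rewrite !(innerDl, innerNl, innerZl).
  by ring: ii.
- rewrite (@tauE idfun 1 0) /=; last 2 first.
  + exact: opalg_id.
  + by rewrite scaler0 addr0.
  by have := tr 0; have := tr 1; rewrite rmorph0 rmorph1 => -> ->.
- by exists (t (Sa Xh ah)).
move=> S XS Sx; have [S' XS' aS] := opalg_adj hX XS.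
have [a [b [E E']]] := cartesian XS XS' aS.
have Kz y : K y -> S y = 0.
  move=> [T XT <-]; rewrite (opalgC hX x XS XT) Sx lin0 //.
  exact: opalg_linear hX _ XT.
(* [S' S = a^2 + b^2] vanishes on [K], hence so does its image by [t] *)
have ab0 : t (a * a + b * b) <= 0.
  rewrite -oppr_ge0 -tN; apply: t0 => y Ky; rewrite /= !fctE /=.
  suff -> : op a (op a y) + op b (op b y) = S' (S y).
    rewrite Kz // lin0 ?oppr0 ?ip0l //; exact: opalg_linear hX _ XS'.
  have la := opalg_linear hX (op_in a); have lb := opalg_linear hX (op_in b).
  rewrite E E' !fctE !(linD _ _ la) !(linD _ _ lb) !(linZ _ _ la) !(linZ _ _ lb).
  rewrite (opalgC hX _ (op_in b) (op_in a)).
  have ii : 'i * 'i = - 1 :> R[i] by rewrite -expr2 sqrCi.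
  by apply: inner_inj => z; rewrite !(innerDl, innerNl, innerZl); ring: ii.
have [ta tb] : t a = 0 /\ t b = 0.
  move: ab0; rewrite tD !tM -!expr2 => ab0.
  have := sqr_ge0 (t a); have := sqr_ge0 (t b).
  by split; apply/eqP; rewrite -sqrf_eq0 eq_le sqr_ge0 andbT; lra.
by rewrite (tauE S a b) // ta tb.
Qed.

End VectorCharacter.
End SelfAdjointRing.

(** * The norm closure of a represented commutative algebra *)

Section NormClosure.
Context {R : realType} {A : comStarAlgType R} {H : hilbertType R}.
Variable pi : A -> H -> H.
Hypothesis pi_rep : representation pi.

Local Notation B := (norm_closure (range pi)).
Implicit Types (S T U V W : H -> H) (x y z : H) (a b : A) (e c q : R).

Lemma rep_BH a : BH (pi a). Proof. by case: pi_rep. Qed.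
Lemma rep_linear : linear pi. Proof. by case: pi_rep. Qed.
Lemma rep_mul a b : pi (amul a b) = pi a \o pi b. Proof. by case: pi_rep. Qed.
Lemma rep_adj a : is_adjoint (pi a) (pi (astar a)). Proof. by case: pi_rep. Qed.

Lemma range_BH : range pi `<=` BH.
Proof. by move=> _ [a _ <-]; exact: rep_BH. Qed.

Lemma closureP T : B T <-> BH T /\ forall e, 0 < e -> exists a, bnd (T - pi a) e.
Proof.
rewrite norm_closureP; last exact: range_BH.
split=> -[BT h]; split=> // e /h; first by move=> [_ [a _ <-] ?]; exists a.
by move=> [a Ta]; exists (pi a) => //; exists a.
Qed.

Lemma closure_BH : B `<=` BH. Proof. by move=> T []. Qed.

Lemma closure_linear T : B T -> linear T. Proof. by move=> /closure_BH/BH_linear. Qed.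

Lemma closure_rep a : B (pi a).
Proof.
apply/closureP; split=> [|e e0]; first exact: rep_BH.
by exists a => x; rewrite subrr /= rnorm0 mulr_ge0 ?rnorm_ge0 // ltW.
Qed.

Lemma closure_lim (u : nat -> H -> H) T : (forall n, B (u n)) -> BH T -> opcvg u T -> B T.
Proof.
move=> Bu BT uT; apply/closureP; split=> // e e0.
have e2 : 0 < e / 2 by rewrite divr_gt0.
have [N /(_ N (leqnn N)) uN] := uT _ e2.
have [_ /(_ _ e2)[a ua]] := (closureP (u N)).1 (Bu N).
by exists a; rewrite [e]splitr; apply: bnd_tri ua; exact: bndB.
Qed.

Lemma closure_lin (k : R[i]) S T : B S -> B T -> B (k *: S + T).
Proof.
move=> /closureP[BS hS] /closureP[BT hT]; apply/closureP; split.
  by apply: BH_D => //; exact: BH_Z.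
move=> e e0; pose c := rnorm (k : R[i]^o) + 1.
have c0 : 0 < c by rewrite ltr_wpDl // rnorm_ge0.
have [a Sa] := hS (e / 2 / c) ltac:(by rewrite !divr_gt0).
have [b Tb] := hT (e / 2) ltac:(by rewrite divr_gt0).
exists (k *: a + b); rewrite rep_linear opprD addrACA -scalerBr.
apply: (bndS _ (bndD (bndZ k Sa) Tb)); rewrite [leRHS]splitr lerD2r.
by rewrite mulrCA ler_piMr ?divr_ge0 ?ltW // ltr_pdivrMr // mul1r ltrDl.
Qed.

Lemma closure0 : B 0.
Proof.
have -> : 0 = pi 0; last exact: closure_rep.
by have := rep_linear (-1) 0 0; rewrite scaler0 addr0 scaleN1r addNr => ->.
Qed.

Lemma closureZ (k : R[i]) S : B S -> B (k *: S).
Proof. by move=> BS; rewrite -[_ *: _]addr0; apply: closure_lin => //; exact: closure0. Qed.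

Lemma closureD S T : B S -> B T -> B (S + T).
Proof. by move=> BS BT; rewrite -[S]scale1r; exact: closure_lin. Qed.

Lemma closureN S : B S -> B (- S).
Proof. by move=> BS; rewrite -scaleN1r; exact: closureZ. Qed.

Lemma closureB S T : B S -> B T -> B (S - T).
Proof. by move=> BS BT; apply/closureD/closureN. Qed.

Lemma closure_comp S T : B S -> B T -> B (S \o T).
Proof.
move=> /[dup] BS0 /closureP[BS hS] /[dup] BT0 /closureP[BT hT].
apply/closureP; split; first exact: BH_comp.
have [c c0 bS] := BH_bnd BS; have [d d0 bT] := BH_bnd BT.
move=> e e0; pose c' := c + 1; pose d' := d + 1.
have c'0 : 0 < c' by rewrite ltr_wpDl.
have d'0 : 0 < d' by rewrite ltr_wpDl.
pose r := Num.min 1 (e / 2 / d').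
have r0 : 0 < r by rewrite lt_min ltr01 !divr_gt0.
have [a Sa] := hS r r0.
have [b Tb] := hT (e / 2 / c') ltac:(by rewrite !divr_gt0).
exists (amul a b); rewrite rep_mul.
have bc : bnd (pi a) c'.
  have := bndD (bndB Sa) bS; rewrite subrK; apply: bndS.
  by rewrite addrC lerD2l ge_min lexx.
have -> : (S \o T) - (pi a \o pi b) = ((S - pi a) \o T) + (pi a \o (T - pi b)).
  apply/funext => x; rewrite !fctE /= (linB _ _ (BH_linear (rep_BH a))).
  by rewrite subrKA.
have h1 := bnd_comp (ltW r0) Sa bT; have h2 := bnd_comp (ltW c'0) bc Tb.
apply: (bndS _ (bndD h1 h2)); rewrite [leRHS]splitr; apply: lerD.
  apply: (@le_trans _ _ (e / 2 / d' * d)).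
    by apply: ler_wpM2r => //; rewrite /r ge_min lexx orbT.
  by rewrite mulrAC ler_pdivrMr // ler_wpM2l ?lerDl // divr_ge0 // ltW.
by rewrite mulrC divfK // gt_eqF.
Qed.

Lemma op_eq S T : (forall e, 0 < e -> bnd (S - T) e) -> S = T.
Proof.
move=> h; apply/funext => x; apply: rnorm_dist_eps => e e0.
have r1 : 0 < rnorm x + 1 by rewrite ltr_wpDl // rnorm_ge0.
apply: le_trans (h _ (divr_gt0 e0 r1) x) _.
by rewrite mulrAC ler_pdivrMr // ler_pM2l // lerDl.
Qed.

Lemma commute_limit S T : BH T ->
  (forall e, 0 < e -> exists U, [/\ BH U, bnd (S - U) e & T \o U = U \o T]) ->
  T \o S = S \o T.
Proof.
move=> BT h; have [c c0 bT] := BH_bnd BT; apply: op_eq => e e0.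
have c1 : 0 < 2 * (c + 1) by rewrite mulr_gt0 // ltr_wpDl.
have [U [BU SU TU]] := h _ (divr_gt0 e0 c1).
have -> : (T \o S) - (S \o T) = (T \o (S - U)) - ((S - U) \o T).
  apply/funext => x; rewrite !fctE /= (linB _ _ (BH_linear BT)).
  by rewrite -[T (U x)]/((T \o U) x) TU /=; vector_ring.
have e' : 0 <= e / (2 * (c + 1)) by rewrite ltW // divr_gt0.
have h1 := bnd_comp c0 bT SU; have h2 := bndN (bnd_comp e' SU bT).
apply: (bndS _ (bndD h1 h2)).
rewrite (mulrC c) -mulrDr -mulrA ler_piMr ?(ltW e0) // mulrC ler_pdivrMr // mul1r.
by lra.
Qed.

Lemma rep_comm a b : pi a \o pi b = pi b \o pi a.
Proof. by rewrite -!rep_mul amulC. Qed.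

Lemma closure_commute T S : BH T -> (forall a, T \o pi a = pi a \o T) -> B S ->
  T \o S = S \o T.
Proof.
move=> BT h /closureP[BS hS]; apply: commute_limit => // e /hS[a Sa].
by exists (pi a); split => //; exact: rep_BH.
Qed.

Lemma closure_comm S T : B S -> B T -> S \o T = T \o S.
Proof.
move=> BS BT; apply: closure_commute => //; first exact: closure_BH.
move=> a; apply/esym; apply: closure_commute => //; first exact: rep_BH.
by move=> b; exact: rep_comm.
Qed.

Lemma closureC S T x : B S -> B T -> S (T x) = T (S x).
Proof. by move=> BS BT; rewrite -[LHS]/((S \o T) x) (closure_comm BS BT). Qed.

(** Taking adjoints is isometric, hence carries Cauchy sequences to Cauchy
    sequences. *)
Lemma closure_adj S : B S -> exists2 S', B S' & is_adjoint S' S.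
Proof.
move=> /[dup] BS0 /closureP[BS hS].
have /choice[a aP] n : exists a, bnd (S - pi a) n.+1%:R^-1.
  by apply: hS; rewrite invr_gt0.
have aS : opcvg (fun n => pi (a n)) S.
  by move=> e /inv_small[N h]; exists N => n /h; move: (bndB (aP n)) => + b; exact: bndS.
have adjs n : is_adjoint (pi (astar (a n))) (pi (a n)).
  exact/is_adjointC/rep_adj.
have [||T BT aT] := @BH_complete _ _ (fun n => pi (astar (a n))).
- by move=> n; exact: rep_BH.
- move=> e e0; have [N h] := aS (e / 2) ltac:(by rewrite divr_gt0).
  exists N => m n Nm Nn; have hm := h m Nm; have hn := bndB (h n Nn).
  apply: (@bnd_adjoint _ _ _ (pi (a m) - pi (a n))) => //; last 2 first.
  + exact: ltW.
  + by rewrite [e]splitr; exact: bnd_tri hm hn.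
  by apply: adjD => //; exact: adjN.
exists T; first by apply: (closure_lim _ BT aT) => n; exact: closure_rep.
apply: (is_adjoint_lim _ _ aT aS) => //; exact: BH_linear.
Qed.

(** The closure itself need not contain the identity. *)
Definition unitization : set (H -> H) :=
  [set T | exists S (c : R[i]), B S /\ T = S + c *: idfun].

Lemma unitization_closure S : B S -> unitization S.
Proof. by move=> BS; exists S, 0; rewrite scale0r addr0. Qed.

Lemma unitization_opalg : opalg unitization.
Proof.
split.
- move=> _ [S [c [BS ->]]]; apply: BH_D; first exact: closure_BH.
  by apply: BH_Z; exact: BH_id.
- by exists 0, 1; rewrite scale1r add0r; split => //; exact: closure0.
- move=> k _ _ [S [c [BS ->]]] [T [d [BT ->]]].
  exists (k *: S + T), (k * c + d); split; first exact: closure_lin.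
  by apply/funext => x; rewrite !fctE /=; vector_ring.
- move=> _ _ [S [c [BS ->]]] [T [d [BT ->]]].
  exists ((S \o T) + (d *: S + c *: T)), (c * d); split.
    apply: closureD; first exact: closure_comp.
    by apply: closure_lin => //; exact: closureZ.
  apply/funext => x; rewrite !fctE /= (linD _ _ (closure_linear BS)) (linZ _ _ (closure_linear BS)).
  by vector_ring.
- move=> _ _ [S [c [BS ->]]] [T [d [BT ->]]].
  have [lS lT] := (closure_linear BS, closure_linear BT).
  apply/funext => x; rewrite !fctE /= (linD _ _ lS) (linZ _ _ lS) (linD _ _ lT) (linZ _ _ lT).
  by rewrite (closureC _ BS BT); vector_ring.
- move=> _ [S [c [BS ->]]]; have [S' BS' aS] := closure_adj BS.
  exists (S' + c^* *: idfun); first by exists S', (c^*).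
  apply: adjD => // x y; rewrite !fctE /= innerZl innerZr //.
Qed.

Lemma expr_small q : 0 <= q -> q < 1 -> forall e, 0 < e ->
  exists N, forall n, (N <= n)%N -> q ^+ n <= e.
Proof.
move=> q0 q1 e e0; have : q ^+ n @[n --> \oo] --> (0 : R).
  by apply: cvg_expr; rewrite ger0_norm.
move/cvgrPdist_le => /(_ e e0)[N _ h]; exists N => n /h /=.
by rewrite sub0r normrN ger0_norm // exprn_ge0.
Qed.

(** Contractions have fixed points, and the iteration stays in the closed
    algebra. *)
Lemma affine_fixpoint V W q : BH V -> 0 <= q -> q < 1 -> bnd V q ->
  (forall S, B S -> B (V \o S)) -> B W -> exists2 U, B U & U = (V \o U) + W.
Proof.
move=> BV q0 q1 bV VB BW; have [c c0 bW] := BH_bnd (closure_BH BW).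
have lV := BH_linear BV.
pose u := fix u n := if n is n'.+1 then (V \o u n') + W else (0 : H -> H).
have Bu n : B (u n).
  by elim: n => [|n IHn] /=; [exact: closure0|apply: closureD => //; exact: VB].
pose C := c / (1 - q); have q1' : 0 < 1 - q by lra.
have C0 : 0 <= C by rewrite divr_ge0 // ltW.
have CE : q * C + c = C by rewrite /C; field; rewrite gt_eqF.
have bu n k : bnd (u (n + k)%N - u n) (q ^+ n * C).
  elim: n => [|n IHn].
    rewrite add0n expr0 mul1r /= subr0; elim: k => [|k IHk].
      by move=> x; rewrite /= rnorm0 mulr_ge0 // rnorm_ge0.
    by rewrite -CE; apply: bndD => //; exact: bnd_comp.
  rewrite addSn /= (_ : _ - _ = V \o (u (n + k)%N - u n)).
    by rewrite exprS -mulrA; exact: bnd_comp.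
  apply/funext => x; rewrite !fctE /= (linB _ _ lV) opprD addrACA subrr addr0 //.
have [|U BU uU] := @BH_complete _ _ u (fun n => closure_BH (Bu n)).
  move=> e e0; have e2 : 0 < e / 2 / (C + 1) by rewrite !divr_gt0 // ltr_wpDl.
  have [N h] := expr_small q0 q1 e2; exists N.
  have hN n : (N <= n)%N -> bnd (u n - u N) (e / 2).
    move=> Nn; have := bu N (n - N)%N; rewrite subnKC //; apply: bndS.
    apply: le_trans (ler_wpM2r C0 (h N (leqnn N))) _.
    rewrite mulrAC ler_pdivrMr ?ltr_wpDl // ler_wpM2l ?lerDl //.
    by rewrite ltW // divr_gt0.
  move=> m n /hN um /hN/bndB un; rewrite [e]splitr; exact: bnd_tri um un.
have BBU : B U by exact: closure_lim uU.
exists U => //; apply: op_eq => e e0.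
have [N h] := uU (e / 2) ltac:(by rewrite divr_gt0).
have h1 := bndB (h N.+1 (leqnSn N)); have h2 := bnd_comp q0 bV (h N (leqnn N)).
rewrite (_ : U - _ = (U - u N.+1) + (V \o (u N - U))).
  apply: (bndS _ (bndD h1 h2)); rewrite [leRHS]splitr lerD2l.
  by rewrite ler_piMl // ltW // divr_gt0.
apply/funext => x; rewrite !fctE /= (linB _ _ lV).
by vector_ring.
Qed.

Section Character.
Variable tau : (H -> H) -> R[i].
Hypothesis chi : character B tau.

Lemma charD S T : B S -> B T -> tau (S + T) = tau S + tau T.
Proof. by case: chi => h _ _ _; exact: h. Qed.
Lemma charZ k S : B S -> tau (k *: S) = k * tau S.
Proof. by case: chi => _ h _ _; exact: h. Qed.
Lemma charM S T : B S -> B T -> tau (S \o T) = tau S * tau T.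
Proof. by case: chi => _ _ h _; exact: h. Qed.
Lemma char_neq0 : exists2 S, B S & tau S != 0.
Proof. by case: chi. Qed.

Lemma charN S : B S -> tau (- S) = - tau S.
Proof. by move=> BS; rewrite -scaleN1r charZ // mulN1r. Qed.
Lemma charB S T : B S -> B T -> tau (S - T) = tau S - tau T.
Proof. by move=> BS BT; rewrite charD ?charN //; exact: closureN. Qed.
Lemma char0 : tau 0 = 0.
Proof. by rewrite -(scale0r 0) charZ ?mul0r //; exact: closure0. Qed.

(** Otherwise some [S] in the open unit ball satisfies [tau S = 1], and
    [U = S U + S] is absurd. *)
Lemma char_norm T c : 0 <= c -> B T -> bnd T c -> rnorm (tau T : R[i]^o) <= c.
Proof.
move=> c0 BT bT; rewrite leNgt; apply/negP => ct.
set t := rnorm (tau T : R[i]^o) in ct; have t0 : 0 < t by exact: le_lt_trans ct.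
have tT : tau T != 0.
  by apply: contraTneq t0 => tT; rewrite /t tT rnorm0 ltxx.
pose S := (tau T)^-1 *: T; have BS : B S by exact: closureZ.
have tS : tau S = 1 by rewrite charZ // mulVf.
have bS : bnd S (c / t).
  have := bndZ (tau T)^-1 bT; rewrite -/S mulrC (_ : rnorm _ = t^-1) //.
  apply: (mulfI (lt0r_neq0 t0)); rewrite -rnormM mulfV // mulfV ?rnorm1 //.
  exact: lt0r_neq0.
have [||U BU E] := affine_fixpoint (closure_BH BS) _ _ bS (fun T => closure_comp BS) BS.
- by rewrite divr_ge0 // ltW.
- by rewrite ltr_pdivrMr // mul1r.
have := congr1 tau E; rewrite (charD (closure_comp BS BU) BS) (charM BS BU) tS.
by rewrite mul1r -[LHS]addr0 => /addrI /esym/eqP; rewrite oner_eq0.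
Qed.

(** For [S] self-adjoint [1 + S^2] is invertible, so that [tau S] is not [i];
    a non-real value of [tau T] could be moved to [i] by a real quadratic
    polynomial without constant term. *)
Lemma char_real T : B T -> is_adjoint T T -> complex.Im (tau T) = 0.
Proof.
move=> BT aT; case E : (tau T) => [a b] /=; apply/eqP/negP => /negP b0.
pose n := a ^+ 2 + b ^+ 2.
have n0 : n != 0 by rewrite gt_eqF // ltr_wpDl ?sqr_ge0 // exprn_even_gt0.
pose al := a / (b * n); pose be := (b ^+ 2 - a ^+ 2) / (b * n).
pose S := al%:C *: (T \o T) + be%:C *: T.
have BTT : B (T \o T) by exact: closure_comp.
have BS : B S by apply: closureD; exact: closureZ.
have aS : is_adjoint S S.
  by apply: adjD; apply: adj_real => //; exact: adj_comp.
have tS : tau S = 'i.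
  rewrite (charD (closureZ _ BTT) (closureZ _ BT)) !charZ // (charM BT BT).
  rewrite E; apply/eqP; rewrite eq_complex /= /al /be; apply/andP; split; apply/eqP.
    by field; rewrite n0 b0.
  by rewrite /n; field; rewrite -/n n0 b0.
clearbody S; have BSS : B (S \o S) by exact: closure_comp.
have [d d0 bS] := BH_bnd (closure_BH BS); pose c := d ^+ 2.
have c0 : 0 <= c by exact: sqr_ge0.
have c1 : 0 < 1 + c by rewrite ltr_pwDl.
pose V := ((1 + c)^-1)%:C *: (c%:C *: idfun - (S \o S)).
have BV : BH V.
  apply: BH_Z; apply: BH_B; first by apply: BH_Z; exact: BH_id.
  exact: closure_BH.
have bV : bnd V (c / (1 + c)).
  move=> x; rewrite /V !fctE /= rnormZ rnorm_real ger0_norm ?invr_ge0 ?(ltW c1) //.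
  rewrite (mulrC c) -[leRHS]mulrA; apply: ler_wpM2l; first by rewrite invr_ge0 ltW.
  apply: rnorm_sqr_le; first by rewrite mulr_ge0 // rnorm_ge0.
  rewrite rnormB_sqr ipZl rnormZ rnorm_real ger0_norm //.
  have -> : ip x (S (S x)) = rnorm (S x) ^+ 2 by rewrite rnorm_sqr /ip aS.
  have h1 : rnorm (S (S x)) ^+ 2 <= c * rnorm (S x) ^+ 2.
    by rewrite -exprMn ler_pXn2r ?nnegrE ?rnorm_ge0 ?mulr_ge0 ?rnorm_ge0 //; exact: bS.
  have h2 : 0 <= c * rnorm (S x) ^+ 2 by rewrite mulr_ge0 // sqr_ge0.
  by lra.
have VB U : B U -> B (V \o U).
  move=> BU; have -> : V \o U = ((1 + c)^-1)%:C *: (c%:C *: U - ((S \o S) \o U)) by [].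
  apply: closureZ; apply: closureB; first exact: closureZ.
  exact: closure_comp.
have [||U BU EU] := affine_fixpoint BV _ _ bV VB (closureZ (- ((1 + c)^-1)%:C) BSS).
- by rewrite divr_ge0 // ltW.
- by rewrite ltr_pdivrMr // mul1r ltrDr.
have : (1 + c)%:C *: U = c%:C *: U - ((S \o S) \o U) - (S \o S).
  rewrite {1}EU /V; apply/funext => x; rewrite !fctE /=.
  have cc : (1 + c)%:C * ((1 + c)^-1)%:C = 1 :> R[i].
    by rewrite -rmorphM mulfV ?rmorph1 // gt_eqF.
  move: cc; set p := (1 + c)%:C; set q := ((1 + c)^-1)%:C.
  clearbody p q => cc; apply: inner_inj => z.
  by rewrite !(innerDl, innerNl, innerZl); ring: cc.
have BSU : B ((S \o S) \o U) by exact: closure_comp.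
move=> /(congr1 tau).
rewrite (charB (closureB (closureZ _ BU) BSU) BSS) (charB (closureZ _ BU) BSU).
rewrite !charZ // (charM BSS BU) !(charM BS BS) !tS -expr2 sqrCi rmorphD rmorph1.
move=> /eqP; rewrite -subr_eq0 => /eqP h.
have /eqP : (1 : R[i]) = 0.
  by rewrite -[RHS]oppr0 -h; ring.
by rewrite oner_eq0.
Qed.

Lemma char_adj S S' : B S -> B S' -> is_adjoint S' S -> tau S' = (tau S)^*.
Proof.
move=> BS BS' aS; have aS' := is_adjointC aS.
have h1 : complex.Im (tau (S + S')) = 0.
  apply: char_real; first exact: closureD.
  by rewrite {2}[S + S']addrC; exact: adjD.
have h2 : complex.Im (tau ('i *: (S - S'))) = 0.
  apply: char_real; first by apply: closureZ; exact: closureB.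
  move=> x y; rewrite !fctE innerZl innerZr innerDl innerNl aS aS' innerDr.
  by rewrite -[- S' y]scaleN1r innerZr rmorphN rmorph1 conjCi; ring.
move: h1 h2; rewrite charD // charZ ?charB //; last exact: closureB.
case: (tau S) => a b; case: (tau S') => c d /= h1 h2.
apply/eqP; rewrite eq_complex /=; apply/andP; split; apply/eqP; lra.
Qed.

Lemma char_adjM S S' : B S -> B S' -> is_adjoint S' S ->
  tau (S' \o S) = ((rnorm (tau S : R[i]^o)) ^+ 2)%:C.
Proof. by move=> BS BS' aS; rewrite charM // (char_adj BS BS' aS) rnormCK. Qed.

End Character.

(** The characters of the unitization restrict to the closure. *)
Lemma unitization_character tau f :
  (forall (k : R[i]) S T, unitization S -> unitization T ->
     tau (k *: S + T) = k * tau S + tau T) ->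
  (forall S T, unitization S -> unitization T -> tau (S \o T) = tau S * tau T) ->
  B f -> tau f != 0 -> character B tau.
Proof.
move=> tl tM Bf f0; have UB := unitization_closure.
have tD S T : B S -> B T -> tau (S + T) = tau S + tau T.
  by move=> /UB US /UB UT; rewrite -[S]scale1r tl // mul1r scale1r.
have tz : tau 0 = 0.
  by have := tD _ _ closure0 closure0; rewrite addr0 -[LHS]addr0 => /addrI.
split => //; last by exists f.
- move=> k S BS; rewrite -[k *: S]addr0 tl ?tz ?addr0 //; apply: UB => //; exact: closure0.
- by move=> S T /UB US /UB UT; exact: tM.
Qed.

Lemma closure_vector_character f x : B f -> is_adjoint f f -> ip (f x) x < 0 ->
  exists tau, [/\ character B tau, exists2 r, r < 0 & tau f = r%:C &
    forall g, B g -> g x = 0 -> tau g = 0].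
Proof.
move=> Bf af fx; have UB := unitization_closure.
have [tau [tl tM t1 [r r0 tr] t0]] := vector_character unitization_opalg (UB f Bf) af fx.
exists tau; split; [|by exists r|by move=> g /UB; exact: t0].
apply: (unitization_character tl tM Bf); rewrite tr; apply/eqP => -[r00].
by rewrite r00 ltxx in r0.
Qed.

(** At a vector [x] where the bound fails, [c^2 - T^2] has a negative matrix
    element, so that it is negative at some character, where [|tau T| > c]. *)
Lemma gelfand_norm T c : 0 <= c -> B T -> is_adjoint T T ->
  (forall tau, character B tau -> rnorm (tau T : R[i]^o) <= c) -> bnd T c.
Proof.
move=> c0 BT aT Tc x; rewrite leNgt; apply/negP => xc.
have UB := unitization_closure; have hX := unitization_opalg.
have BTT : B (T \o T) by exact: closure_comp.
pose h := (c ^+ 2)%:C *: idfun - (T \o T).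
have Xh : unitization h.
  apply: (opalgB hX); first by apply: (opalgZ hX); exact: opalg_id.
  exact: UB.
have ah : is_adjoint h h.
  by apply: adjD; [exact: adj_real|apply: adjN; exact: adj_comp].
have hx : ip (h x) x < 0.
  rewrite /h !fctE ipDl ipNl ipZl -rnorm_sqr /=.
  have -> : ip (T (T x)) x = rnorm (T x) ^+ 2 by rewrite rnorm_sqr /ip aT.
  rewrite subr_lt0 -exprMn ltr_pXn2r // nnegrE ?mulr_ge0 ?rnorm_ge0 //.
have [tau [tl tM t1 [r r0 tr] _]] := vector_character hX Xh ah hx.
have tT : tau T * tau T = (c ^+ 2 - r)%:C.
  have := tl (- 1) (T \o T) ((c ^+ 2)%:C *: idfun) (UB _ BTT) (opalgZ hX _ (opalg_id hX)).
  rewrite scaleN1r addrC -/h tr tM; [|exact: UB|exact: UB].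
  have -> : tau ((c ^+ 2)%:C *: idfun) = (c ^+ 2)%:C.
    have tz : tau 0 = 0.
      have := tl 1 0 0 (opalg0 hX) (opalg0 hX).
      by rewrite scale1r addr0 mul1r -[LHS]addr0 => /addrI.
    rewrite -[_ *: _]addr0 (tl _ _ _ (opalg_id hX) (opalg0 hX)) t1 tz.
    by rewrite mulr1 addr0.
  by move=> E; rewrite rmorphB /= E; ring.
have tT0 : tau T != 0.
  apply: contraTneq r0 => T0; move: tT; rewrite T0 mul0r => /esym[/eqP].
  by rewrite subr_eq0 => /eqP <-; rewrite -leNgt sqr_ge0.
have chi := unitization_character tl tM BT tT0.
have := Tc tau chi; rewrite -(@ler_pXn2r _ 2) ?nnegrE ?rnorm_ge0 //.
rewrite leNgt => /negP; apply; rewrite -rnormX [tau T ^+ 2]expr2 tT rnorm_real.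
rewrite ger0_norm; first by rewrite ltrBrDl gtrDr.
by rewrite subr_ge0 (le_trans (ltW r0)) // sqr_ge0.
Qed.

Lemma gelfand_inj T : B T -> (forall tau, character B tau -> tau T = 0) -> T = 0.
Proof.
move=> BT T0; have [T' BT' aT] := closure_adj BT.
have : bnd (T' \o T) 0.
  apply: gelfand_norm => //; first exact: closure_comp.
    by apply: adj_comp => //; exact: is_adjointC.
  by move=> tau chi; rewrite (charM chi) // T0 // mulr0 rnorm0.
move=> b0; apply/funext => x; apply: ip_eq0.
rewrite /ip -aT -[T' (T x)]/((T' \o T) x).
by have := b0 x; rewrite mul0r => /rnorm_le0 ->; rewrite inner0l.
Qed.

End NormClosure.

(** * Absolute values and positive parts *)

Section AbsoluteValue.
Context {R : realType} {A : comStarAlgType R} {H : hilbertType R}.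
Variable pi : A -> H -> H.
Hypothesis pi_rep : representation pi.

Local Notation B := (norm_closure (range pi)).

(** The iteration [p + (t^2 - p^2) / 2] for the square root of [t^2]: polynomials
    without constant term, so that they can be evaluated in an algebra without
    unit. *)
Fixpoint abs_poly (n : nat) (t : R) : R :=
  if n is m.+1 then abs_poly m t + (t ^+ 2 - abs_poly m t ^+ 2) / 2 else 0.

(** The error [e_n = |t| - abs_poly n t] satisfies
    [e_(n+1) = e_n (1 - (|t| + abs_poly n t) / 2)], whence the bound by
    induction. *)
Lemma abs_polyP n (t : R) : `|t| <= 1 ->
  0 <= `|t| - abs_poly n t <= 2 / n.+1%:R.
Proof.
move=> t1; pose e k : R := `|t| - abs_poly k t.
set s : R := `|t| in t1 e *.
have s0 : 0 <= s by exact: normr_ge0.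
have eS k : e k.+1 = e k * (1 - (s + abs_poly k t) / 2).
  by rewrite /e /= -(real_normK (num_real t)) -/s; field.
have bound m : [/\ 0 <= e m, e m <= s & e m * (1 + m%:R * s / 2) <= s].
  elim: m => [|m [IH0 IHs IH]]; first by rewrite /e /= subr0 mul0r; split => //; lra.
  have pm : 0 <= abs_poly m t by move: IHs; rewrite /e; lra.
  have pms : abs_poly m t <= s by move: IH0; rewrite /e; lra.
  have f0 : 0 <= 1 - (s + abs_poly m t) / 2 by lra.
  have f1 : 1 - (s + abs_poly m t) / 2 <= 1 - s / 2 by lra.
  have m0 : 0 <= m%:R :> R by exact: ler0n.
  have eS_le : e m.+1 <= e m * (1 - s / 2) by rewrite eS; exact: ler_wpM2l.
  split; first by rewrite eS mulr_ge0.
    apply: le_trans eS_le _; apply: le_trans IHs; rewrite ler_piMr //; lra.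
  apply: le_trans IH.
  have k0 : 0 <= 1 + m.+1%:R * s / 2.
    by rewrite addr_ge0 // mulr_ge0 // mulr_ge0.
  apply: le_trans (ler_wpM2r k0 eS_le) _; rewrite -(mulrA (e m)); apply: ler_wpM2l => //.
  have h : 0 <= m%:R * s ^+ 2 by rewrite mulr_ge0 // sqr_ge0.
  have h2 : 0 <= s ^+ 2 by exact: sqr_ge0.
  by rewrite -[m.+1%:R]natr1; lra.
have [e0 es en] := bound n; apply/andP; split => //.
rewrite ler_pdivlMr //.
have n0 : 0 <= n%:R :> R by exact: ler0n.
(* [s <= 1] trades the weight [1 + n s / 2] for [s (n + 1) / 2] *)
have [s00|sn0] := eqVneq s 0.
  by rewrite (_ : s - abs_poly n t = 0) ?mul0r //; move: es e0; rewrite /e; lra.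
have sp : 0 < s by rewrite lt_def sn0.
rewrite -(ler_pM2r sp) -[n.+1%:R]natr1.
apply: (@le_trans _ _ (2 * (e n * (1 + n%:R * s / 2)))); last by lra.
rewrite mulrCA -/(e n) -[e n * _ * s]mulrA; apply: ler_wpM2l => //; lra.
Qed.

Fixpoint abs_op (f : H -> H) (n : nat) : H -> H :=
  if n is m.+1
  then abs_op f m + (2^-1)%:C *: ((f \o f) - (abs_op f m \o abs_op f m)) else 0.

Lemma abs_opP f n : B f -> is_adjoint f f ->
  [/\ B (abs_op f n), is_adjoint (abs_op f n) (abs_op f n) &
    forall tau, character B tau -> tau (abs_op f n) = (abs_poly n (complex.Re (tau f)))%:C].
Proof.
move=> Bf af; elim: n => [|n [Bn an tn]] /=.
  split; [exact: closure0|exact: adj0|by move=> tau chi; rewrite (char0 pi_rep chi)].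
have Bff : B (f \o f) by exact: closure_comp.
have Bpp : B (abs_op f n \o abs_op f n) by exact: closure_comp.
have BD := closureB pi_rep Bff Bpp.
split.
- by apply: (closureD pi_rep) => //; exact: closureZ.
- by apply: adjD => //; apply: adj_real; apply: adjD; [|apply: adjN]; exact: adj_comp.
move=> tau chi; have tf : tau f = (complex.Re (tau f))%:C.
  by have := char_real pi_rep chi Bf af; case: (tau f) => a b /= ->.
rewrite (charD chi Bn (closureZ pi_rep _ BD)) (charZ chi _ BD).
rewrite (charB pi_rep chi Bff Bpp) (charM chi Bf Bf) (charM chi Bn Bn).
rewrite (tn tau chi) tf -!expr2 -!rmorphXn -rmorphB -rmorphM -rmorphD /=.
by congr (_%:C); rewrite [in RHS]mulrC.
Qed.

(** The [abs_op f n] converge in norm, as the Gelfand transform carries them to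
    the uniformly convergent [abs_poly n]. *)
Lemma closure_abs1 f : B f -> is_adjoint f f -> bnd f 1 ->
  exists2 g, B g & forall tau, character B tau -> tau g = `|complex.Re (tau f)|%:C.
Proof.
move=> Bf af f1; pose p := abs_op f.
have pP n := abs_opP n Bf af.
have small (e : R) : 0 < e -> exists N, forall n, (N <= n)%N -> 2 / n.+1%:R <= e.
  move=> e0; have [|N h] := @inv_small _ (e / 2); first by rewrite divr_gt0.
  by exists N => n /h; rewrite ler_pdivlMr // mulrC.
have t1 tau : character B tau -> `|complex.Re (tau f)| <= 1.
  move=> chi; apply: le_trans (Re_le_rnorm _) _.
  exact: (char_norm pi_rep chi).
have [||g Bg pg] := @BH_complete _ _ p.
- by move=> n; have [/closure_BH] := pP n.
- move=> e e0; have [N h] := small (e / 2) ltac:(by rewrite divr_gt0).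
  exists N => m n Nm Nn; have [Bm am tm] := pP m; have [Bn an tn] := pP n.
  apply: (gelfand_norm pi_rep (ltW e0)); first exact: (closureB pi_rep).
    by apply: adjD => //; exact: adjN.
  move=> tau chi; rewrite (charB pi_rep chi) // tm // tn // -rmorphB rnorm_real.
  have /andP[m0 mN] := abs_polyP m (t1 tau chi).
  have /andP[n0 nN] := abs_polyP n (t1 tau chi).
  have hm := le_trans mN (h m Nm); have hn := le_trans nN (h n Nn).
  clear mN nN; move: m0 n0 hm hn.
  set u := `| _ |; set v := abs_poly m _; set w := abs_poly n _ => *.
  by rewrite ler_norml; apply/andP; split; lra.
have BBg : B g by apply: (closure_lim pi_rep _ Bg pg) => n; have [] := pP n.
exists g => // tau chi; apply: (@rnorm_dist_eps _ R[i]^o) => e e0.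
have e2 : 0 < e / 2 by rewrite divr_gt0.
have [N1 h1] := small _ e2; have [N2 h2] := pg _ e2.
set n := maxn N1 N2; have {h1}h1 := h1 n (leq_maxl _ _).
have {h2}h2 := bndB (h2 n (leq_maxr _ _)); have [Bn an tn] := pP n.
have := @rnormB_tri _ R[i]^o (tau g) (tau (p n)) `|complex.Re (tau f)|%:C.
move=> /le_trans; apply; rewrite [e]splitr; apply: lerD.
  have -> : tau g - tau (p n) = tau (g - p n) by rewrite (charB pi_rep chi).
  by apply: (char_norm pi_rep chi (ltW e2) _ h2); exact: (closureB pi_rep).
rewrite tn // -rmorphB rnorm_real distrC.
have /andP[m0 mN] := abs_polyP n (t1 tau chi).
by rewrite ger0_norm //; exact: le_trans mN h1.
Qed.

(** [max 0 t = (|t| + t) / 2], once [f] is rescaled into the unit ball. *)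
Lemma closure_pos f : B f -> is_adjoint f f ->
  exists2 g, B g & forall tau, character B tau ->
    tau g = (Num.max 0 (complex.Re (tau f)))%:C.
Proof.
move=> Bf af; have [c c0 bf] := BH_bnd (closure_BH Bf).
pose d := c + 1; have d0 : 0 < d by rewrite ltr_wpDl.
have d1 : d != 0 by rewrite gt_eqF.
have Bf1 : B ((d^-1)%:C *: f) by exact: closureZ.
have [|g Bg tg] := closure_abs1 Bf1 (adj_real _ af).
  move=> x; apply: le_trans (bndZ _ bf x) _; apply: ler_wpM2r; first exact: rnorm_ge0.
  by rewrite rnorm_real ger0_norm ?invr_ge0 ?(ltW d0) // mulrC ler_pdivrMr // mul1r lerDl.
exists ((2^-1)%:C *: (d%:C *: g + f)); first by do ?[apply: closureZ|apply: closureD].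
move=> tau chi; have tf : tau f = (complex.Re (tau f))%:C.
  by have := char_real pi_rep chi Bf af; case: (tau f) => a b /= ->.
rewrite (charZ chi) ?(charD chi) ?(charZ chi) ?tg //; last 2 first.
- exact: closureZ.
- by apply: closureD => //; exact: closureZ.
rewrite (charZ chi) // {2}tf -!rmorphM -rmorphD -rmorphM /=; congr (_%:C).
rewrite tf -rmorphM /=; set t := complex.Re (tau f).
rewrite normrM gtr0_norm ?invr_gt0 // mulrA mulfV // mul1r.
case: (lerP 0 t) => t0; [rewrite ger0_norm //|rewrite ltr0_norm //]; lra.
Qed.

End AbsoluteValue.

(** * The spectrum *)

Section Spectrum.
Context {R : realType} {A : comStarAlgType R} {H : hilbertType R}.
Variable pi : A -> H -> H.
Hypothesis pi_rep : representation pi.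

Local Notation B := (norm_closure (range pi)).
Implicit Types (s t : sp pi) (S T f g : H -> H) (a b : A) (e d : R).

Lemma sp_character s : exists2 tau, character B tau &
  forall a, tau (pi a) = hat pi a s.
Proof.
have [tau chi E] := set_valP s; exists tau => // a.
by rewrite /hat; move: (congr1 (fun f : A -> R[i] => f a) E).
Qed.

(** A point of the spectrum is a function on [A]; this is its extension to the
    norm closure of [range pi]. *)
Definition ev s : (H -> H) -> R[i] := s2val (cid2 (sp_character s)).

Lemma evP s : character B (ev s).
Proof. by rewrite /ev; case: cid2. Qed.

Lemma ev_rep s a : ev s (pi a) = hat pi a s.
Proof. by rewrite /ev; case: cid2. Qed.

Lemma ev_norm s T c : 0 <= c -> B T -> bnd T c -> rnorm (ev s T : R[i]^o) <= c.
Proof. exact: (char_norm pi_rep (evP s)). Qed.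

Lemma character_dist tau T a e : character B tau -> 0 <= e -> B T -> bnd (T - pi a) e ->
  rnorm (tau T - tau (pi a) : R[i]^o) <= e.
Proof.
move=> chi e0 BT Ta; have Ba := closure_rep pi_rep a.
rewrite -(charB pi_rep chi) //; apply: (char_norm pi_rep chi) => //.
exact: (closureB pi_rep).
Qed.

(** A character is continuous for the norm, hence determined by its values on
    the [pi a]. *)
Lemma character_ev tau : character B tau -> exists s, forall T, B T -> ev s T = tau T.
Proof.
move=> chi; have spt : sp_set pi (fun a => tau (pi a)) by exists tau.
exists (SigSub (mem_set spt)) => T /[dup] BT /(closureP pi_rep)[_ hT].
set s := SigSub _; apply: (@rnorm_dist_eps _ R[i]^o) => e e0.
have e2 : 0 < e / 2 by rewrite divr_gt0.
have [a Ta] := hT _ e2.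
have h1 := character_dist (evP s) (ltW e2) BT Ta.
have h2 := character_dist chi (ltW e2) BT Ta.
have E : ev s (pi a) = tau (pi a) by rewrite ev_rep.
have := @rnormB_tri _ R[i]^o (ev s T) (tau (pi a)) (tau T).
move=> /le_trans; apply; rewrite [e]splitr; apply: lerD; first by rewrite -E.
by rewrite rnormB.
Qed.

Lemma gelfand_ev_inj T : B T -> (forall s, ev s T = 0) -> T = 0.
Proof.
move=> BT T0; apply: (gelfand_inj pi_rep) => // tau /character_ev[s E].
by rewrite -E.
Qed.

Lemma vector_ev f x : B f -> is_adjoint f f -> ip (f x) x < 0 ->
  exists s, (exists2 r : R, r < 0 & ev s f = r%:C) /\
    forall g, B g -> g x = 0 -> ev s g = 0.
Proof.
move=> Bf af /(closure_vector_character pi_rep Bf af)[tau [chi [r r0 fr] t0]].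
have [s E] := character_ev chi; exists s; split; first by exists r => //; rewrite E.
by move=> g Bg gx; rewrite E // t0.
Qed.

Lemma hat_continuous a : continuous (hat pi a : sp pi -> R[i]^o).
Proof.
move=> s; rewrite /hat.
apply: (@continuous_comp (sp pi) {ptws A -> R[i]^o} R[i]^o set_val (fun h => h a)).
  exact: initial_continuous.
exact: (@proj_continuous A (fun=> R[i]^o) a).
Qed.

Lemma ev_continuous T : B T -> continuous (fun s => ev s T : R[i]^o).
Proof.
move=> /[dup] BT /(closureP pi_rep)[_ hT] s.
apply: (continuous_rnormP (fun t => ev t T : R[i]^o) s).2 => e e0.
have e3 : 0 < e / 3 by rewrite divr_gt0.
have [a Ta] := hT _ e3.
have := (continuous_rnormP (hat pi a : sp pi -> R[i]^o) s).1 (@hat_continuous a s).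
move=> /(_ _ e3); apply: filterS => t /= h.
have h1 := character_dist (evP s) (ltW e3) BT Ta.
have h2 := character_dist (evP t) (ltW e3) BT Ta.
rewrite !ev_rep in h1 h2.
have t1 := @rnormB_tri _ R[i]^o (ev t T) (hat pi a t) (ev s T).
have t2 := @rnormB_tri _ R[i]^o (hat pi a t) (hat pi a s) (ev s T).
have h3 : rnorm (hat pi a s - ev s T : R[i]^o) <= e / 3.
  by rewrite (@rnormB _ R[i]^o).
exact: le_third t1 t2 h2 h h3.
Qed.

Lemma ev_dist_continuous T (c : R[i]) : B T ->
  continuous (fun s => rnorm (ev s T - c : R[i]^o)).
Proof.
move=> BT s; apply: (continuous_normP _ s).2 => e e0.
have := (continuous_rnormP (fun t => ev t T : R[i]^o) s).1 (@ev_continuous _ BT s).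
move=> /(_ _ e0); apply: filterS => t /=; apply: le_trans.
have t1 := @rnormB_tri _ R[i]^o (ev s T) (ev t T) c.
have t2 := @rnormB_tri _ R[i]^o (ev t T) (ev s T) c.
by rewrite (@rnormB _ R[i]^o (ev s T) (ev t T)) in t1; rewrite ler_norml lerNl opprB !lerBlDr t1 t2.
Qed.

Lemma open_ev_lt T (c : R[i]) e : B T -> open [set s | rnorm (ev s T - c : R[i]^o) < e].
Proof.
move=> BT; have := @open_comp (sp pi) R _ [set x | x < e] (in1W (@ev_dist_continuous T c BT)).
by apply; exact: open_lt.
Qed.

Lemma open_ev_gt T (c : R[i]) e : B T -> open [set s | e < rnorm (ev s T - c : R[i]^o)].
Proof.
move=> BT; have := @open_comp (sp pi) R _ [set x | e < x] (in1W (@ev_dist_continuous T c BT)).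
by apply; exact: open_gt.
Qed.

Lemma sp_ext s t : (forall a, hat pi a s = hat pi a t) -> s = t.
Proof. by move=> st; apply: val_inj; apply/funext => a; exact: st. Qed.

(** The topology of the spectrum is initial for the functions [hat pi a]. *)
Lemma sp_cvg (F : set_system (sp pi)) s : Filter F ->
  (forall a e, 0 < e -> F [set t | rnorm (hat pi a t - hat pi a s : R[i]^o) <= e]) ->
  F --> s.
Proof.
move=> FF h U; rewrite nbhsE => -[V [[W oW <-] Ws] VU].
have : set_val @ F --> (set_val s : {ptws A -> R[i]^o}).
  apply/cvg_sup => a V' /=.
  have /= -> := @nbhsE (initial_topology (fun f : A -> R[i]^o => f a)) (set_val s).
  move=> [N [[C oC <-] Cs] NV'].
  have : nbhs (hat pi a s : R[i]^o) C by rewrite nbhsE; exists C.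
  move=> /nbhs_ballP[e /= e0 eC].
  have eR : e = (complex.Re e)%:C by rewrite RRe_real // gtr0_real.
  have e0' : 0 < complex.Re e / 2 by rewrite divr_gt0 // -ltcR -eR.
  rewrite -[nbhs _ _]/(F (set_val @^-1` V')).
  apply: filterS (h a _ e0') => t /= ht; apply/NV'/eC.
  rewrite -ball_normE /ball_/= (rnormE (hat pi a s - hat pi a t : R[i]^o)) eR ltcR.
  rewrite (@rnormB _ R[i]^o); apply: le_lt_trans ht _.
  by rewrite ltr_pdivrMr // ltr_pMr ?ltr1n // -ltcR -eR.
move=> /(_ W) FW; apply: filterS VU _; apply: FW.
by rewrite nbhsE; exists W.
Qed.

(** The sets that contain the non-vanishing locus of some [g] with [g s <> 0]
    form a filter, and the positive parts of [e^2 |u|^2 - |u (a - s a)|^2] show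
    that it converges to [s]. *)
Lemma sp_urysohn s (U : set (sp pi)) : open U -> U s ->
  exists g, [/\ B g, ev s g != 0 & forall t, ~ U t -> ev t g = 0].
Proof.
move=> oU Us.
pose F : set_system (sp pi) := [set W | exists g, [/\ B g, ev s g != 0 &
   forall t, ~ W t -> ev t g = 0]].
have [u Bu su] := char_neq0 (evP s).
have FF : Filter F.
  split.
  - by exists u; split=> // t /(_ I).
  - move=> V W [g [Bg sg Vg]] [h [Bh sh Wh]]; exists (g \o h); split.
    + exact: closure_comp.
    + by rewrite (charM (evP s)) // mulf_neq0.
    move=> t /not_andP[/Vg|/Wh] E; rewrite (charM (evP t)) // E ?mul0r ?mulr0 //.
  - by move=> V W VW [g [Bg sg Vg]]; exists g; split=> // t nW; apply: Vg => /VW.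
suff /(_ U) : F --> s by apply; rewrite nbhsE; exists U.
apply: sp_cvg => a e e0; have Ba := closure_rep pi_rep a.
pose c := hat pi a s; pose v := (pi a \o u) - c *: u.
have Bau : B (pi a \o u) by exact: closure_comp.
have Bv : B v by apply: (closureB pi_rep) => //; exact: closureZ.
have [u' Bu' au] := closure_adj pi_rep Bu.
have [v' Bv' av] := closure_adj pi_rep Bv.
have Buu : B (u' \o u) by exact: closure_comp.
have Bvv : B (v' \o v) by exact: closure_comp.
pose f := (e ^+ 2)%:C *: (u' \o u) - (v' \o v).
have Bf : B f by apply: (closureB pi_rep) => //; exact: closureZ.
have af : is_adjoint f f.
  apply: adjD; first by apply: adj_real; apply: adj_comp => //; exact: is_adjointC.
  by apply: adjN; apply: adj_comp => //; exact: is_adjointC.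
have evf t : ev t f = (rnorm (ev t u : R[i]^o) ^+ 2 *
    (e ^+ 2 - rnorm (hat pi a t - c : R[i]^o) ^+ 2))%:C.
  rewrite (charB pi_rep (evP t) (closureZ pi_rep _ Buu) Bvv) (charZ (evP t)) //.
  rewrite (char_adjM pi_rep (evP t) Bu Bu' au) (char_adjM pi_rep (evP t) Bv Bv' av).
  rewrite (charB pi_rep (evP t) Bau (closureZ pi_rep _ Bu)) (charZ (evP t)) //.
  rewrite (charM (evP t)) // ev_rep -mulrBl rnormM exprMn.
  by rewrite -rmorphM -rmorphB; congr (_%:C); ring.
have [g Bg tg] := closure_pos pi_rep Bf af; exists g; split => //.
  rewrite tg; last exact: evP.
  rewrite evf /c subrr rnorm0 expr0n subr0 /=.
  have h : 0 < rnorm (ev s u : R[i]^o) ^+ 2 * e ^+ 2.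
    by rewrite mulr_gt0 ?exprn_gt0 // (@rnorm_gt0 _ R[i]^o).
  by rewrite max_r ?(ltW h) //; apply/eqP => -[h0]; rewrite h0 ltxx in h.
move=> t /= /negP; rewrite -ltNge => et; rewrite tg; last exact: evP.
rewrite evf /= max_l // mulr_ge0_le0 ?sqr_ge0 // subr_le0.
by rewrite ler_pXn2r // ?nnegrE ?(ltW e0) ?rnorm_ge0 // ltW.
Qed.

Lemma sp_hausdorff : hausdorff_space (sp pi).
Proof.
move=> s t st; apply: sp_ext => a; apply: (@rnorm_dist_eps _ R[i]^o) => e e0.
have Ba := closure_rep pi_rep a; have e2 : 0 < e / 2 by rewrite divr_gt0.
have nb w : nbhs w [set v | rnorm (ev v (pi a) - hat pi a w : R[i]^o) < e / 2].
  rewrite nbhsE; exists [set v | rnorm (ev v (pi a) - hat pi a w : R[i]^o) < e / 2] => //.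
  by split; [exact: open_ev_lt|rewrite /= ev_rep subrr rnorm0].
have [v [/= sv tv]] := st _ _ (nb s) (nb t).
have := @rnormB_tri _ R[i]^o (hat pi a s) (ev v (pi a)) (hat pi a t).
rewrite (@rnormB _ R[i]^o (hat pi a s) (ev v (pi a))) => h; exact: le_half h (ltW sv) (ltW tv).
Qed.

(** Closed discs are compact: the real and imaginary parts converge in segments. *)
Lemma ultra_cvg_disc (F : set_system (sp pi)) (k : sp pi -> R[i]) (M : R) :
  UltraFilter F -> (forall s, rnorm (k s : R[i]^o) <= M) ->
  exists l : R[i], forall e, 0 < e -> F [set s | rnorm (k s - l : R[i]^o) <= e].
Proof.
move=> UF kM; have PF : ProperFilter F by case: UF.
have lim (h : sp pi -> R) : (forall s, `|h s| <= M) ->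
    exists l : R, forall e, 0 < e -> F [set s | `|h s - l| <= e].
  move=> hM; have [|l [_ hl]] := @segment_compact R (- M) M (h @ F) _.
    suff : F (h @^-1` `[- M, M]) by [].
    by apply: (filterS _ filterT) => s _ /=; rewrite in_itv /= -ler_norml; exact: hM.
  exists l => e e0.
  have [//|nF] := in_ultra_setVsetC [set s | `|h s - l| <= e] UF.
  have nl : nbhs l (ball l e) by exact: nbhsx_ballx.
  have hF : F (h @^-1` (h @` ~` [set s | `|h s - l| <= e])).
    by apply: filterS nF; exact: preimage_image.
  have [_ [[s ns <-]]] := hl _ _ hF nl.
  by rewrite -ball_normE /ball_/= distrC => /ltW.
have [l1 h1] := lim (fun s => complex.Re (k s)) (fun s => le_trans (Re_le_rnorm _) (kM s)).
have [l2 h2] := lim (fun s => complex.Im (k s)) (fun s => le_trans (Im_le_rnorm _) (kM s)).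
exists (l1 +i* l2) => e e0; have e2 : 0 < e / 2 by rewrite divr_gt0.
apply: filterS (filterI (h1 _ e2) (h2 _ e2)) => s [/= s1 s2].
apply: le_trans (rnorm_le_ReIm _) _; rewrite [e]splitr.
by case: (k s) s1 s2 => x y /= s1 s2; exact: lerD.
Qed.

(** Pointwise limits of characters along an ultrafilter on which [a] stays away
    from [0] are again characters. *)
Lemma sp_compact a e : 0 < e -> compact [set s | e <= rnorm (hat pi a s : R[i]^o)].
Proof.
move=> e0; rewrite compact_ultra => F UF FK; have PF : ProperFilter F by case: UF.
have lim T : exists l : R[i], B T -> forall d, 0 < d ->
    F [set s | rnorm (ev s T - l : R[i]^o) <= d].
  have [BT|nBT] := pselect (B T); last by exists 0.
  have [c c0 bT] := BH_bnd (closure_BH BT).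
  have [l hl] := ultra_cvg_disc UF (fun s => ev_norm s c0 BT bT).
  by exists l => _.
have [tau tauP] := choice lim.
have tau_cvg T : B T -> (fun s => ev s T : R[i]^o) @ F --> (tau T : R[i]^o).
  by move=> BT; apply/cvg_rnormP; exact: tauP.
have uniq (k l : R[i]) (f : sp pi -> R[i]) : f @ F --> (k : R[i]^o) ->
    f @ F --> (l : R[i]^o) -> k = l.
  by move=> fk fl; apply: (cvg_unique (@norm_hausdorff _ R[i]^o) fk fl).
have Ba := closure_rep pi_rep a.
have tau_a : e <= rnorm (tau (pi a) : R[i]^o).
  apply: ler_eps => d d0.
  have [s [/= sK sd]] := filter_ex (filterI FK (tauP _ Ba _ d0)).
  rewrite -ev_rep in sK; apply: le_trans sK _.
  rewrite -[ev s (pi a)](subrK (tau (pi a))); apply: le_trans (@rnormD _ R[i]^o _ _) _.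
  by rewrite addrC lerD2l.
have chi : character B tau.
  split.
  - move=> S T BS BT; apply: (uniq _ _ (fun s => ev s (S + T))).
      by apply: tau_cvg; exact: (closureD pi_rep).
    under eq_fun do rewrite (charD (evP _) BS BT).
    exact: (@cvgD _ R[i]^o _ F _ _ _ _ _ (tau_cvg S BS) (tau_cvg T BT)).
  - move=> k S BS; apply: (uniq _ _ (fun s => ev s (k *: S))).
      by apply: tau_cvg; exact: (closureZ pi_rep).
    under eq_fun do rewrite (charZ (evP _) k BS).
    exact: (@cvgM R[i] _ F _ _ _ _ _ (@cvg_cst _ (k : R[i]^o) _ F _) (tau_cvg S BS)).
  - move=> S T BS BT; apply: (uniq _ _ (fun s => ev s (S \o T))).
      by apply: tau_cvg; exact: (closure_comp pi_rep).
    under eq_fun do rewrite (charM (evP _) BS BT).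
    exact: (@cvgM R[i] _ F _ _ _ _ _ (tau_cvg S BS) (tau_cvg T BT)).
  - exists (pi a) => //; apply: contraTneq tau_a => ->.
    by rewrite rnorm0 -ltNge.
have [s0 E] := character_ev chi; exists s0; split.
  by rewrite /= -ev_rep E.
apply: sp_cvg => b d d0; have Bb := closure_rep pi_rep b.
by have := tauP _ Bb _ d0; apply: filterS => t /=; rewrite ev_rep -E // ev_rep.
Qed.

Lemma hat_neq0 s : exists a, hat pi a s != 0.
Proof.
have [T /[dup] BT /(closureP pi_rep)[_ hT] sT] := char_neq0 (evP s).
have r0 : 0 < rnorm (ev s T : R[i]^o) / 2.
  by rewrite divr_gt0 // (@rnorm_gt0 _ R[i]^o).
have [a Ta] := hT _ r0; exists a.
have := character_dist (evP s) (ltW r0) BT Ta; rewrite ev_rep.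
apply: contraTneq => ->; rewrite subr0 -ltNge.
by rewrite ltr_pdivrMr // ltr_pMr ?ltr1n // -(@pmulr_lgt0 _ 2^-1).
Qed.

Lemma sp_locally_compact : locally_compact [set: sp pi].
Proof.
move=> s _; have [a sa] := hat_neq0 s; have Ba := closure_rep pi_rep a.
have r0 : 0 < rnorm (hat pi a s : R[i]^o) by exact: (@rnorm_gt0 _ R[i]^o).
set r := rnorm _ in r0; have r2 : 0 < r / 2 by rewrite divr_gt0.
have cK := @sp_compact a _ r2; exists [set t | r / 2 <= rnorm (hat pi a t : R[i]^o)].
  rewrite nbhsE /=; exists [set t | r / 2 < rnorm (ev t (pi a) - 0 : R[i]^o)].
    split; first exact: open_ev_gt.
    by rewrite /= ev_rep subr0 ltr_pdivrMr // ltr_pMr ?ltr1n.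
  by move=> t /= + _; rewrite ev_rep subr0 => /ltW.
by split => //; apply: compact_closed => //; exact: sp_hausdorff.
Qed.

End Spectrum.

(** * The projections attached to the open sets of the spectrum *)

Section OpenProjections.
Context {R : realType} {A : comStarAlgType R} {H : hilbertType R}.
Variable pi : A -> H -> H.
Hypothesis pi_rep : representation pi.
Hypothesis pi_nondeg : nondegenerate_rep pi.

Local Notation B := (norm_closure (range pi)).
Implicit Types (s t : sp pi) (S T f g : H -> H) (e : R) (x y z : H)
  (U V W C w : set (sp pi)) (D : set (set (sp pi))).

(** The indicator of [U] is the supremum of the functions between [0] and [1]
    supported in [U]; accordingly the kernel of its projection [popen U] consists
    of the vectors killed by all elements whose Gelfand transform is supported
    in [U]. *)
Definition supp_ideal U : set (H -> H) :=
  [set f | B f /\ forall t, ~ U t -> ev t f = 0].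

Definition null U : set H := [set x | forall f, supp_ideal U f -> f x = 0].

Definition range_open U : set H := orth (null U).

Lemma supp_idealS U V : U `<=` V -> supp_ideal U `<=` supp_ideal V.
Proof. by move=> UV f [Bf f0]; split=> // t nV; apply: f0 => /UV. Qed.

Lemma supp_ideal_adj U f : supp_ideal U f -> exists2 f', supp_ideal U f' & is_adjoint f' f.
Proof.
move=> [Bf f0]; have [f' Bf' af] := closure_adj pi_rep Bf; exists f' => //.
by split=> // t /f0 tf; rewrite (char_adj pi_rep (evP t) Bf Bf' af) tf conjC0.
Qed.

Lemma null_closed U : closed_subspace (null U).
Proof.
split=> [f [Bf _]|k x y hx hy f Jf|x hx f Jf].
- exact: lin0 (closure_linear Bf).
- by rewrite (closure_linear Jf.1) hx // hy // scaler0 addr0.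
have [c c0 bf] := BH_bnd (closure_BH Jf.1).
apply: rnorm_le_eps => e e0.
have c1 : 0 < c + 1 by rewrite ltr_wpDl.
have [y Ny xy] := hx _ (divr_gt0 e0 c1).
rewrite -[f x]subr0 -(Ny f Jf) -(linB _ _ (closure_linear Jf.1)).
apply: le_trans (bf _) _; apply: le_trans (ler_wpM2l c0 xy) _.
by rewrite mulrCA ler_piMr ?(ltW e0) // ler_pdivrMr // mul1r lerDl.
Qed.

Lemma range_open_closed U : closed_subspace (range_open U).
Proof. exact: orth_closed. Qed.

Lemma orth_range_open U : orth (range_open U) = null U.
Proof. by rewrite orthK //; exact: null_closed. Qed.

Lemma nullS U V : U `<=` V -> null V `<=` null U.
Proof. by move=> UV x Nx f /(supp_idealS UV); exact: Nx. Qed.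

Lemma range_openS U V : U `<=` V -> range_open U `<=` range_open V.
Proof. by move=> UV; apply/orthS/nullS. Qed.

Lemma range_open_ideal U f x : supp_ideal U f -> range_open U (f x).
Proof.
move=> Jf y Ny; have [f' Jf' af] := supp_ideal_adj Jf.
by rewrite (is_adjointC af) (Ny _ Jf') inner0r.
Qed.

(** [range_open U] is the closed span of the ranges of the elements supported
    in [U]. *)
Lemma range_open_min U (M : set H) : closed_subspace M ->
  (forall f y, supp_ideal U f -> M (f y)) -> range_open U `<=` M.
Proof.
move=> cM JM; rewrite -(orthK cM); apply: orthS => z oz f Jf.
have [f' Jf' af] := supp_ideal_adj Jf.
apply: inner_eq0 => y; rewrite (is_adjointC af).
by apply: oz; exact: JM.
Qed.

Lemma preimage_closed T (M : set H) : BH T -> closed_subspace M ->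
  closed_subspace [set z | M (T z)].
Proof.
move=> BT cM; have lT := BH_linear BT; have [c c0 bT] := BH_bnd BT.
split=> [|k x y /= Mx My|x hx] /=.
- by rewrite lin0 //; exact: subspace0.
- by rewrite lT; apply: (subspaceD cM) => //; exact: (subspaceZ cM).
apply: (subspace_lim cM) => e e0; have c1 : 0 < c + 1 by rewrite ltr_wpDl.
have [y /= My xy] := hx _ (divr_gt0 e0 c1); exists (T y) => //.
rewrite -linB //; apply: le_trans (bT _) _; apply: le_trans (ler_wpM2l c0 xy) _.
by rewrite mulrCA ler_piMr ?(ltW e0) // ler_pdivrMr // mul1r lerDl.
Qed.

Section Commuting.
Variable T : H -> H.
Hypothesis BT : BH T.
Hypothesis cT : forall g, B g -> forall x, T (g x) = g (T x).

Lemma null_commute U x : null U x -> null U (T x).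
Proof.
by move=> Nx f Jf; rewrite -cT ?(Nx f) ?(lin0 (BH_linear BT)) //; case: Jf.
Qed.

Lemma range_open_commute U x : range_open U x -> range_open U (T x).
Proof.
apply: (range_open_min (preimage_closed BT (range_open_closed U))) => f y Jf /=.
by rewrite cT; [exact: range_open_ideal|case: Jf].
Qed.

End Commuting.

Definition popen U : H -> H := proj (range_open U).

Lemma popen_eq0 U x : popen U x = 0 -> null U x.
Proof.
move=> p0; rewrite -orth_range_open -[x]subr0 -p0.
exact/proj_orth/range_open_closed.
Qed.

Lemma popen_null U x : null U x -> popen U x = 0.
Proof. by rewrite -orth_range_open; apply: proj_eq0; exact: range_open_closed. Qed.

Lemma popen_sub_null U x : null U (x - popen U x).
Proof. by rewrite -orth_range_open; exact/proj_orth/range_open_closed. Qed.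

Lemma popen_in U x : range_open U (popen U x).
Proof. exact: (proj_in (range_open_closed U)). Qed.

Lemma popen_linear U : linear (popen U).
Proof. exact/proj_linear/range_open_closed. Qed.

Lemma closure_cT g : B g -> forall h, B h -> forall x, g (h x) = h (g x).
Proof. by move=> Bg h Bh x; rewrite (closureC pi_rep x Bg Bh). Qed.

Lemma popen_comm T U x : BH T -> (forall g, B g -> forall x, T (g x) = g (T x)) ->
  T (popen U x) = popen U (T x).
Proof.
move=> BT cT; apply/esym/proj_uniq; first exact: range_open_closed.
  by apply: range_open_commute => //; exact: popen_in.
rewrite -(linB _ _ (BH_linear BT)) orth_range_open.
by apply: null_commute => //; exact: popen_sub_null.
Qed.

Lemma popen_closureC g U x : B g -> g (popen U x) = popen U (g x).
Proof.
move=> Bg; apply: popen_comm; first exact: (closure_BH Bg).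
exact: closure_cT.
Qed.

Lemma supp_idealI U V f g : supp_ideal U f -> supp_ideal V g ->
  supp_ideal (U `&` V) (f \o g).
Proof.
move=> [Bf f0] [Bg g0]; split=> [|t /not_andP nUV]; first exact: closure_comp.
by rewrite (charM (evP t) Bf Bg); case: nUV => [/f0|/g0] ->; rewrite ?mul0r ?mulr0.
Qed.

(** A product of elements supported in [U] and in [V] is supported in [U `&` V]. *)
Lemma popenI U V x : popen U (popen V x) = popen (U `&` V) x.
Proof.
have h y : null (U `&` V) y -> popen U (popen V y) = 0.
  move=> Ny; apply: popen_null => f Jf; rewrite popen_closureC; last by case: Jf.
  apply: popen_null => g Jg; have := Ny _ (supp_idealI Jf Jg).
  by rewrite /= (closureC pi_rep _ Jf.1 Jg.1).
rewrite -{1}(subrK (popen (U `&` V) x) x).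
rewrite (linD _ _ (popen_linear V)) (linD _ _ (popen_linear U)).
rewrite h ?add0r; last exact: popen_sub_null.
have pin := @popen_in (U `&` V) x.
rewrite /popen (proj_id (range_open_closed V)); last first.
  by apply: range_openS pin; exact: subIsetr.
rewrite (proj_id (range_open_closed U)) //.
by apply: range_openS pin; exact: subIsetl.
Qed.

(** A vector killed by the whole closure is killed by every [pi a]. *)
Lemma popen_setT x : popen setT x = x.
Proof.
apply: proj_id; first exact: range_open_closed.
move=> y Ny; rewrite (pi_nondeg (x := y)) ?inner0r // => a.
by apply: Ny; split=> [|t /(_ I)] //; exact: closure_rep.
Qed.

Lemma null_set0 x : null set0 x.
Proof.
by move=> f [Bf f0]; rewrite (gelfand_ev_inj pi_rep Bf) // => s; exact: f0.
Qed.

Lemma popen_set0 x : popen set0 x = 0.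
Proof. by apply: popen_null; exact: null_set0. Qed.

(** If [f x <> 0] for an [f] supported in the union, then some character with
    [tau f <> 0] kills everything that kills [x]; it lies in a member of the
    union, whose supported elements separate it. *)
Lemma null_bigcup D x : (forall U, D U -> open U /\ null U x) ->
  null (\bigcup_(U in D) U) x.
Proof.
move=> hD f [Bf f0]; apply: ip_eq0; apply/eqP; rewrite eq_le ip_ge0 andbT leNgt.
apply/negP => fx; have [f' Bf' af] := closure_adj pi_rep Bf.
have Bff : B (f' \o f) by exact: closure_comp.
have [|||s [[r r0 sr] s0]] := @vector_ev _ _ _ _ pi_rep (- (f' \o f)) x.
- exact: (closureN pi_rep).
- by apply: adjN; apply: adj_comp => //; exact: is_adjointC.
- have -> : ip ((- (f' \o f)) x) x = - ip (f x) (f x).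
    by rewrite ipNl /= /ip af.
  by rewrite oppr_lt0.
have sf : ev s f != 0.
  apply: contraTneq r0 => sf; move: sr.
  rewrite (charN (evP s) Bff) (charM (evP s) Bf' Bf) sf mulr0 oppr0.
  by move=> -[<-]; rewrite ltxx.
have [U DU Us] : (\bigcup_(U in D) U) s.
  by apply: contrapT => /f0 sf0; rewrite sf0 eqxx in sf.
have [oU NU] := hD U DU.
have [g [Bg sg g0]] := sp_urysohn pi_rep oU Us.
by move: sg; rewrite (s0 g Bg) ?eqxx //; apply: NU.
Qed.

Lemma nullU U V x : open U -> open V -> null U x -> null V x -> null (U `|` V) x.
Proof.
move=> oU oV NU NV; have -> : U `|` V = \bigcup_(W in [set U; V]) W.
  by rewrite bigcup_setU !bigcup_set1.
by apply: null_bigcup => W [->|->].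
Qed.

(** The family of the [popen U] is directed, so that its supremum is a limit. *)
Lemma popen_directed D x : D !=set0 -> (forall U, D U -> open U) ->
  (forall U V, D U -> D V -> exists2 W, D W & U `|` V `<=` W) ->
  forall e, 0 < e -> exists2 U, D U & rnorm (popen (\bigcup_(U in D) U) x - popen U x) <= e.
Proof.
move=> [U0 DU0] oD dirD; set Y := \bigcup_(U in D) U.
pose M := [set z | forall e, 0 < e -> exists2 U, D U & rnorm (z - popen U z) <= e].
have sub z U V : U `<=` V -> rnorm (z - popen V z) <= rnorm (z - popen U z).
  move=> UV; have := proj_pyth (range_open_closed U) z.
  have := proj_pyth (range_open_closed V) z.
  have := projS_le z (range_open_closed U) (range_open_closed V) (range_openS UV).
  rewrite -/(popen U) -/(popen V) => h1 h2 h3.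
  have h4 : rnorm (popen U z) ^+ 2 <= rnorm (popen V z) ^+ 2.
    by rewrite ler_pXn2r // nnegrE rnorm_ge0.
  apply: rnorm_sqr_le; first exact: rnorm_ge0.
  by move: h2 h3 h4; clear; set a := rnorm z ^+ 2 => *; lra.
have lp U := popen_linear U.
have cM : closed_subspace M.
  split=> [e e0|k y z My Mz e e0|z hz e e0].
  - by exists U0 => //; rewrite (lin0 (lp _)) subrr rnorm0 ltW.
  - pose c := rnorm (k : R[i]^o) + 1.
    have c0 : 0 < c by rewrite ltr_wpDl // rnorm_ge0.
    have [U DU yU] := My (e / 2 / c) ltac:(by rewrite !divr_gt0).
    have [V DV zV] := Mz (e / 2) ltac:(by rewrite divr_gt0).
    have [W DW UVW] := dirD U V DU DV; exists W => //.
    have -> : k *: y + z - popen W (k *: y + z) =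
       k *: (y - popen W y) + (z - popen W z).
      by rewrite lp scalerBr opprD addrACA.
    apply: le_trans (rnormD _ _) _; rewrite [e]splitr rnormZ; apply: lerD.
      apply: (@le_trans _ _ (c * (e / 2 / c))); last by rewrite mulrC divfK ?gt_eqF.
      apply: ler_pM; rewrite ?rnorm_ge0 ?lerDl //.
      by apply: le_trans yU; apply: sub; apply: subset_trans UVW; exact: subsetUl.
    by apply: le_trans zV; apply: sub; apply: subset_trans UVW; exact: subsetUr.
  - have [y My zy] := hz (e / 2) ltac:(by rewrite divr_gt0).
    have [U DU yU] := My (e / 2) ltac:(by rewrite divr_gt0); exists U => //.
    have -> : z - popen U z = ((z - y) - popen U (z - y)) + (y - popen U y).
      by rewrite (linB _ _ (lp U)); vector_ring.
    apply: le_trans (rnormD _ _) _; rewrite [e]splitr; apply: lerD => //.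
    apply: le_trans zy; apply: rnorm_sqr_le; first exact: rnorm_ge0.
    by rewrite [leRHS](proj_pyth (range_open_closed U)) lerDr sqr_ge0.
have LM U : D U -> range_open U `<=` M.
  move=> DU z Lz e e0; exists U => //.
  by rewrite /popen (proj_id (range_open_closed U)) // subrr rnorm0 ltW.
have MY : range_open Y `<=` M.
  rewrite -(orthK cM); apply: orthS => z oz; apply: null_bigcup => U DU.
  split; first exact: oD; rewrite -orth_range_open.
  by apply: orthS oz; exact: LM.
move=> e e0; have [U DU h] := MY _ (@popen_in Y x) e e0; exists U => //.
rewrite popenI in h; rewrite (_ : U `&` Y = U) // in h.
by apply/setIidPl; exact: bigcup_sup.
Qed.

(** The right-hand side is [1 - (1 - popen U)(1 - popen V)], and a vector killed
    by the ideals of [U] and [V] is killed by that of the union. *)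
Lemma popenU U V x : open U -> open V ->
  popen (U `|` V) x = popen U x + popen V x - popen (U `&` V) x.
Proof.
move=> oU oV; apply: proj_uniq; first exact: range_open_closed.
  have cL := range_open_closed (U `|` V).
  apply: (subspaceB cL); first apply: (subspaceD cL).
  - by apply: range_openS (@popen_in U x); exact: subsetUl.
  - by apply: range_openS (@popen_in V x); exact: subsetUr.
  - by apply: range_openS (@popen_in (U `&` V) x) => z []; left.
rewrite orth_range_open; apply: nullU => //.
  have -> : x - (popen U x + popen V x - popen (U `&` V) x) =
      (x - popen V x) - popen U (x - popen V x).
    by rewrite (linB _ _ (popen_linear U)) popenI; vector_ring.
  exact: popen_sub_null.
have -> : x - (popen U x + popen V x - popen (U `&` V) x) =
    (x - popen U x) - popen V (x - popen U x).
  by rewrite (linB _ _ (popen_linear V)) popenI setIC; vector_ring.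
exact: popen_sub_null.
Qed.

Definition mopen x U : R := rnorm (popen U x) ^+ 2.

Lemma mopenE x U : mopen x U = ip (popen U x) x.
Proof. by rewrite /mopen /popen (proj_sqr (range_open_closed U)). Qed.

Lemma mopenU x U V : open U -> open V ->
  mopen x (U `|` V) = mopen x U + mopen x V - mopen x (U `&` V).
Proof. by move=> oU oV; rewrite !mopenE popenU // !(ipDl, ipNl). Qed.

Lemma mopen_ge0 x U : 0 <= mopen x U. Proof. exact: sqr_ge0. Qed.

Lemma mopenU_le x U V : open U -> open V -> mopen x (U `|` V) <= mopen x U + mopen x V.
Proof. by move=> oU oV; rewrite mopenU // gerBl mopen_ge0. Qed.

Lemma mopenS x U V : U `<=` V -> mopen x U <= mopen x V.
Proof.
move=> UV; rewrite ler_pXn2r ?nnegrE ?rnorm_ge0 //.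
exact: (projS_le x (range_open_closed U) (range_open_closed V) (range_openS UV)).
Qed.

Lemma mopen_set0 x : mopen x set0 = 0.
Proof. by rewrite /mopen popen_set0 rnorm0 expr0n. Qed.

Lemma mopen_setT x : mopen x setT = rnorm x ^+ 2.
Proof. by rewrite /mopen popen_setT. Qed.

Lemma mopen_sub x U V : U `<=` V ->
  rnorm (popen V x - popen U x) ^+ 2 = mopen x V - mopen x U.
Proof.
move=> UV.
exact: (projS_sub x (range_open_closed U) (range_open_closed V) (range_openS UV)).
Qed.

Lemma mopen_directed D x : D !=set0 -> (forall U, D U -> open U) ->
  (forall U V, D U -> D V -> exists2 W, D W & U `|` V `<=` W) ->
  forall e, 0 < e -> exists2 U, D U & mopen x (\bigcup_(U in D) U) <= mopen x U + e.
Proof.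
move=> D0 oD dirD e e0.
have q0 : 0 < Num.sqrt e by rewrite sqrtr_gt0.
have [U DU h] := popen_directed x D0 oD dirD q0; exists U => //.
rewrite -lerBlDl -mopen_sub; last exact: bigcup_sup.
by rewrite -[leRHS](sqr_sqrtr (ltW e0)) ler_pXn2r // nnegrE ?rnorm_ge0 // ltW.
Qed.

End OpenProjections.

(** * The spectral measure *)

Section SigmaAlgebra.
Context {Omega : Type} {E : set (set Omega)}.
Hypothesis sE : sigma_algebra setT E.

Lemma sigma_set0 : E set0. Proof. by case: sE. Qed.

Lemma sigma_setC w : E w -> E (~` w).
Proof. by move=> Ew; rewrite -setTD; case: sE => _ h _; exact: h. Qed.

Lemma sigma_bigcup (F : nat -> set Omega) : (forall n, E (F n)) -> E (\bigcup_n F n).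
Proof. by case: sE => _ _; apply. Qed.

Lemma sigma_setU v w : E v -> E w -> E (v `|` w).
Proof.
by move=> Ev Ew; rewrite -bigcup2E; apply: sigma_bigcup => -[|[|n]] //=; exact: sigma_set0.
Qed.

Lemma sigma_setI v w : E v -> E w -> E (v `&` w).
Proof.
by move=> Ev Ew; rewrite -[v `&` w]setCK setCI; apply/sigma_setC/sigma_setU; exact: sigma_setC.
Qed.

Lemma sigma_setD v w : E v -> E w -> E (v `\` w).
Proof. by move=> Ev Ew; rewrite setDE; apply: sigma_setI => //; exact: sigma_setC. Qed.

End SigmaAlgebra.

Section SpectralProjections.
Context {R : realType} {A : comStarAlgType R} {H : hilbertType R}.
Variable pi : A -> H -> H.
Hypothesis pi_rep : representation pi.
Hypothesis pi_nondeg : nondegenerate_rep pi.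

Local Notation B := (norm_closure (range pi)).
Local Notation borel := (borel (sp pi)).
Implicit Types (s t : sp pi) (S T f g : H -> H) (e : R) (x y z : H)
  (U V W C w v : set (sp pi)) (D : set (set (sp pi))).

(** Outer regularity, made into a definition: the projection of [w] is the
    infimum of those of the open sets around [w]. *)
Definition range_proj w : set H :=
  \bigcap_(U in [set U | open U /\ w `<=` U]) range_open U.

Definition spec w : H -> H := proj (range_proj w).

Lemma range_proj_closed w : closed_subspace (range_proj w).
Proof. by apply: bigcap_closed => U _; exact: range_open_closed. Qed.

Lemma range_projS v w : v `<=` w -> range_proj v `<=` range_proj w.
Proof. by move=> vw x hx U [oU wU]; apply: hx; split=> //; exact: subset_trans wU. Qed.

Lemma range_proj_open U : open U -> range_proj U = range_open U.
Proof.
move=> oU; apply/seteqP; split=> x; first by apply; split.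
by move=> hx V [oV UV]; apply: range_openS hx.
Qed.

Lemma spec_open U : open U -> spec U = popen U.
Proof. by move=> oU; rewrite /spec range_proj_open. Qed.

Lemma spec_in w x : range_proj w (spec w x).
Proof. exact: (proj_in (range_proj_closed w)). Qed.

Lemma spec_setT x : spec setT x = x.
Proof. by rewrite spec_open ?popen_setT //; exact: openT. Qed.

Lemma spec_set0 x : spec set0 x = 0.
Proof. by rewrite spec_open ?popen_set0 //; exact: open0. Qed.

(** [V] and [W] are the sets where a Urysohn element is above, respectively
    below, half of its value at [s]. *)
Lemma sp_regular U s : open U -> U s -> exists V W,
  [/\ open V, V s, open W, ~` U `<=` W & V `&` W = set0].
Proof.
move=> oU Us; have [g [Bg sg g0]] := sp_urysohn pi_rep oU Us.
have r0 : 0 < rnorm (ev s g : R[i]^o).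
  exact: (@rnorm_gt0 _ R[i]^o).
set r := rnorm _ in r0.
exists [set t | r / 2 < rnorm (ev t g - 0 : R[i]^o)].
exists [set t | rnorm (ev t g - 0 : R[i]^o) < r / 2]; split.
- exact: open_ev_gt.
- by rewrite /= subr0 ltr_pdivrMr // ltr_pMr ?ltr1n.
- exact: open_ev_lt.
- by move=> t /g0 /= ->; rewrite subrr rnorm0 divr_gt0.
- by rewrite -subset0 => t [/= h1 h2]; have := lt_trans h1 h2; rewrite ltxx.
Qed.

(** Points of [U] have neighbourhoods separated from [~` U], and these cover [U];
    conversely an open set around [~` U] covers the spectrum together with [U]. *)
Lemma range_proj_setC U : open U -> range_proj (~` U) = null U.
Proof.
move=> oU; apply/seteqP; split=> z.
  move=> hz.
  pose D := [set V | open V /\ exists W, [/\ open W, ~` U `<=` W & V `&` W = set0]].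
  have UD : U `<=` \bigcup_(V in D) V.
    move=> s Us; have [V [W [oV Vs oW CW VW]]] := sp_regular oU Us.
    by exists V => //; split => //; exists W.
  apply: (nullS UD); apply: null_bigcup => // V [oV [W [oW CW VW]]]; split => //.
  apply: popen_eq0; have /(proj_id (range_open_closed W)) <- : range_open W z by apply: hz.
  by rewrite -/(popen W z) popenI // VW popen_set0.
move=> Nz V [oV CV]; have UV : U `|` V = setT.
  apply/seteqP; split=> // s _; have [Us|nUs] := pselect (U s); first by left.
  by right; exact: CV.
have := popenU pi_rep z oU oV; rewrite UV popen_setT // (popen_null Nz) add0r.
rewrite setIC -popenI // (popen_null Nz) (lin0 (popen_linear _)) subr0 => ->.
exact: popen_in.
Qed.

Lemma spec_closed C x : closed C -> spec C x = x - popen (~` C) x.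
Proof.
move=> cC; have oC : open (~` C) by exact: closed_openC.
apply: proj_uniq; first exact: range_proj_closed.
  by rewrite -[C in range_proj C]setCK range_proj_setC //; exact: popen_sub_null.
rewrite opprB addrCA subrr addr0 -[C in range_proj C]setCK range_proj_setC //.
exact: popen_in.
Qed.

Definition mspec x w : R := rnorm (spec w x) ^+ 2.

Lemma mspecE x w : mspec x w = ip (spec w x) x.
Proof. by rewrite /mspec /spec (proj_sqr (range_proj_closed w)). Qed.

Lemma mspec_ge0 x w : 0 <= mspec x w. Proof. exact: sqr_ge0. Qed.

Lemma mspec_open x U : open U -> mspec x U = mopen x U.
Proof. by move=> oU; rewrite /mspec spec_open. Qed.

Lemma mspecS x v w : v `<=` w -> mspec x v <= mspec x w.
Proof.
move=> vw; rewrite ler_pXn2r ?nnegrE ?rnorm_ge0 //.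
exact: (projS_le x (range_proj_closed v) (range_proj_closed w) (range_projS vw)).
Qed.

Lemma mspec_closed x C : closed C -> mspec x C = rnorm x ^+ 2 - mopen x (~` C).
Proof.
move=> cC; rewrite mspecE spec_closed // ipDl ipNl rnorm_sqr mopenE //.
Qed.

Lemma mspec_sub x C U : closed C -> open U -> C `<=` U ->
  mopen x (U `\` C) = mopen x U - mspec x C.
Proof.
move=> cC oU CU; rewrite mspec_closed // setDE; have oC := closed_openC cC.
have := mopenU pi_rep x oU oC; rewrite (_ : U `|` ~` C = setT) ?mopen_setT //.
  by move=> ->; ring.
apply/seteqP; split=> // s _; have [Cs|nCs] := pselect (C s); last by right.
by left; exact: CU.
Qed.

(** Approximation for one vector at a time suffices for countable additivity, and
    the sets that allow it form a [sigma]-algebra. *)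
Definition regular_set x w := forall e, 0 < e -> exists C U,
  [/\ closed C, open U, C `<=` w, w `<=` U & mopen x (U `\` C) <= e].

Lemma open_setD U C : open U -> closed C -> open (U `\` C).
Proof. by move=> oU cC; rewrite setDE; apply: openI => //; exact: closed_openC. Qed.

(** [U] is the directed union of the open sets whose closure lies in [U]. *)
Lemma regular_open x U : open U -> regular_set x U.
Proof.
move=> oU e e0.
pose D := [set V | open V /\ exists C, [/\ closed C, V `<=` C & C `<=` U]].
have UD : \bigcup_(V in D) V = U.
  apply/seteqP; split=> s.
    by move=> [V [_ [C [_ VC CU]]] Vs]; apply/CU/VC.
  move=> Us; have [V [W [oV Vs oW CW VW]]] := sp_regular oU Us.
  exists V => //; split => //; exists (~` W); split.
  - exact: open_closedC.
  - by move=> t Vt Wt; have : (V `&` W) t by []; rewrite VW.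
  - by move=> t nWt; apply: contrapT => /CW.
have [||V1 V2 [oV1 [C1 [cC1 VC1 CU1]]] [oV2 [C2 [cC2 VC2 CU2]]]|V [oV [C [cC VC CU]]] h] :=
    @mopen_directed _ _ _ _ pi_rep D x _ _ _ e e0.
- by exists set0; split; [exact: open0|exists set0; split => //; exact: closed0].
- by move=> V [].
- exists (V1 `|` V2) => //; split; first exact: openU.
  exists (C1 `|` C2); split; first exact: closedU.
    by move=> t [/VC1|/VC2]; [left|right].
  by move=> t [/CU1|/CU2].
exists C, U; split=> //; rewrite mspec_sub //; rewrite UD in h.
have := mspecS x VC; rewrite mspec_open // => h2.
by rewrite lerBlDl; apply: le_trans h _; rewrite lerD2r.
Qed.

Lemma regular_setC x w : regular_set x w -> regular_set x (~` w).
Proof.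
move=> hw e /hw[C [U [cC oU Cw wU h]]]; exists (~` U), (~` C); split.
- exact: open_closedC.
- exact: closed_openC.
- exact: subsetC.
- exact: subsetC.
- by rewrite setDE setCK setIC -setDE.
Qed.

Lemma mopen_bigcup_le x (V : nat -> set (sp pi)) N e : 0 < e -> (forall n, open (V n)) ->
  (forall n, mopen x (V n) <= e / 2 ^+ n.+1) ->
  mopen x (\bigcup_(n in `I_N) V n) <= e.
Proof.
move=> e0 oV hV; suff : mopen x (\bigcup_(n in `I_N) V n) <= e - e / 2 ^+ N.
  by move=> /le_trans; apply; rewrite gerBl divr_ge0 ?exprn_ge0 ?(ltW e0).
elim: N => [|N IHN].
  by rewrite II0 bigcup_set0 mopen_set0 // expr0 divr1 subrr.
have oN : open (\bigcup_(n in `I_N) V n) by exact: bigcup_open.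
rewrite IIS bigcup_setU bigcup_set1; apply: le_trans (mopenU_le pi_rep x oN (oV N)) _.
apply: le_trans (lerD IHN (hV N)) _.
have h : 2 ^+ N != 0 :> R by rewrite expf_neq0.
by rewrite exprS le_eqVlt; apply/orP; left; apply/eqP; field.
Qed.

Lemma mopen_bigcup_approx x (U : nat -> set (sp pi)) e : 0 < e -> (forall n, open (U n)) ->
  exists N, mopen x (\bigcup_n U n) <= mopen x (\bigcup_(n in `I_N) U n) + e.
Proof.
move=> e0 oU; pose D := [set V | exists N, V = \bigcup_(n in `I_N) U n].
have UD : \bigcup_(V in D) V = \bigcup_n U n.
  apply/seteqP; split=> s; first by move=> [_ [N ->] [n _ Uns]]; exists n.
  by move=> [n _ Uns]; exists (\bigcup_(n in `I_n.+1) U n); [exists n.+1|exists n => /=].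
have [|||_ [N ->]] := @mopen_directed _ _ _ _ pi_rep D x _ _ _ e e0.
- by exists (\bigcup_(n in `I_0) U n); exists 0%N.
- by move=> _ [N ->]; exact: bigcup_open.
- move=> _ _ [N ->] [M ->]; exists (\bigcup_(n in `I_(maxn N M)) U n); first by eexists.
  move=> s [[n /= nN Uns]|[n /= nM Uns]]; exists n => //=.
    exact: leq_trans nN (leq_maxl _ _).
  exact: leq_trans nM (leq_maxr _ _).
by rewrite UD; exists N.
Qed.

Lemma closed_bigcup_finite (C : nat -> set (sp pi)) N : (forall n, closed (C n)) ->
  closed (\bigcup_(n in `I_N) C n).
Proof.
move=> cC; elim: N => [|N IHN]; first by rewrite II0 bigcup_set0; exact: closed0.
by rewrite IIS bigcup_setU bigcup_set1; exact: closedU.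
Qed.

Lemma regular_bigcup x (F : nat -> set (sp pi)) : (forall n, regular_set x (F n)) ->
  regular_set x (\bigcup_n F n).
Proof.
move=> hF e e0; have e2 : 0 < e / 2 by rewrite divr_gt0.
have en n : 0 < e / 2 / 2 ^+ n.+1 by rewrite divr_gt0 // exprn_gt0.
have [C] := choice (fun n => hF n _ (en n)).
move=> /choice[U CU].
have oU n : open (U n) by case: (CU n).
have cC n : closed (C n) by case: (CU n).
have CF n : C n `<=` F n by case: (CU n).
have FU n : F n `<=` U n by case: (CU n).
have hCU n : mopen x (U n `\` C n) <= e / 2 / 2 ^+ n.+1 by case: (CU n).
have [N hN] := mopen_bigcup_approx x e2 oU.
have cN := @closed_bigcup_finite _ N cC.
have oN : open (\bigcup_(n in `I_N) U n) by exact: bigcup_open.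
have oT : open (\bigcup_n U n) by exact: bigcup_open.
have CUN : \bigcup_(n in `I_N) C n `<=` \bigcup_(n in `I_N) U n.
  by move=> s [n nN Cs]; exists n => //; apply/FU/CF.
exists (\bigcup_(n in `I_N) C n), (\bigcup_n U n); split => //.
- by move=> s [n _ Cs]; exists n => //; exact: CF.
- by move=> s [n _ Fs]; exists n => //; exact: FU.
rewrite mspec_sub //; last by move=> s /CUN [n _ Us]; exists n.
have := mspec_sub x cN oN CUN.
have : mopen x ((\bigcup_(n in `I_N) U n) `\` (\bigcup_(n in `I_N) C n)) <= e / 2.
  apply: le_trans (mopen_bigcup_le N e2 _ hCU).
    apply: mopenS => s [[n nN Us] nC]; exists n => //; split => // Cs.
    by apply: nC; exists n.
  by move=> n; exact: open_setD.
move: hN; clear => h1 h2 h3; rewrite h3 in h2.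
by move: h1 h2; set a := mopen x _; set b := mopen x _; set c := mspec x _ => *; lra.
Qed.

Lemma borel_regular x w : borel w -> regular_set x w.
Proof.
apply: smallest_sub => [|U]; last exact: regular_open.
split.
- by apply: regular_open; exact: open0.
- by move=> v hv; rewrite setTD; exact: regular_setC.
- exact: regular_bigcup.
Qed.

Lemma borel_approx x w e : borel w -> 0 < e -> exists C U,
  [/\ closed C, open U, C `<=` w, w `<=` U & mopen x U <= mspec x C + e].
Proof.
move=> /(borel_regular x) hw /hw[C [U [cC oU Cw wU h]]]; exists C, U; split=> //.
rewrite mspec_sub // in h; last exact: subset_trans wU.
by rewrite -lerBlDl.
Qed.

(** Subadditivity comes from open sets around [v] and [w], superadditivity from
    disjoint closed sets inside, whose complements cover the spectrum. *)
Lemma mspec_setU x v w : borel v -> borel w -> v `&` w = set0 ->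
  mspec x (v `|` w) = mspec x v + mspec x w.
Proof.
move=> bv bw vw; apply/eqP; rewrite eq_le; apply/andP; split; apply: ler_eps => e e0.
  have e2 : 0 < e / 2 by rewrite divr_gt0.
  have [C [U [cC oU Cv vU h1]]] := borel_approx x bv e2.
  have [C' [U' [cC' oU' Cw wU h2]]] := borel_approx x bw e2.
  have h3 := mspecS x Cv; have h4 := mspecS x Cw.
  have h5 : mspec x (v `|` w) <= mopen x (U `|` U').
    by rewrite -mspec_open; [apply: mspecS; exact: setUSS|exact: openU].
  have h6 := mopenU_le pi_rep x oU oU'.
  apply: le_trans h5 _; apply: le_trans h6 _.
  move: h1 h2 h3 h4; set a := mopen x U; set b := mopen x U'.
  set c := mspec x C; set d := mspec x C'; set c' := mspec x v; set d' := mspec x w.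
  by clear; lra.
have e2 : 0 < e / 2 by rewrite divr_gt0.
have [C [U [cC oU Cv vU h1]]] := borel_approx x bv e2.
have [C' [U' [cC' oU' Cw wU h2]]] := borel_approx x bw e2.
have h3 : mspec x v <= mopen x U by rewrite -mspec_open //; exact: mspecS.
have h4 : mspec x w <= mopen x U' by rewrite -mspec_open //; exact: mspecS.
have h5 : mspec x (C `|` C') <= mspec x (v `|` w) by apply: mspecS; exact: setUSS.
have h6 : mspec x (C `|` C') = mspec x C + mspec x C'.
  rewrite !mspec_closed //; last exact: closedU.
  have := mopenU pi_rep x (closed_openC cC) (closed_openC cC').
  rewrite -setCI (_ : C `&` C' = set0); last first.
    by rewrite -subset0 -vw; exact: setISS.
  rewrite setC0 mopen_setT // setCU.
  set a := rnorm x ^+ 2; set b := mopen _ _; set c := mopen _ _; set d := mopen _ _.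
  by clear; lra.
move: h1 h2 h3 h4 h5; rewrite h6.
set a := mopen x U; set b := mopen x U'; set m := mspec x (v `|` w).
set c := mspec x C; set d := mspec x C'; set c' := mspec x v; set d' := mspec x w.
by clear; lra.
Qed.

Lemma borel_sigma : sigma_algebra setT borel.
Proof. exact: smallest_sigma_algebra. Qed.

Lemma borel_setC w : borel w -> borel (~` w).
Proof. exact: (sigma_setC borel_sigma). Qed.

Lemma borel_open U : open U -> borel U.
Proof. by move=> oU; apply: sub_sigma_algebra. Qed.

Lemma borel_closed C : closed C -> borel C.
Proof. by move=> cC; rewrite -[C]setCK; exact: (borel_setC (borel_open (closed_openC cC))). Qed.

Lemma borel_bigcup_finite (F : nat -> set (sp pi)) N : (forall n, borel (F n)) ->
  borel (\bigcup_(n in `I_N) F n).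
Proof.
move=> bF; elim: N => [|N IHN].
  by rewrite II0 bigcup_set0; exact: (sigma_set0 borel_sigma).
by rewrite IIS bigcup_setU bigcup_set1; exact: (sigma_setU borel_sigma).
Qed.

Lemma mspec_bigcup_finite x (F : nat -> set (sp pi)) N : (forall n, borel (F n)) ->
  trivIset setT F ->
  mspec x (\bigcup_(n in `I_N) F n) = \sum_(0 <= n < N) mspec x (F n).
Proof.
move=> bF tF; elim: N => [|N IHN].
  by rewrite II0 bigcup_set0 big_nil /mspec spec_set0 rnorm0 expr0n.
rewrite IIS bigcup_setU bigcup_set1 big_nat_recr //= -IHN.
apply: mspec_setU => //; first exact: borel_bigcup_finite.
rewrite -subset0 => s [[n /= nN Fn] FN].
have := @tF n N I I (ex_intro _ s (conj Fn FN)) => nE.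
by rewrite nE ltnn in nN.
Qed.

(** The converse inequality follows from monotony and finite additivity, so that
    countable additivity is only a matter of approximating [F n] from outside up
    to [e / 2^(n+2)] and of continuity along increasing open sets. *)
Lemma mspec_sigma x (F : nat -> set (sp pi)) : (forall n, borel (F n)) ->
  trivIset setT F -> forall e, 0 < e ->
  exists N, mspec x (\bigcup_n F n) <= \sum_(0 <= n < N) mspec x (F n) + e.
Proof.
move=> bF tF e e0; have e2 : 0 < e / 2 by rewrite divr_gt0.
have en n : 0 < e / 2 / 2 ^+ n.+1 by rewrite divr_gt0 // exprn_gt0.
have approx n : exists V,
    [/\ open V, F n `<=` V & mopen x V <= mspec x (F n) + e / 2 / 2 ^+ n.+1].
  have [C [V [cC oV CF FV h]]] := borel_approx x (bF n) (en n); exists V; split=> //.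
  by apply: le_trans h _; rewrite lerD2r; exact: mspecS.
have [U UP] := choice approx.
have oU n : open (U n) by case: (UP n).
have [N hN] := mopen_bigcup_approx x e2 oU; exists N.
have h1 : mspec x (\bigcup_n F n) <= mopen x (\bigcup_n U n).
  rewrite -mspec_open; last exact: bigcup_open.
  by apply: mspecS => s [n _ Fs]; exists n => //; case: (UP n) => _ h _; exact: h.
have h2 M : mopen x (\bigcup_(n in `I_M) U n) <=
    \sum_(0 <= n < M) mspec x (F n) + (e / 2 - e / 2 / 2 ^+ M).
  elim: M => [|M IHM].
    by rewrite II0 bigcup_set0 mopen_set0 // big_nil expr0 divr1 subrr addr0.
  have oM : open (\bigcup_(n in `I_M) U n) by exact: bigcup_open.
  rewrite IIS bigcup_setU bigcup_set1; apply: le_trans (mopenU_le pi_rep x oM (oU M)) _.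
  have [_ _ hM] := UP M; apply: le_trans (lerD IHM hM) _.
  have h : 2 ^+ M != 0 :> R by rewrite expf_neq0.
  rewrite big_nat_recr //= exprS le_eqVlt; apply/orP; left; apply/eqP.
  by set a := \sum_(0 <= n < M) _; set b := mspec x (F M); field.
have h3 : 0 <= e / 2 / 2 ^+ N by rewrite divr_ge0 ?exprn_ge0 // ltW.
move: h1 (h2 N) hN h3; set a := \sum_(0 <= n < N) _; set b := mspec x _.
set c := mopen x _; set d := mopen x _; set p := _ / 2 ^+ N.
by clear; lra.
Qed.

Lemma spec_projection w : orthogonal_projection (spec w).
Proof. exact/orthogonal_projection_proj/range_proj_closed. Qed.

Lemma spec_measure x : is_measure borel (diag_measure spec x).
Proof.
have dE w : diag_measure spec x w = (mspec x w)%:E.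
  by rewrite /diag_measure mspecE.
split=> [|w _|F bF tF]; rewrite ?dE.
- by rewrite /mspec spec_set0 rnorm0 expr0n.
- by rewrite lee_fin mspec_ge0.
have -> : (fun n => \sum_(0 <= i < n) diag_measure spec x (F i))%E =
    (fun n => (\sum_(0 <= i < n) mspec x (F i))%:E).
  by apply/funext => n; rewrite -sumEFin; apply: eq_bigr => i _; rewrite dE.
apply: cvg_EFin; first by near=> n.
apply/cvgrPdist_le => e e0; have [N hN] := mspec_sigma x bF tF e0.
exists N => // n /= Nn.
have le1 : \sum_(0 <= i < n) mspec x (F i) <= mspec x (\bigcup_k F k).
  rewrite -mspec_bigcup_finite //; apply: mspecS => s [k _ Fs]; by exists k.
have le2 : \sum_(0 <= i < N) mspec x (F i) <= \sum_(0 <= i < n) mspec x (F i).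
  rewrite [leRHS](@big_cat_nat _ _ _ N) //= lerDl; apply: sumr_ge0 => i _.
  exact: mspec_ge0.
rewrite ger0_norm ?subr_ge0 //; apply: le_trans (lerB hN le2) _.
by rewrite addrAC subrr add0r.
Unshelve. all: by end_near. Qed.

End SpectralProjections.

(** * Estimates on spectral subspaces, and inner regularity *)

Section SpectralEstimate.
Context {R : realType} {A : comStarAlgType R} {H : hilbertType R}.
Variable pi : A -> H -> H.
Hypothesis pi_rep : representation pi.
Hypothesis pi_nondeg : nondegenerate_rep pi.

Local Notation B := (norm_closure (range pi)).
Local Notation borel := (borel (sp pi)).
Implicit Types (s t : sp pi) (S T f g k : H -> H) (e d : R) (c : R[i]) (x y z : H)
  (U V W C w v : set (sp pi)).

(** The defect of [z] from the closed cyclic subspace of [z] is killed by every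
    [pi a]. *)
Lemma approximate_unit z e : 0 < e -> exists2 k, B k & rnorm (z - k z) <= e.
Proof.
pose M := [set y | forall e, 0 < e -> exists2 k, B k & rnorm (y - k z) <= e].
have cM : closed_subspace M.
  split=> [d d0|c x y Mx My d d0|y hy d d0].
  - by exists 0; [exact: (closure0 pi_rep)|rewrite subr0 rnorm0 ltW].
  - pose r := rnorm (c : R[i]^o) + 1.
    have r0 : 0 < r by rewrite ltr_wpDl // rnorm_ge0.
    have [k Bk xk] := Mx (d / 2 / r) ltac:(by rewrite !divr_gt0).
    have [l Bl yl] := My (d / 2) ltac:(by rewrite divr_gt0).
    exists (c *: k + l); first exact: closure_lin.
    have -> : c *: x + y - (c *: k + l) z = c *: (x - k z) + (y - l z).
      by rewrite !fctE; vector_ring.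
    apply: le_trans (rnormD _ _) _; rewrite [d]splitr rnormZ; apply: lerD => //.
    apply: (@le_trans _ _ (r * (d / 2 / r))); last by rewrite mulrC divfK ?gt_eqF.
    by apply: ler_pM; rewrite ?rnorm_ge0 ?lerDl.
  - have [x Mx yx] := hy (d / 2) ltac:(by rewrite divr_gt0).
    have [k Bk xk] := Mx (d / 2) ltac:(by rewrite divr_gt0); exists k => //.
    exact: le_half (rnormB_tri y x (k z)) yx xk.
have MB a y : M y -> M (pi a y).
  move=> My d d0; have Ba := closure_rep pi_rep a.
  have [q q0 bq] := BH_bnd (closure_BH Ba).
  have q1 : 0 < q + 1 by rewrite ltr_wpDl.
  have [k Bk yk] := My _ (divr_gt0 d0 q1); exists (pi a \o k); first exact: closure_comp.
  rewrite /= -(linB _ _ (closure_linear Ba)).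
  apply: le_trans (bq _) _; apply: le_trans (ler_wpM2l q0 yk) _.
  by rewrite mulrCA ler_piMr ?(ltW d0) // ler_pdivrMr // mul1r lerDl.
suff Mz : M z by exact: Mz.
rewrite (_ : z = proj M z); first exact: proj_in.
apply/eqP; rewrite -subr_eq0; apply/eqP/pi_nondeg => a.
have Ba := closure_rep pi_rep a; apply: (@orth_self _ _ M).
  rewrite (linB _ _ (closure_linear Ba)); apply: (subspaceB cM).
    by move=> d d0; exists (pi a) => //; rewrite subrr rnorm0 ltW.
  by apply: MB; exact: proj_in.
move=> y My; rewrite (rep_adj pi_rep); apply: (proj_orth cM).
exact: MB.
Qed.

(** If the estimate fails then, by the approximate unit, it fails at a vector
    [k z], so that some character with [|tau g - c| > d] sees [z]. But [z] is
    killed by the elements supported where [|tau g - c| > d]. *)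
Lemma range_open_estimate g c d z : B g -> 0 <= d ->
  range_open [set s : sp pi | rnorm (ev s g - c : R[i]^o) < d] z ->
  rnorm (g z - c *: z) <= d * rnorm z.
Proof.
move=> Bg d0; set V := [set s : sp pi | _] => Vz.
have lg := closure_linear Bg.
have cyc k : B k -> rnorm (g (k z) - c *: k z) <= d * rnorm (k z).
  move=> Bk; rewrite leNgt; apply/negP => bad.
  have [k' Bk' ak] := closure_adj pi_rep Bk.
  pose G := (g \o k) - c *: k.
  have Bgk : B (g \o k) by exact: closure_comp.
  have BG : B G by apply: (closureB pi_rep) => //; exact: closureZ.
  have [G' BG' aG] := closure_adj pi_rep BG.
  have Bkk : B (k' \o k) by exact: closure_comp.
  have BGG : B (G' \o G) by exact: closure_comp.
  pose f := (d ^+ 2)%:C *: (k' \o k) - (G' \o G).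
  have Bf : B f by apply: (closureB pi_rep) => //; exact: closureZ.
  have af : is_adjoint f f.
    apply: adjD; first by apply: adj_real; apply: adj_comp => //; exact: is_adjointC.
    by apply: adjN; apply: adj_comp => //; exact: is_adjointC.
  have fz : ip (f z) z < 0.
    rewrite /f !fctE ipDl ipNl ipZl /= [ip (k' _) _]/ip ak -/(ip _ _).
    rewrite [ip (G' _) _]/ip aG -/(ip _ _) -!rnorm_sqr subr_lt0 -exprMn.
    by rewrite ltr_pXn2r // nnegrE ?mulr_ge0 ?rnorm_ge0.
  have [s [[r r0 sr] s0]] := vector_ev pi_rep Bf af fz.
  have sE : ev s f = (rnorm (ev s k : R[i]^o) ^+ 2 *
      (d ^+ 2 - rnorm (ev s g - c : R[i]^o) ^+ 2))%:C.
    rewrite (charB pi_rep (evP s) (closureZ pi_rep _ Bkk) BGG) (charZ (evP s)) //.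
    rewrite (char_adjM pi_rep (evP s) Bk Bk' ak) (char_adjM pi_rep (evP s) BG BG' aG).
    rewrite (charB pi_rep (evP s) Bgk (closureZ pi_rep _ Bk)) (charZ (evP s)) //.
    rewrite (charM (evP s) Bg Bk) -mulrBl rnormM exprMn.
    by rewrite -rmorphM -rmorphB; congr (_%:C); ring.
  pose W := [set s : sp pi | d < rnorm (ev s g - c : R[i]^o)].
  have oW : open W by exact: open_ev_gt.
  have Ws : W s.
    rewrite /W /= ltNge; apply/negP => h; move: r0; apply/negP; rewrite -leNgt.
    move: sr; rewrite sE => -[<-]; rewrite mulr_ge0 ?sqr_ge0 // subr_ge0.
    by rewrite ler_pXn2r // nnegrE rnorm_ge0.
  have [u [Bu su u0]] := sp_urysohn pi_rep oW Ws.
  have VW : W `&` V = set0.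
    by rewrite -subset0 => t [/= h1 h2]; have := lt_trans h1 h2; rewrite ltxx.
  have NW : null W z.
    apply: popen_eq0; rewrite -[z in popen W z](proj_id (range_open_closed V) Vz).
    by rewrite -/(popen V z) popenI // VW popen_set0.
  by move: su; rewrite (s0 u Bu) ?eqxx //; apply: NW.
have [q q0 bq] := BH_bnd (closure_BH Bg).
apply: ler_eps => e e0; pose r := q + rnorm (c : R[i]^o) + d + 1.
have r0 : 0 < r by rewrite ltr_wpDl // !addr_ge0 ?rnorm_ge0.
have [k Bk zk] := approximate_unit z (divr_gt0 e0 r0).
have h1 := cyc k Bk.
have h2 : rnorm (g (z - k z) - c *: (z - k z)) <= (q + rnorm (c : R[i]^o)) * rnorm (z - k z).
  by apply: le_trans (rnormD _ _) _; rewrite rnormN rnormZ mulrDl lerD2r.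
have h3 : rnorm (k z) <= rnorm z + rnorm (z - k z).
  by have := rnormB_tri 0 z (k z); rewrite !sub0r !rnormN.
have -> : g z - c *: z = (g (z - k z) - c *: (z - k z)) + (g (k z) - c *: k z).
  by rewrite (linB _ _ lg); vector_ring.
apply: le_trans (rnormD _ _) _; apply: le_trans (lerD h2 h1) _.
have h4 := ler_wpM2l d0 h3; have h5 : rnorm (z - k z) * r <= e by rewrite -ler_pdivlMr.
have h6 := rnorm_ge0 (z - k z).
move: h4 h5 h6; rewrite /r; set p := rnorm (z - k z); set a := rnorm (k z).
set b := rnorm z; set u := rnorm _; clear; nra.
Qed.

(** The range of [spec w] lies in that of [popen V] for every open [V] around [w],
    among which are the sets where [g] is at distance less than [d' > d] from
    [c]. *)
Lemma spec_estimate g c d w x : B g -> 0 <= d ->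
  (forall s, w s -> rnorm (ev s g - c : R[i]^o) <= d) ->
  rnorm (g (spec w x) - c *: spec w x) <= d * rnorm (spec w x).
Proof.
move=> Bg d0 wd; apply: ler_eps => e e0; set z := spec w x.
have r0 : 0 < rnorm z + 1 by rewrite ltr_wpDl // rnorm_ge0.
pose d' := d + e / (rnorm z + 1).
have dd' : d < d' by rewrite ltrDl divr_gt0.
have d'0 : 0 <= d' by rewrite (le_trans d0) // ltW.
have Vz : range_open [set s : sp pi | rnorm (ev s g - c : R[i]^o) < d'] z.
  apply: (@spec_in _ _ _ _ w x); split; first exact: open_ev_lt.
  by move=> s /wd /= h; exact: le_lt_trans dd'.
apply: le_trans (range_open_estimate Bg d'0 Vz) _.
rewrite mulrDl lerD2l mulrAC ler_pdivrMr //.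
by rewrite ler_pM2l // lerDl.
Qed.

(** [x] is close to some [pi a x], and [pi a] is small on the projection of the
    set where [hat pi a] is small, the complement of a compact set. *)
Lemma tight x e : 0 < e -> exists2 K : set (sp pi), compact K & mopen x (~` K) <= e.
Proof.
move=> e0; pose q : R := Num.sqrt e; have q0 : 0 < q by rewrite sqrtr_gt0.
have q2 : 0 < q / 2 by rewrite divr_gt0.
have q4 : 0 < q / 2 / 2 by rewrite divr_gt0.
have [k /(closureP pi_rep)[_ hk] xk] := approximate_unit x q4.
have n1 : 0 < rnorm x + 1 by rewrite ltr_wpDl // rnorm_ge0.
have [a ka] := hk _ (divr_gt0 q4 n1).
have xa : rnorm (x - pi a x) <= q / 2.
  apply: le_half (rnormB_tri x (k x) (pi a x)) xk _; apply: le_trans (ka x) _.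
  by rewrite mulrAC ler_pdivrMr // ler_pM2l // lerDl.
pose d : R := q / 2 / (rnorm x + 1); have d0 : 0 < d by rewrite divr_gt0.
exists [set s : sp pi | d <= rnorm (hat pi a s : R[i]^o)]; first exact: sp_compact.
have Ba := closure_rep pi_rep a.
have -> : ~` [set s : sp pi | d <= rnorm (hat pi a s : R[i]^o)] =
    [set s : sp pi | rnorm (ev s (pi a) - 0 : R[i]^o) < d].
  apply/seteqP; split=> s /=; rewrite ev_rep subr0 ltNge; first by move/negP.
  by move/negP.
set V := [set s : sp pi | _]; rewrite -[e](sqr_sqrtr (ltW e0)).
rewrite /mopen ler_pXn2r // ?nnegrE ?rnorm_ge0 ?(ltW q0) //.
have h1 := @range_open_estimate (pi a) 0 d _ Ba (ltW d0) (@popen_in _ _ _ _ V x).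
rewrite scale0r subr0 in h1.
have h2 : rnorm (popen V x) <= rnorm x by exact: (proj_le (range_open_closed V)).
have -> : popen V x = popen V (x - pi a x) + pi a (popen V x).
  rewrite (popen_closureC pi_rep) // (linB _ _ (popen_linear V)); vector_ring.
apply: le_half (rnormD _ _) _ _.
  by apply: le_trans xa; exact: (proj_le (range_open_closed V)).
apply: le_trans h1 _; apply: le_trans (ler_wpM2l (ltW d0) h2) _.
by rewrite /d mulrAC ler_pdivrMr // ler_pM2l // lerDl.
Qed.

(** Regularity gives closed sets inside [w]; tightness cuts them down to compact
    ones. *)
Lemma spec_inner_regular x : inner_regular (diag_measure (@spec R A H pi) x).
Proof.
move=> w bw; have dE v : diag_measure (@spec R A H pi) x v = (mspec x v)%:E.
  by rewrite /diag_measure mspecE.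
apply/eqP; rewrite eq_le; apply/andP; split; last first.
  apply: ge_ereal_sup => _ [K [cK Kw] <-]; rewrite !dE lee_fin; exact: mspecS.
apply/lee_addgt0Pr => e e0; have e2 : 0 < e / 2 by rewrite divr_gt0.
have [C [U [cC oU Cw wU h1]]] := borel_approx pi_rep pi_nondeg x bw e2.
have [K cK hK] := tight x e2.
have clK : closed K by apply: compact_closed => //; exact: sp_hausdorff.
have cKC : compact (K `&` C) by exact: compact_closedI.
apply: (@le_trans _ _ (diag_measure (@spec R A H pi) x (K `&` C) + e%:E)%E); last first.
  rewrite leeD2r //; apply: ereal_sup_ubound; exists (K `&` C) => //; split => //.
  by move=> s [_ /Cw].
rewrite !dE -EFinD lee_fin.
have h2 : mspec x w <= mopen x U by rewrite -mspec_open //; exact: mspecS.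
have h3 : mspec x (K `&` C) = rnorm x ^+ 2 - mopen x (~` K `|` ~` C).
  by rewrite mspec_closed // ?setCI //; exact: closedI.
have h4 := mopenU_le pi_rep x (closed_openC clK) (closed_openC cC).
have h5 := mspec_closed pi_rep pi_nondeg x cC.
move: h1 h2 h3 h4 h5 hK; set a := mspec x w; set b := mopen x U; set u := mspec x C.
set p := mspec x (K `&` C); set q := mopen x _; set r := mopen x _; set l := mopen x _.
set n := rnorm x ^+ 2; clear; lra.
Qed.

End SpectralEstimate.

(** * Integration of step functions against a spectral measure *)

Section SpectralMeasure.
Context {R : realType} {H : hilbertType R} {Omega : Type}.
Variables (E : set (set Omega)) (Q : set Omega -> H -> H).
Hypothesis QM : spectral_measure E Q.
Implicit Types (x y : H) (w : set Omega) (f h : Omega -> R[i]) (T b : H -> H).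

Let sE : sigma_algebra setT E. Proof. by case: QM. Qed.
Let Qproj w : E w -> orthogonal_projection (Q w). Proof. by case: QM => _ _ h _ _; exact: h. Qed.

Lemma spectral_BH w : E w -> BH (Q w). Proof. by move=> /Qproj[]. Qed.
Lemma spectral_linear w : E w -> linear (Q w). Proof. by move=> /spectral_BH/BH_linear. Qed.
Lemma spectral_idem w x : E w -> Q w (Q w x) = Q w x.
Proof. by move=> /Qproj[_ h _]; rewrite -[LHS]/((Q w \o Q w) x) h. Qed.
Lemma spectral_adj w : E w -> is_adjoint (Q w) (Q w). Proof. by move=> /Qproj[]. Qed.
Lemma spectral_setT x : Q setT x = x. Proof. by case: QM => _ _ _ -> _. Qed.

Lemma spectral_sqr w x : E w -> ip (Q w x) x = rnorm (Q w x) ^+ 2.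
Proof. by move=> Ew; rewrite rnorm_sqr /ip -(spectral_adj Ew) spectral_idem. Qed.

Let mass x w : R := rnorm (Q w x) ^+ 2.

Let diagE x w : E w -> diag_measure Q x w = (mass x w)%:E.
Proof. by move=> Ew; rewrite /diag_measure /mass -spectral_sqr. Qed.

Lemma spectral_set0 x : Q set0 x = 0.
Proof.
apply: ip_eq0; rewrite -rnorm_sqr; case: QM => _ _ _ _ /(_ x)[m0 _ _].
by move: m0; rewrite diagE; [move=> -[]|exact: (sigma_set0 sE)].
Qed.

Let massU x v w : E v -> E w -> v `&` w = set0 -> mass x (v `|` w) = mass x v + mass x w.
Proof.
move=> Ev Ew vw; case: QM => _ _ _ _ /(_ x)[_ _ sm].
have EF n : E (bigcup2 v w n) by case: n => [|[|n]] //=; exact: (sigma_set0 sE).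
have tF : trivIset setT (bigcup2 v w).
  have E1 := (sigma_set0 sE).
  move=> [|[|i]] [|[|j]] _ _ //=.
  - by rewrite vw => -[].
  - by rewrite setI0 => -[].
  - by rewrite setIC vw => -[].
  - by rewrite setI0 => -[].
  - by rewrite set0I => -[].
  - by rewrite set0I => -[].
  - by rewrite setI0 => -[].
have := sm _ EF tF; rewrite bigcup2E diagE; last exact: (sigma_setU sE).
set u := (fun n => _) => uc.
have uc2 : u @ \oo --> (mass x v + mass x w)%:E.
  apply: cvg_near_cst; exists 2%N => // n /= n2.
  rewrite /u -(subnK n2) addn2 big_nat_recl // big_nat_recl //= !diagE //; last first.
    exact: (sigma_set0 sE).
  by rewrite big1 ?adde0 // => i _; rewrite /mass spectral_set0 rnorm0 expr0n.
by apply: EFin_inj; exact: (cvg_unique (@ereal_hausdorff R) uc uc2).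
Qed.

Lemma quadratic_eq0 T : linear T -> is_adjoint T T -> (forall x, ip (T x) x = 0) ->
  forall x, T x = 0.
Proof.
move=> lT aT T0 x; apply: ip_eq0.
have := T0 (x + T x); rewrite (linD _ _ lT) !(ipDl, ipDr) !T0 add0r addr0.
by rewrite [ip (T (T x)) x]/ip aT -/(ip (T x) (T x)) => h; lra.
Qed.

Lemma spectralU v w x : E v -> E w -> v `&` w = set0 ->
  Q (v `|` w) x = Q v x + Q w x.
Proof.
move=> Ev Ew vw; have Evw := sigma_setU sE Ev Ew.
have := @quadratic_eq0 (Q (v `|` w) - (Q v + Q w)) _ _ _ x.
rewrite !fctE => h; apply/eqP; rewrite -subr_eq0; apply/eqP/h.
- by apply: BH_linear; apply: BH_B; [|apply: BH_D]; exact: spectral_BH.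
- apply: adjD; first exact: spectral_adj.
  by apply/adjN/adjD; exact: spectral_adj.
move=> y; rewrite ipDl ipNl ipDl !spectral_sqr //.
by rewrite -/(mass y _) massU // /mass subrr.
Qed.

(** A sum of two projections can only be a projection if their ranges are
    orthogonal. *)
Lemma spectral_disjoint v w x : E v -> E w -> v `&` w = set0 -> Q v (Q w x) = 0.
Proof.
move=> Ev Ew vw; set y := Q w x; have Evw := sigma_setU sE Ev Ew.
have yy : Q w y = y by exact: spectral_idem.
have le1 : rnorm (Q (v `|` w) y) ^+ 2 <= rnorm y ^+ 2.
  have := massU y Evw (sigma_setC sE Evw) (setICr _); rewrite setUCr /mass spectral_setT => ->.
  by rewrite lerDl sqr_ge0.
apply: ip_eq0; rewrite -rnorm_sqr; apply/eqP; rewrite eq_le sqr_ge0 andbT.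
have := massU y Ev Ew vw; rewrite /mass yy => h; rewrite h in le1.
by move: le1; rewrite gerDr.
Qed.

Lemma spectralI v w x : E v -> E w -> Q v (Q w x) = Q (v `&` w) x.
Proof.
move=> Ev Ew; have Evw := sigma_setI sE Ev Ew.
have Ew' := sigma_setD sE Ew Ev; have Ev' := sigma_setD sE Ev Ew.
have wE : w = (v `&` w) `|` (w `\` v) by rewrite setIC setDE -setIUr setUCr setIT.
have vE : v = (v `&` w) `|` (v `\` w) by rewrite setDE -setIUr setUCr setIT.
have d1 : (v `&` w) `&` (w `\` v) = set0.
  by rewrite -subset0 => s [[vs _] [_ /(_ vs)]].
have d2 : (v `&` w) `&` (v `\` w) = set0.
  by rewrite -subset0 => s [[_ ws] [_ /(_ ws)]].
rewrite {1}wE spectralU // (linD _ _ (spectral_linear Ev)).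
rewrite (@spectral_disjoint v (w `\` v)) ?addr0 //; last by rewrite setDE setICA setICr setI0.
rewrite {1}vE spectralU // spectral_idem // (@spectral_disjoint (v `\` w)) ?addr0 //.
by rewrite setIC.
Qed.

Lemma spectralC v w x : E v -> E w -> Q v (Q w x) = Q w (Q v x).
Proof. by move=> Ev Ew; rewrite !spectralI // setIC. Qed.

Lemma spectralS_eq0 v w x : E v -> E w -> v `<=` w -> Q w x = 0 -> Q v x = 0.
Proof.
move=> Ev Ew /setIidPl <- w0; rewrite -spectralI // w0.
exact: lin0 (spectral_linear Ev).
Qed.

Lemma spectral_cover_eq0 v w x : E v -> E w -> Q v x = 0 -> Q w x = 0 ->
  Q (v `|` w) x = 0.
Proof.
move=> Ev Ew v0 w0; have Ew' := sigma_setD sE Ew Ev.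
have -> : v `|` w = v `|` (w `\` v).
  apply/seteqP; split=> s; last by move=> [|[]]; [left|right].
  move=> [|ws]; first by left.
  by have [vs|nvs] := pselect (v s); [left|right].
rewrite spectralU //; last by rewrite setDE setICA setICr setI0.
rewrite v0 add0r; apply: spectralS_eq0 w0 => //; exact: subDsetl.
Qed.

(** ** Step functions *)

Local Notation step := (step_fun E).

Definition levels h : seq R[i] := xget [::] [set s | uniq s /\ range h = [set` s]].

Lemma levelsP h : step h -> uniq (levels h) /\ range h = [set` levels h].
Proof.
move=> [/finite_seqP[s hs] _]; rewrite /levels; case: xgetP => [t -> //|no].
case: (no (undup s)); split; first exact: undup_uniq.
by rewrite hs; apply/seteqP; split=> z /=; rewrite mem_undup.
Qed.

Lemma preimage_cons h z (s : seq R[i]) :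
  h @^-1` [set` z :: s] = h @^-1` [set z] `|` h @^-1` [set` s].
Proof.
apply/seteqP; split=> t /=; rewrite in_cons.
  by move=> /orP[/eqP|]; [left|right].
by move=> [->|->]; rewrite ?eqxx ?orbT.
Qed.

Lemma preimage_seq_measurable h (s : seq R[i]) : step h -> E (h @^-1` [set` s]).
Proof.
move=> [_ hE]; elim: s => [|z s IHs].
  rewrite (_ : _ @^-1` _ = set0); first exact: (sigma_set0 sE).
  by rewrite -subset0 => t.
rewrite preimage_cons; exact: (sigma_setU sE).
Qed.

(** The level sets give an orthogonal decomposition of the space, along which the
    squares of norms add up. *)
Lemma step_norm_le h x y (d : R) : step h -> 0 <= d ->
  (forall z, rnorm (Q (h @^-1` [set z]) y) <= d * rnorm (Q (h @^-1` [set z]) x)) ->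
  rnorm y <= d * rnorm x.
Proof.
move=> sh d0 hd; have [us rs] := levelsP sh; have [_ hE] := sh.
have seq_le s : uniq s -> mass y (h @^-1` [set` s]) <= d ^+ 2 * mass x (h @^-1` [set` s]).
  elim: s => [|z s IHs] /=.
    have -> : h @^-1` [set` [::]] = set0 by rewrite -subset0 => t.
    by rewrite /mass !spectral_set0 rnorm0 expr0n mulr0.
  move=> /andP[zs us'].
  rewrite preimage_cons.
  have Es := preimage_seq_measurable s sh.
  have dis : h @^-1` [set z] `&` h @^-1` [set` s] = set0.
    by rewrite -subset0 => t [/= -> zs']; rewrite zs' in zs.
  rewrite !massU // mulrDr; apply: lerD; last exact: IHs.
  by rewrite /mass -exprMn ler_pXn2r // ?nnegrE ?mulr_ge0 ?rnorm_ge0.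
have := seq_le _ us; rewrite -rs (_ : h @^-1` _ = setT).
  rewrite /mass !spectral_setT -exprMn => h2.
  by apply: rnorm_sqr_le => //; rewrite mulr_ge0 // rnorm_ge0.
by apply/seteqP; split=> // t _; exists t.
Qed.

Lemma step_eq h x y : step h ->
  (forall z, Q (h @^-1` [set z]) x = Q (h @^-1` [set z]) y) -> x = y.
Proof.
move=> sh hxy; apply/eqP; rewrite -subr_eq0; apply/eqP/rnorm_le0.
have := @step_norm_le h 0 (x - y) 0 sh (lexx _); rewrite mul0r; apply => z.
by rewrite (linB _ _ (spectral_linear (sh.2 z))) hxy subrr rnorm0 mul0r.
Qed.

Definition step_integral h x : H := \sum_(z <- levels h) z *: Q (h @^-1` [set z]) x.

Lemma spectral_sum w (s : seq R[i]) (F : R[i] -> H) : E w ->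
  Q w (\sum_(z <- s) F z) = \sum_(z <- s) Q w (F z).
Proof.
move=> Ew; have lw := spectral_linear Ew.
elim: s => [|z s IHs]; first by rewrite !big_nil (lin0 lw).
by rewrite !big_cons (linD _ _ lw) IHs.
Qed.

Lemma step_integral_level h z x : step h ->
  Q (h @^-1` [set z]) (step_integral h x) = z *: Q (h @^-1` [set z]) x.
Proof.
move=> sh; have [us rs] := levelsP sh; have [_ hE] := sh.
have dis (u u' : R[i]) : u != u' -> h @^-1` [set u] `&` h @^-1` [set u'] = set0.
  by move=> uv; rewrite -subset0 => t [/= -> /eqP]; exact/negP.
rewrite /step_integral spectral_sum //.
have [zs|nzs] := boolP (z \in levels h).
  rewrite (bigD1_seq z) //= big1 ?addr0 => [|u uz].
    by rewrite (linZ _ _ (spectral_linear (hE z))) spectral_idem.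
  rewrite (linZ _ _ (spectral_linear (hE z))) spectral_disjoint ?scaler0 //.
  by apply: dis; rewrite eq_sym.
have -> : h @^-1` [set z] = set0.
  rewrite -subset0 => t /= tz; have : range h z by exists t.
  by rewrite rs /= (negPf nzs).
rewrite spectral_set0 scaler0 big1 // => u _.
by rewrite (linZ _ _ (spectral_linear (sigma_set0 sE))) spectral_set0 scaler0.
Qed.

Lemma step_integral_in h w (c : R[i]) x : step h -> E w -> (forall s, w s -> h s = c) ->
  Q w (step_integral h x) = c *: Q w x.
Proof.
move=> sh Ew hw; have Ec := sh.2 c.
have wE : w = w `&` h @^-1` [set c] by apply/esym/setIidPl => s /hw.
rewrite wE -!spectralI // step_integral_level //.
by rewrite (linZ _ _ (spectral_linear Ew)).
Qed.

Lemma step_integral_comm T h : BH T -> step h ->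
  (forall w, E w -> forall x, T (Q w x) = Q w (T x)) ->
  forall x, T (step_integral h x) = step_integral h (T x).
Proof.
move=> BT sh TQ x; have lT := BH_linear BT; rewrite /step_integral.
elim: (levels h) => [|z s IHs]; first by rewrite !big_nil (lin0 lT).
by rewrite !big_cons (linD _ _ lT) IHs (linZ _ _ lT) TQ //; exact: sh.2.
Qed.

Lemma step_integral_BH h : step h -> BH (step_integral h).
Proof.
move=> sh; have -> : step_integral h =
    \sum_(z <- levels h) z *: Q (h @^-1` [set z]).
  by apply/funext => x; rewrite fct_sumE.
elim: (levels h) => [|z s IHs]; first by rewrite big_nil; exact: BH_0.
rewrite big_cons; apply: BH_D => //; apply: BH_Z; apply: spectral_BH; exact: sh.2.
Qed.

Lemma indic_preimage1 w : (\1_w : Omega -> R[i]) @^-1` [set 1] = w.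
Proof.
apply/seteqP; split=> s /=; rewrite indicE; last by move=> ws; rewrite mem_set.
by case: (boolP (s \in w)) => [/set_mem //|_ /eqP]; rewrite eq_sym oner_eq0.
Qed.

Lemma indic_preimage w (z : R[i]) : E w -> E ((\1_w : Omega -> R[i]) @^-1` [set z]).
Proof.
move=> Ew; have [->|z1] := eqVneq z 1.
  by rewrite indic_preimage1.
have [->|z0] := eqVneq z 0.
  rewrite (_ : _ @^-1` _ = ~` w); first exact: (sigma_setC sE).
  apply/seteqP; split=> s /=; rewrite indicE.
    by move=> + ws; rewrite mem_set // => /eqP; rewrite oner_eq0.
  by move=> ws; rewrite memNset.
rewrite (_ : _ @^-1` _ = set0); first exact: (sigma_set0 sE).
rewrite -subset0 => s /=; rewrite indicE => zE.
by move: z0 z1; rewrite -zE; case: (s \in w); rewrite eqxx.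
Qed.

Lemma step_indic w : E w -> step (\1_w : Omega -> R[i]).
Proof.
move=> Ew; split; last by move=> z; exact: indic_preimage.
apply: (sub_finite_set (B := [set` [:: 0; 1]])); last exact: finite_seq.
by move=> _ [s _ <-]; rewrite /= indicE; case: (s \in w); rewrite !inE eqxx ?orbT.
Qed.

Lemma step_comp2 (G : R[i] -> R[i] -> R[i]) f h : step f -> step h ->
  step (fun s => G (f s) (h s)).
Proof.
move=> [ff fE] [fh hE]; split.
  apply: (sub_finite_set (B := [set G u v | u in range f & v in range h])).
    by move=> _ [s _ <-]; exists (f s); [exists s|exists (h s) => //; exists s].
  exact: finite_image2.
move=> z; have [uf rf] := levelsP (conj ff fE); have [uh rh] := levelsP (conj fh hE).
pose t := [seq p <- [seq (u, v) | u <- levels f, v <- levels h] | G p.1 p.2 == z].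
have -> : (fun s => G (f s) (h s)) @^-1` [set z] =
    \big[setU/set0]_(p <- t) (f @^-1` [set p.1] `&` h @^-1` [set p.2]).
  rewrite -bigcup_seq; apply/seteqP; split=> s /=.
    move=> Gz; exists (f s, h s) => //=; rewrite mem_filter /= Gz eqxx /=.
    have fs : range f (f s) by exists s.
    have hs : range h (h s) by exists s.
    by rewrite rf in fs; rewrite rh in hs; apply/allpairsP; exists (f s, h s).
  by move=> [[u v] /=]; rewrite mem_filter => /andP[/eqP <- _] [-> ->].
elim: t => [|p t IHt]; first by rewrite big_nil; exact: (sigma_set0 sE).
by rewrite big_cons; apply: (sigma_setU sE) => //; exact: (sigma_setI sE).
Qed.

Lemma step_integral_linear (k : R[i]) f h : step f -> step h ->
  step_integral (k *: (f : Omega -> R[i]^o) + h) = k *: step_integral f + step_integral h.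
Proof.
move=> sf sh; have sg := step_comp2 (fun u v => k * u + v) sf sh.
set g := fun s => _ in sg.
rewrite (_ : k *: _ + h = g) //; apply/funext => x.
apply: (step_eq sf) => u; apply: (step_eq sh) => v.
have Eu := sf.2 u; have Ev := sh.2 v; have Euv := sigma_setI sE Ev Eu.
rewrite !spectralI //; set w := h @^-1` _ `&` _ in Euv *.
rewrite (@step_integral_in g w (k * u + v)) //; last by move=> s [/= <- <-].
rewrite !fctE (linD _ _ (spectral_linear Euv)) (linZ _ _ (spectral_linear Euv)).
rewrite (@step_integral_in f w u) //; last by move=> s [].
rewrite (@step_integral_in h w v) //; last by move=> s [].
by rewrite scalerDl scalerA.
Qed.

Lemma step_integral_indic w : E w -> step_integral \1_w = Q w.
Proof.
move=> Ew; apply/funext => x; apply: (step_eq (step_indic Ew)) => z.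
have Ez := indic_preimage z Ew; rewrite step_integral_level //; last exact: step_indic.
have [->|z1] := eqVneq z 1.
  by rewrite scale1r indic_preimage1 spectral_idem.
have [zE|z0] := eqVneq z 0.
  rewrite {1}zE scale0r spectral_disjoint // -subset0 => s [/= + ws].
  by rewrite indicE mem_set // zE => /eqP; rewrite oner_eq0.
have -> : (\1_w : Omega -> R[i]) @^-1` [set z] = set0.
  rewrite -subset0 => s /=; rewrite indicE => zE.
  by move: z0 z1; rewrite -zE; case: (s \in w); rewrite eqxx.
by rewrite !spectral_set0 scaler0.
Qed.

Lemma step_integralP : is_step_integral E Q step_integral.
Proof. by split; [exact: step_integral_linear|exact: step_integral_indic]. Qed.

Lemma step_decomp h : step h ->
  h = \sum_(z <- levels h) z *: (\1_(h @^-1` [set z]) : Omega -> R[i]^o).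
Proof.
move=> sh; have [us rs] := levelsP sh; apply/funext => s; rewrite fct_sumE.
have hs : h s \in levels h by have : range h (h s); [exists s|rewrite rs].
rewrite (bigD1_seq (h s)) //= big1 ?addr0 => [|u uz].
  by rewrite fctE indicE mem_set //= -[RHS]/(h s * 1) mulr1.
rewrite fctE indicE memNset /=; last by move=> hu; rewrite hu eqxx in uz.
by rewrite -[LHS]/(u * 0) mulr0.
Qed.

(** Step functions are linear combinations of indicators of their level sets. *)
Lemma step_integral_unique I h : is_step_integral E Q I -> step h -> I h = step_integral h.
Proof.
move=> [Il I1] sh; have [Jl J1] := step_integralP.
have s0 : step (0 : Omega -> R[i]^o).
  by have := step_indic (sigma_set0 sE); rewrite indic0.
have I0 : I (0 : Omega -> R[i]^o) = 0.
  have := I1 set0 (sigma_set0 sE); rewrite indic0 => ->.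
  by apply/funext => x; rewrite spectral_set0.
have J0 : step_integral (0 : Omega -> R[i]^o) = 0.
  have := J1 set0 (sigma_set0 sE); rewrite indic0 => ->.
  by apply/funext => x; rewrite spectral_set0.
rewrite (step_decomp sh); set t := levels h.
suff [] : step (\sum_(z <- t) z *: (\1_(h @^-1` [set z]) : Omega -> R[i]^o)) /\
  I (\sum_(z <- t) z *: (\1_(h @^-1` [set z]) : Omega -> R[i]^o)) =
  step_integral (\sum_(z <- t) z *: (\1_(h @^-1` [set z]) : Omega -> R[i]^o)) by [].
elim: t => [|z t [IHs IHt]]; first by rewrite big_nil I0 J0.
have Ez := sh.2 z; have si := step_indic Ez; rewrite big_cons; split.
  exact: (step_comp2 (fun u v => z * u + v) si IHs).
by rewrite Il // Jl // IHt I1 // J1.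
Qed.

End SpectralMeasure.

(** * Integrals in norm *)

Section NormIntegral.
Context {R : realType} {H : hilbertType R} {Omega : Type}.
Variables (E : set (set Omega)) (Q : set Omega -> H -> H).
Hypothesis QM : spectral_measure E Q.
Implicit Types (x y : H) (w : set Omega) (f h : Omega -> R[i]) (T b : H -> H).

Let sE : sigma_algebra setT E. Proof. by case: QM. Qed.

Local Notation step := (step_fun E).

Lemma open_contraction_lt (L : R[i]^o -> R) (r : R) :
  (forall u v, `|L u - L v| <= rnorm (u - v : R[i]^o)) -> open [set z | L z < r].
Proof.
move=> LL; have cL : continuous L.
  move=> z; apply/(continuous_normP L z) => e e0.
  have := (continuous_rnormP (fun u : R[i]^o => u) z).1 (@cvg_id _ _) e e0.
  by apply: filterS => u /=; exact: le_trans.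
by apply: (open_comp (f := L) (D := [set t | t < r])); [move=> *; exact: cL|exact: open_lt].
Qed.

(** The index of the cell of [f s] in a grid of mesh [d], counted from [- M]. *)
Lemma grid_measurable f (L : R[i]^o -> R) (M d : R) n :
  bounded_measurable E f -> 0 < d ->
  (forall u v, `|L u - L v| <= rnorm (u - v : R[i]^o)) ->
  (forall s, 0 <= L (f s) + M) ->
  E [set s | Num.truncn ((L (f s) + M) / d) = n].
Proof.
move=> [_ fE] d0 LL Lf.
have Elt r : E (f @^-1` [set z | L z < r]) by exact: (fE _ (@open_contraction_lt L r LL)).
have -> : [set s | Num.truncn ((L (f s) + M) / d) = n] =
    (f @^-1` [set z | L z < n.+1%:R * d - M]) `&` ~` (f @^-1` [set z | L z < n%:R * d - M]).
  apply/seteqP; split=> s /=.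
    have /truncn_itv : 0 <= (L (f s) + M) / d by rewrite divr_ge0 // ltW.
    move=> + <- => /andP[]; rewrite ler_pdivlMr // ltr_pdivrMr // => h1 h2.
    by split; [rewrite ltrBrDr|rewrite ltrBrDr; apply/negP; rewrite -leNgt].
  rewrite !ltrBrDr => -[h1 /negP]; rewrite -leNgt => h2.
  by apply/truncn_def; rewrite ler_pdivlMr // ltr_pdivrMr // h2 h1.
by apply: (sigma_setI sE) => //; exact: (sigma_setC sE).
Qed.

(** Round the real and the imaginary part of [f] down to a grid of mesh [d / 2]. *)
Lemma step_approximation f (d : R) : bounded_measurable E f -> 0 < d ->
  exists2 h, step h & forall s, rnorm (f s - h s : R[i]^o) <= d.
Proof.
move=> bf d0; have [[M hM] _] := bf.
have d2 : 0 < d / 2 by rewrite divr_gt0.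
pose kR s := Num.truncn ((complex.Re (f s) + M) / (d / 2)).
pose kI s := Num.truncn ((complex.Im (f s) + M) / (d / 2)).
pose G (i j : nat) : R[i] := (i%:R * (d / 2) - M) +i* (j%:R * (d / 2) - M).
have Re0 s : 0 <= complex.Re (f s) + M.
  have := le_trans (Re_le_rnorm (f s)) (hM s); rewrite ler_norml => /andP[h _].
  by rewrite -(opprK M) subr_ge0.
have Im0 s : 0 <= complex.Im (f s) + M.
  have := le_trans (Im_le_rnorm (f s)) (hM s); rewrite ler_norml => /andP[h _].
  by rewrite -(opprK M) subr_ge0.
have ReL (u v : R[i]^o) : `|complex.Re u - complex.Re v| <= rnorm (u - v : R[i]^o).
  by rewrite -raddfB; exact: Re_le_rnorm.
have ImL (u v : R[i]^o) : `|complex.Im u - complex.Im v| <= rnorm (u - v : R[i]^o).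
  by rewrite -raddfB; exact: Im_le_rnorm.
have ER n := grid_measurable n bf d2 ReL Re0.
have EI n := grid_measurable n bf d2 ImL Im0.
have near_grid (t : R) : 0 <= t + M ->
    `|t - ((Num.truncn ((t + M) / (d / 2)))%:R * (d / 2) - M)| <= d / 2.
  move=> t0; have /truncn_itv : 0 <= (t + M) / (d / 2) by rewrite divr_ge0 // ltW.
  set k := Num.truncn _; move=> /andP[]; rewrite ler_pdivlMr // => h1.
  rewrite ltr_pdivrMr // -[k.+1%:R]natr1 mulrDl mul1r => h2.
  by rewrite ler_norml; apply/andP; split; lra.
have grid_bound (t : R) : `|t| <= M ->
    (Num.truncn ((t + M) / (d / 2)) < (Num.truncn ((M + M) / (d / 2))).+1)%N.
  rewrite ler_norml => /andP[_ tM]; rewrite ltnS; apply: le_truncn.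
  by rewrite ler_pM2r ?invr_gt0 // lerD2r.
exists (fun s => G (kR s) (kI s)); last first.
  move=> s; apply: le_trans (rnorm_le_ReIm _) _; rewrite [d]splitr /G.
  have hR := near_grid _ (Re0 s); have hI := near_grid _ (Im0 s).
  by move: hR hI; rewrite /kR /kI; case: (f s) => a b /= hR hI; exact: lerD.
split.
  pose N := (Num.truncn ((M + M) / (d / 2))).+1.
  apply: (sub_finite_set (B := [set G i j | i in `I_N & j in `I_N])); last first.
    by apply: finite_image2; exact: finite_II.
  move=> _ [s _ <-]; exists (kR s) => /=.
    by apply: grid_bound; exact: le_trans (Re_le_rnorm _) (hM s).
  exists (kI s) => //=.
  by apply: grid_bound; exact: le_trans (Im_le_rnorm _) (hM s).
move=> z.
have -> : (fun s => G (kR s) (kI s)) @^-1` [set z] =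
    \bigcup_i \bigcup_j (if G i j == z then
       [set s | kR s = i] `&` [set s | kI s = j] else set0).
  apply/seteqP; split=> s /=.
    by move=> Gz; exists (kR s) => //; exists (kI s) => //; rewrite Gz eqxx.
  by move=> [i _ [j _]]; case: eqVneq => // <- [/= -> ->].
apply: (sigma_bigcup sE) => i; apply: (sigma_bigcup sE) => j.
case: ifP => _; last exact: (sigma_set0 sE).
exact: (sigma_setI sE (ER i) (EI j)).
Qed.

Lemma supnorm_le f (d : R) : (forall s, rnorm (f s : R[i]^o) <= d) -> supnorm f <= d.
Proof.
move=> fd; apply: ge_sup; last by move=> _ [s _ <-]; exact: fd.
by case: QM => -[s _] _ _ _ _; exists (rnorm (f s : R[i]^o)), s.
Qed.

Lemma integral_step_bound f h b (d : R) : is_integral_in_norm E Q f b -> step h ->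
  (forall s, rnorm (f s - h s : R[i]^o) <= d) -> bnd (b - step_integral Q h) d.
Proof.
move=> [_ Bb [I II Ib]] sh fh; apply: bnd_opnormS.
  by apply: BH_B => //; exact: (step_integral_BH QM).
rewrite -(step_integral_unique QM II sh); apply: le_trans (Ib h sh) _.
exact: supnorm_le.
Qed.

Lemma integral_commute f b T : is_integral_in_norm E Q f b -> BH T ->
  (forall w, E w -> forall x, T (Q w x) = Q w (T x)) -> T \o b = b \o T.
Proof.
move=> fb BT TQ; apply: commute_limit => // e e0; have [bf _ _] := fb.
have [h sh fh] := step_approximation bf e0.
exists (step_integral Q h); split; first exact: (step_integral_BH QM).
  exact: (integral_step_bound fb sh fh).
by apply/funext => x; exact: (step_integral_comm BT sh TQ).
Qed.

(** Any step function close to [f] can be given the value [c] on [w]. *)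
Lemma integral_estimate f b w (c : R[i]) (d : R) x : is_integral_in_norm E Q f b ->
  E w -> 0 < d -> (forall s, w s -> rnorm (f s - c : R[i]^o) <= d) ->
  rnorm (b (Q w x) - c *: Q w x) <= d * rnorm (Q w x).
Proof.
move=> fb Ew d0 wd; have [bf _ _] := fb.
have [h0 sh0 fh0] := step_approximation bf d0.
pose h s : R[i] := if (\1_w : Omega -> R[i]) s == 1 then c else h0 s.
have sh : step h.
  exact: (step_comp2 QM (fun u v => if u == 1 then c else v) (step_indic QM Ew) sh0).
have hw s : w s -> h s = c by move=> ws; rewrite /h indicE mem_set // eqxx.
have fh s : rnorm (f s - h s : R[i]^o) <= d.
  have [ws|nws] := pselect (w s); first by rewrite hw //; exact: wd.
  by rewrite /h indicE memNset //= eq_sym oner_eq0; exact: fh0.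
have := integral_step_bound fb sh fh (Q w x); rewrite !fctE.
suff -> : step_integral Q h (Q w x) = c *: Q w x by [].
rewrite -(step_integral_comm (spectral_BH QM Ew) sh); last first.
  by move=> v Ev y; exact: (spectralC QM).
exact: (step_integral_in QM).
Qed.

End NormIntegral.

(** * The spectral theorem *)

Section SpectralTheorem.
Context {R : realType} {A : comStarAlgType R} {H : hilbertType R}.
Variable pi : A -> H -> H.
Hypothesis H_neq0 : exists x : H, x != 0.
Hypothesis pi_rep : representation pi.
Hypothesis pi_nondeg : nondegenerate_rep pi.

Local Notation B := (norm_closure (range pi)).
Local Notation borel := (borel (sp pi)).
Local Notation P := (@spec R A H pi).
Implicit Types (s t : sp pi) (S T f g : H -> H) (e d : R) (x y : H)
  (U V W C w : set (sp pi)).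

Lemma spec_spectral : spectral_measure borel P.
Proof.
split.
- apply: contrapT => no; have [x] := H_neq0; rewrite -(spec_setT pi_rep pi_nondeg x).
  have -> : [set: sp pi] = set0 by rewrite -subset0 => s _; apply: no; exists s.
  by rewrite spec_set0 // eqxx.
- exact: borel_sigma.
- by move=> w _; exact: spec_projection.
- by apply/funext => x; rewrite spec_setT.
- by move=> x; exact: spec_measure.
Qed.

Lemma spec_decomp w x : borel w -> x = P w x + P (~` w) x.
Proof.
move=> bw; rewrite -(spectralU spec_spectral) ?setICr //; last exact: borel_setC.
by rewrite setUCr spec_setT.
Qed.

(** [T] preserves the ranges of both [P w] and [P (~` w)]. *)
Lemma spec_comm T w x : BH T -> (forall g, B g -> forall x, T (g x) = g (T x)) ->
  borel w -> T (P w x) = P w (T x).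
Proof.
move=> BT cT bw; have lT := BH_linear BT; have bw' := borel_setC bw.
have inv v y : range_proj v (T (P v y)).
  move=> U hU; apply: range_open_commute => //.
  exact: (@spec_in _ _ _ _ v y U hU).
have lP := spectral_linear spec_spectral bw.
rewrite {2}(spec_decomp x bw) (linD _ _ lT) (linD _ _ lP).
rewrite [P w (T (P w x))](proj_id (range_proj_closed w)) //.
have <- : P (~` w) (T (P (~` w) x)) = T (P (~` w) x).
  exact: (proj_id (range_proj_closed (~` w))).
by rewrite (spectral_disjoint spec_spectral) ?addr0 // setICr.
Qed.

Lemma hat_bounded_measurable a : bounded_measurable borel (hat pi a).
Proof.
split.
  have [c c0 bc] := BH_bnd (rep_BH pi_rep a); exists c => s; rewrite -ev_rep.
  by apply: (ev_norm pi_rep) => //; exact: closure_rep.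
move=> U oU; apply: borel_open.
by apply: (open_comp (f := (hat pi a : sp pi -> R[i]^o))) => // s _; exact: hat_continuous.
Qed.

Lemma step_bounded h : step_fun borel h -> exists M : R, forall s, rnorm (h s : R[i]^o) <= M.
Proof.
move=> sh; have [us rs] := levelsP sh.
exists (\sum_(z <- levels h) rnorm (z : R[i]^o)) => s.
have hs : h s \in levels h by have : range h (h s); [exists s|rewrite rs].
rewrite (bigD1_seq (h s)) //= lerDl; apply: sumr_ge0 => z _; exact: rnorm_ge0.
Qed.

(** On a level set of [h] its integral is a scalar, which [spec_estimate] compares
    with [pi a]; the projections of the level sets are orthogonal. *)
Lemma spec_integral a : is_integral_in_norm borel P (hat pi a) (pi a).
Proof.
split; [exact: hat_bounded_measurable|exact: rep_BH|].
exists (step_integral P); first exact: (step_integralP spec_spectral).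
move=> h sh; set d := supnorm _.
have le_d s : rnorm (hat pi a s - h s : R[i]^o) <= d.
  apply: ub_le_sup; last by exists s.
  have [[M hM] _] := hat_bounded_measurable a; have [N hN] := step_bounded sh.
  exists (M + N) => _ [t _ <-]; apply: le_trans (@rnormD _ R[i]^o _ _) _.
  by rewrite rnormN; apply: lerD; [exact: hM|exact: hN].
have d0 : 0 <= d.
  by case: spec_spectral => -[s _] _ _ _ _; apply: le_trans (le_d s); exact: rnorm_ge0.
have Ba := closure_rep pi_rep a; have sE := spec_spectral.
apply: opnorm_le => // x; apply: (step_norm_le sE sh d0) => z.
have bz := sh.2 z; rewrite !fctE (linB _ _ (spectral_linear sE bz)).
rewrite (step_integral_level sE) // -(spec_comm x (rep_BH pi_rep a)) //; last first.
  by move=> g Bg y; rewrite (closureC pi_rep y Ba Bg).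
apply: (spec_estimate pi_rep pi_nondeg x Ba d0) => s /= <-.
by rewrite ev_rep; exact: le_d.
Qed.

Lemma spec_represents : represents P.
Proof.
split; last exact: spec_integral.
split.
- exact: sp_hausdorff.
- exact: sp_locally_compact.
- exact: spec_spectral.
- exact: spec_inner_regular.
Qed.

(** ** Uniqueness *)

Section Uniqueness.
Variable Q : set (sp pi) -> H -> H.
Hypothesis QP : represents Q.

Let QM : spectral_measure borel Q. Proof. by case: QP => -[]. Qed.
Let Qint a : is_integral_in_norm borel Q (hat pi a) (pi a). Proof. by case: QP. Qed.

Lemma represents_comm g w x : B g -> borel w -> Q w (g x) = g (Q w x).
Proof.
move=> Bg bw; have BQ := spectral_BH QM bw.
rewrite -[LHS]/((Q w \o g) x) (closure_commute pi_rep BQ _ Bg) // => a.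
apply: (integral_commute QM (Qint a) BQ) => v bv y.
exact: (spectralC QM).
Qed.

(** [spec_estimate] for [Q]: true of the [pi a] because they are integrals, and
    passed on to the norm closure. *)
Lemma represents_estimate g w (c : R[i]) d x : B g -> borel w -> 0 < d ->
  (forall s, w s -> rnorm (ev s g - c : R[i]^o) <= d) ->
  rnorm (g (Q w x) - c *: Q w x) <= d * rnorm (Q w x).
Proof.
move=> /[dup] Bg /(closureP pi_rep)[_ hg] bw d0 wd; set y := Q w x.
apply: ler_eps => e e0; have y1 : 0 < 2 * (rnorm y + 1).
  by rewrite mulr_gt0 // ltr_wpDl // rnorm_ge0.
pose r := e / (2 * (rnorm y + 1)); have r0 : 0 < r by rewrite divr_gt0.
have [a ga] := hg r r0.
have wa s : w s -> rnorm (hat pi a s - c : R[i]^o) <= d + r.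
  move=> ws; rewrite (addrC d) -ev_rep.
  apply: le_trans (@rnormB_tri _ R[i]^o _ (ev s g) _) _; apply: lerD; last exact: wd.
  by rewrite (@rnormB _ R[i]^o); exact: (character_dist pi_rep (evP s) (ltW r0) Bg ga).
have h := integral_estimate QM x (Qint a) bw (addr_gt0 d0 r0) wa.
rewrite -/y in h; have := ga y; rewrite !fctE => h2.
apply: le_trans (rnormB_tri _ (pi a y) _) _; apply: le_trans (lerD h2 h) _.
have er : e = r * (2 * (rnorm y + 1)) by rewrite /r divfK // gt_eqF.
rewrite mulrDl addrCA lerD2l er -mulrDr; apply: ler_wpM2l; first exact: ltW.
by rewrite -mulr2n mulrDr mulr1 mulr_natl lerDl.
Qed.

(** Near a point of the compact set [K] some [g] that vanishes on [C] is close to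
    a nonzero scalar. As [g] kills [P C x], so does [Q V] for a neighbourhood [V]
    of that point, and finitely many [V] cover [K]. *)
Lemma represents_disjoint C K x : closed C -> compact K -> K `&` C = set0 ->
  Q K (P C x) = 0.
Proof.
move=> cC cK KC; have clK : closed K by apply: compact_closed => //; exact: sp_hausdorff.
have bC := borel_closed cC; have bK := borel_closed clK.
set y := P C x.
have near_zero s : K s -> exists V, [/\ open V, V s & Q V y = 0].
  move=> Ks; have nCs : (~` C) s by move=> Cs; have : (K `&` C) s by []; rewrite KC.
  have [g [Bg sg g0]] := sp_urysohn pi_rep (closed_openC cC) nCs.
  have r0 : 0 < rnorm (ev s g : R[i]^o).
    exact: (@rnorm_gt0 _ R[i]^o).
  set r := rnorm _ in r0; have r2 : 0 < r / 2 by rewrite divr_gt0.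
  pose V := [set t : sp pi | rnorm (ev t g - ev s g : R[i]^o) < r / 2].
  have oV : open V by exact: open_ev_lt.
  have bV := borel_open oV.
  exists V; split => //; first by rewrite /V /= subrr rnorm0.
  have gC : g y = 0.
    have := @spec_estimate _ _ _ _ pi_rep pi_nondeg g 0 0 C x Bg (lexx _).
    rewrite mul0r scale0r subr0 => h; apply/rnorm_le0/h => t Ct.
    by rewrite g0 ?subr0 ?rnorm0 //; apply.
  have := @represents_estimate g V (ev s g) (r / 2) y Bg bV r2 (fun t h => ltW h).
  rewrite -(represents_comm y Bg bV) gC (lin0 (spectral_linear QM bV)).
  rewrite sub0r rnormN rnormZ -/r => h; apply: rnorm_le0; move: h; set q := rnorm (Q V y).
  rewrite -subr_ge0 -mulrBl (_ : r / 2 - r = - (r / 2)); last by field.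
  by rewrite mulNr oppr_ge0 pmulr_rle0.
(* if [Q K y] is not zero, the sets that miss only a part of [K] invisible to
   [y] form a proper filter; a cluster point in [K] contradicts [near_zero] *)
pose F : set_system (sp pi) := [set W | exists V, [/\ open V, K `\` W `<=` V & Q V y = 0]].
apply: contrapT => Ky.
have PF : ProperFilter F.
  split.
    move=> [V [oV KV V0]]; apply: Ky; rewrite setD0 in KV.
    exact: (spectralS_eq0 QM bK (borel_open oV) KV).
  split.
  - exists set0; split; [exact: open0|by rewrite setDT|exact: (spectral_set0 QM)].
  - move=> W1 W2 [V1 [oV1 KV1 z1]] [V2 [oV2 KV2 z2]]; exists (V1 `|` V2); split.
    + exact: openU.
    + move=> t [Kt /not_andP[nW|nW]]; first by left; apply: KV1.
      by right; apply: KV2.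
    + by apply: (spectral_cover_eq0 QM) => //; exact: borel_open.
  - move=> W1 W2 W12 [V [oV KV z]]; exists V; split => // t [Kt nW].
    by apply: KV; split => // /W12.
have FK : F K.
  exists set0; split; [exact: open0|by rewrite setDv|exact: (spectral_set0 QM)].
have [s [Ks clus]] := cK F PF FK.
have [V [oV Vs V0]] := near_zero s Ks.
have FV : F (~` V) by exists V; split => // t [_ nV]; exact: contrapT.
have nV : nbhs s V by rewrite nbhsE; exists V.
by have [t [nVt Vt]] := clus _ _ FV nV.
Qed.

(** Inner approximations of [w] by closed sets for [P], and of [~` w] by compact
    sets for [Q], reduce this to [represents_disjoint]. *)
Lemma represents_compl w x : borel w -> P w (Q (~` w) x) = 0.
Proof.
move=> bw; have bw' := borel_setC bw.
have PQ v y : borel v -> P v (Q (~` w) y) = Q (~` w) (P v y).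
  move=> bv; symmetry; apply: spec_comm => //; first exact: (spectral_BH QM).
  by move=> g Bg z; exact: represents_comm.
have zero C y : closed C -> C `<=` w -> Q (~` w) (P C y) = 0.
  move=> cC Cw; apply/rnorm0_eq0/eqP; rewrite -sqrf_eq0 eq_le sqr_ge0 andbT.
  case: QP => -[_ _ _ regQ] _; have := regQ (P C y) _ bw'.
  rewrite /diag_measure -/(ip _ _) (spectral_sqr QM) // => E.
  rewrite -lee_fin E; apply: ge_ereal_sup => _ [K [cK Kw] <-].
  have clK : closed (K : set (sp pi)).
    by apply: compact_closed => //; exact: sp_hausdorff.
  have bK := borel_closed clK.
  rewrite -/(ip _ _) (spectral_sqr QM) // represents_disjoint //.
    by rewrite rnorm0 expr0n.
  by rewrite -subset0 => t [/Kw nw /Cw].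
set y := Q (~` w) x; apply/rnorm0_eq0/eqP; rewrite -sqrf_eq0 eq_le sqr_ge0 andbT.
apply: ler_eps => e e0; rewrite add0r.
have [C [U [cC oU Cw wU h]]] := borel_approx pi_rep pi_nondeg y bw e0.
have h1 : mspec y w <= mopen y U by rewrite -mspec_open //; exact: mspecS.
have h2 : mspec y C = 0.
  by rewrite /mspec /y PQ ?zero ?rnorm0 ?expr0n //; exact: borel_closed.
by rewrite h2 add0r in h; exact: le_trans h1 h.
Qed.

(** [P w] fixes the range of [Q w] and kills that of [Q (~` w)], by
    [represents_compl] for [~` w] and for [w]. *)
Lemma represents_unique w : borel w -> Q w = P w.
Proof.
move=> bw; have bw' := borel_setC bw; apply/funext => x.
have E1 : P (~` w) (Q w x) = 0 by rewrite -{2}(setCK w) represents_compl.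
have -> : Q w x = P w (Q w x) by rewrite {1}(spec_decomp (Q w x) bw) E1 addr0.
have E2 : x = Q w x + Q (~` w) x.
  by rewrite -(spectralU QM) ?setICr // setUCr (spectral_setT QM).
rewrite {2}E2 (linD _ _ (spectral_linear spec_spectral bw)).
by rewrite represents_compl // addr0.
Qed.

End Uniqueness.

Lemma spec_commutant : commutant (range pi) = commutant (P @` borel).
Proof.
apply/seteqP; split=> T [BT cT]; split=> // S.
  move=> [w bw <-]; apply/funext => x; apply: spec_comm => // g Bg y.
  rewrite -[LHS]/((T \o g) y) (closure_commute pi_rep BT) // => a.
  by apply: cT; exists a.
move=> [a _ <-]; apply: (integral_commute spec_spectral (spec_integral a) BT) => w bw x.
by rewrite -[LHS]/((T \o P w) x) cT //; exists w.
Qed.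

(** A nonzero element supported in [U] has its range in that of [P U]. *)
Lemma spec_support : is_support P [set: sp pi].
Proof.
exists set0; split.
- exact: open0.
- by apply/funext => x; exact: spec_set0.
- move=> U oU PU s Us; have [g [Bg sg g0]] := sp_urysohn pi_rep oU Us.
  have gz : g = 0.
    apply/funext => x; have /(proj_id (range_open_closed U)) <- : range_open U (g x).
      exact: range_open_ideal.
    by rewrite -/(popen U (g x)) -spec_open // PU.
  by rewrite gz (char0 pi_rep (evP s)) eqxx in sg.
- by rewrite setC0.
Qed.

End SpectralTheorem.

Theorem theorem35p13 (R : realType) (A : comStarAlgType R) (H : hilbertType R)
    (pi : A -> H -> H)
    (H_neq0 : exists x : H, x != 0)
    (pi_rep : representation pi)
    (pi_nondeg : nondegenerate_rep pi) :
  exists P : set (sp pi) -> H -> H,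
    [/\ represents P,
        (forall Q : set (sp pi) -> H -> H, represents Q ->
           forall w, borel (sp pi) w -> Q w = P w),
        commutant (range pi) = commutant (P @` borel (sp pi))
      & is_support P [set: sp pi]].
Proof.
exists (@spec R A H pi); split.
- exact: spec_represents.
- by move=> Q QP w bw; exact: represents_unique.
- exact: spec_commutant.
- exact: spec_support.
Qed.
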